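(* Let $\epsilon\in\mathbb R$, let $\tau$ be an irreducible representation of the dihedral group $G=I_2(m)$, and let $c$ be real-valued and close enough to $c=0$ such that the representation of $H_c(G,E)$ on $M_c(\tau)$ is irreducible and unitarisable. For $k>0$, the eigenvalues of $Z_0+\epsilon\sigma$ on the space $\mathcal H_c(\tau)_k$ of harmonics of homogeneous degree $k$ are $$\lambda(\sigma_{\tau,k})^\pm=\pm\sqrt{(k-N_c(\tau))^2-(1-\epsilon^2)\sigma_{\tau,k}^2},\qquad \sigma_{\tau,k}\in\sigma(\tau)_k .$$ The corresponding eigenvectors inside the space of harmonics $\mathcal H_c(\tau)$, and hence a basis for $\mathcal H_c(\tau)_k$, are $$h(\epsilon,\sigma_{\tau,k})^+=\mathrm{Proj}_k\big[(k-N_c(\tau)+\lambda(\sigma_{\tau,k})^+)\,\bar z^k\otimes\bar z(\sigma_{\tau,k})-\sigma_{\tau,k}(1-\epsilon)\,z^k\otimes z(\sigma_{\tau,k})\big],$$ $$h(\epsilon,\sigma_{\tau,k})^-=\mathrm{Proj}_k\big[(k-N_c(\tau)-\lambda(\sigma_{\tau,k})^-)\,z^k\otimes z(\sigma_{\tau,k})-\sigma_{\tau,k}(1+\epsilon)\,\bar z^k\otimes\bar z(\sigma_{\tau,k})\big],$$ for $\sigma_{\tau,k}\in\sigma(\tau)_k$, where the projection onto $\ker E_-$ is given by $$\mathrm{Proj}_k:p\mapsto\sum_{j=0}^{\lfloor k/2\rfloor}\frac{(-1)^j}{j!\,(N_c(\tau)-k+1)_j}E_+^jE_-^j\,p,$$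 with $(a)_j=a(a+1)\cdots(a+j-1)$ for $j>0$ and $(a)_0=1$. When the polynomial degree is $0$: for $\tau$ one-dimensional, $\epsilon$ times the element of the singleton $\sigma(\tau)_0$ is the eigenvalue of $Z_0+\epsilon\sigma$; for $\tau=\rho^{(u)}$ the eigenvalue is $0$. In both cases, the eigenvectors are given by the representation space $1\otimes V(\tau)$. All other eigenvectors of $Z_0+\epsilon\sigma$ are generated from these through the action of $E_+$.
   Context: Let $E=\mathbb R^2$ with standard Euclidean structure, orthonormal basis $\xi,\eta$ and dual basis $x,y$ of $E^*$; $z=x+iy$, $\bar z=x-iy$, $\zeta=\frac12(\xi-i\eta)$, $\bar\zeta=\frac12(\xi+i\eta)$. $G=I_2(m)$ is the dihedral group of order $2m$ generated by the reflections $s_1,\dots,s_m$, where $s_j$ is the reflection in the root $\alpha_j=\sin(\pi j/m)\xi-\cos(\pi j/m)\eta$; put $a_j=\sin(\pi j/m)x-\cos(\pi j/m)y$. $c$ is a conjugation-invariant function on the reflections. $H_c(G,E)$ is the quotient of $T(E_{\mathbb C}\oplus E_{\mathbb C}^* )\rtimes G$ (where $gX=(g\cdot X)g$) by the relations that elements of $E$ commute, elements of $E^*$ commute, and $[\xi',x']=\langle x',\xi'\rangle-2\sum_{j=1}^m c(s_j)\langle x',\alpha_j\rangle\langle a_j,\xi'\rangle s_j$ for $\xi'\in E$, $x'\in E^*$. Put $\sigma=\sum_{j=1}^m c(s_j)s_j$ and $$E_+=\tfrac12z\bar z,\quad E_-=-2\zeta\bar\zeta,\quad H=z\zeta+\bar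 z\bar\zeta+1-\sigma,\quad Z_0=\bar z\bar\zeta-z\zeta .$$ For an irreducible $\mathbb C[G]$-module $\tau$ on $V(\tau)$, $M_c(\tau)=H_c(G,E)\otimes_{G\ltimes\mathbb C[E^*]}V(\tau)\cong\mathbb C[E]\otimes V(\tau)$ is the standard module, induced from $V(\tau)$ with $E\subset H_c(G,E)$ acting on $V(\tau)$ by zero; $\mathbb C[E]=\mathbb C[z,\bar z]$. $M_c(\tau)_k=\mathbb C[E]_k\otimes V(\tau)$ is its degree-$k$ part; $\mathcal H_c(\tau)_k=M_c(\tau)_k\cap\ker E_-$ and $\mathcal H_c(\tau)=\ker E_-$ are the harmonics. $N_c(\tau)$ is the scalar by which $\sigma$ acts on $V(\tau)$. For real $c$, $\ast$ is the conjugate-linear anti-involution of $H_c(G,E)$ with $\xi^*=x$, $x^*=\xi$, $\eta^*=y$, $y^*=\eta$, $s_j^*=s_j$; $M_c(\tau)$ is unitarisable if its Hermitian form $\beta$, which satisfies $\beta(hp,q)=\beta(p,h^*q)$ and restricts to a $G$-invariant inner product on $V(\tau)$, is positive definite. Let $\omega=\exp(2\pi i/m)$ and, for $k\in\mathbb Z$ and $\bar u\in\mathbb Z/2$, $\sigma_{k,\bar u}=\sum_{1\le j\le m,\ j\equiv u\bmod 2}c(s_j)\omega^{kj}$, $\sigma_k=\sigma_{k,\bar0}+\sigma_{k,\bar1}$. The irreducible representations of $G$ are: $\mathrm{triv}$, $\mathrm{sign}$; if $m$ is even also $\chi_{\bar0},\chi_{\bar1}$ with $\chi_{\bar u}(s_k)=-1$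 if $k\equiv u\bmod2$ and $1$ otherwise; and, writing $m=2q$ or $m=2q-1$, the two-dimensional $\rho^{(u)}$, $u=1,\dots,q-1$, with basis (denoted) $z,\bar z$ of $V(\tau)$ and $\rho^{(u)}(s_j)z=\omega^{ju}\bar z$, $\rho^{(u)}(s_j)\bar z=\omega^{-ju}z$. Define $\sigma(\tau)_k$ by: $\sigma(\mathrm{triv})_k=\{\sigma_k\}$, $\sigma(\chi_{\bar0})_k=\{-\sigma_{k,\bar0}+\sigma_{k,\bar1}\}$, $\sigma(\chi_{\bar1})_k=\{\sigma_{k,\bar0}-\sigma_{k,\bar1}\}$, $\sigma(\mathrm{sign})_k=\{-\sigma_k\}$, $\sigma(\rho^{(u)})_k=\{\sigma_{k+u},\sigma_{k-u}\}$ (for $\rho^{(u)}$ the two members $\sigma_{k+u},\sigma_{k-u}$ are regarded as separately labelled elements even if numerically equal). For $\tau$ one-dimensional, $z(\sigma_{\tau,k})$ and $\bar z(\sigma_{\tau,k})$ both denote the single basis vector of $V(\tau)$. For $\tau=\rho^{(u)}$: $z(\sigma_{k+u})=z$, $\bar z(\sigma_{k+u})=\bar z$, $z(\sigma_{k-u})=\bar z$, $\bar z(\sigma_{k-u})=z$. *)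

(* Defs.v *)
From HB Require Import structures.
From mathcomp Require Import all_boot all_order all_algebra.
From mathcomp Require Import complex.
From mathcomp Require Import boolp classical_sets reals trigo.

Set Implicit Arguments.
Unset Strict Implicit.
Unset Printing Implicit Defensive.

Import Order.TTheory GRing.Theory Num.Theory.
Local Open Scope ring_scope.
Local Open Scope complex_scope.

(* Vectors of E are columns (coordinates along xi, eta), elements of the dual
   E^* are rows (coordinates along x, y); the pairing <f, v> is f *m v. An
   element g of O(E) acts by v |-> g *m v on E and f |-> f *m g^-1 on E^*.
   The reflections s_1, ..., s_m are indexed by i : 'I_m through j = i.+1. *)
Section Dihedral.
Variables (R : realType) (m : nat).

Definition angle (j : nat) : R := pi * j%:R / m%:R.

Definition alpha (j : nat) : 'cV[R]_2 :=
  \col_i (if i == 0 then sin (angle j) else - cos (angle j)).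

Definition coalpha (j : nat) : 'rV[R]_2 :=
  \row_i (if i == 0 then sin (angle j) else - cos (angle j)).

(* alpha j has norm 1, so this is v |-> v - 2 <a_j, v> alpha_j. *)
Definition refl (j : nat) : 'M[R]_2 := 1%:M - 2 *: (alpha j *m coalpha j).

(* The s_j are involutions: the group they generate consists of their products. *)
Inductive in_dihedral : 'M[R]_2 -> Prop :=
| in_dihedral1 : in_dihedral 1%:M
| in_dihedralM (j : 'I_m) g : in_dihedral g -> in_dihedral (refl j.+1 *m g).

Lemma in_dihedral_refl (j : 'I_m) : in_dihedral (refl j.+1).
Proof.
by rewrite -[refl _]mulmx1; apply/in_dihedralM/in_dihedral1.
Qed.

Definition conj_invariant (c : 'M[R]_2 -> R) : Prop :=
  forall g, in_dihedral g -> forall j : 'I_m,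
    c (g *m refl j.+1 *m invmx g) = c (refl j.+1).

End Dihedral.
Arguments angle {R} m j.
Arguments alpha {R} m j.
Arguments coalpha {R} m j.
Arguments refl {R} m j.
Arguments in_dihedral {R} m _.
Arguments conj_invariant {R} m c.

Notation cplx := (map_mx (real_complex _)).

(* H_c(G, E) is the associative unital C-algebra on the generators E_C, E_C^*
   and G, subject to the defining relations; it is constructed as the quotient
   of the algebra expressions in these generators by the smallest congruence
   containing the algebra axioms and the defining relations. *)
Section Cherednik.
Variables (R : realType) (m : nat) (c : 'M[R]_2 -> R).
Local Notation C := (R[i]).

Inductive Hterm : Type :=
| Tvec of 'cV[C]_2
| Tcov of 'rV[C]_2
| Tgrp (g : 'M[R]_2) of in_dihedral m g
| Tsca of C
| Tadd of Hterm & Hterm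
| Tmul of Hterm & Hterm.

Definition Trefl (j : 'I_m) : Hterm := Tgrp (in_dihedral_refl R j).

(* <f, u> - 2 \sum_j c(s_j) <f, alpha_j> <a_j, u> s_j, the value of [u, f]. *)
Definition Tcomm (u : 'cV[C]_2) (f : 'rV[C]_2) : Hterm :=
  Tadd (Tsca ((f *m u) 0 0))
    (\big[Tadd/Tsca 0]_(j < m)
       Tmul (Tsca (- 2 * (c (refl m j.+1))%:C
                   * (f *m cplx (alpha m j.+1)) 0 0
                   * (cplx (coalpha m j.+1) *m u) 0 0)) (Trefl j)).

Inductive Heq : Hterm -> Hterm -> Prop :=
| Heq_refl s : Heq s s
| Heq_sym s t : Heq s t -> Heq t s
| Heq_trans s t u : Heq s t -> Heq t u -> Heq s u
| Heq_add s s' t t' : Heq s s' -> Heq t t' -> Heq (Tadd s t) (Tadd s' t')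
| Heq_mul s s' t t' : Heq s s' -> Heq t t' -> Heq (Tmul s t) (Tmul s' t')
| HaddA s t u : Heq (Tadd s (Tadd t u)) (Tadd (Tadd s t) u)
| HaddC s t : Heq (Tadd s t) (Tadd t s)
| Hadd0 s : Heq (Tadd (Tsca 0) s) s
| HaddN s : Heq (Tadd (Tmul (Tsca (-1)) s) s) (Tsca 0)
| HmulA s t u : Heq (Tmul s (Tmul t u)) (Tmul (Tmul s t) u)
| Hmul1 s : Heq (Tmul (Tsca 1) s) s
| HmulDl s t u : Heq (Tmul (Tadd s t) u) (Tadd (Tmul s u) (Tmul t u))
| HmulDr s t u : Heq (Tmul s (Tadd t u)) (Tadd (Tmul s t) (Tmul s u))
| HscaD a b : Heq (Tsca (a + b)) (Tadd (Tsca a) (Tsca b))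
| HscaM a b : Heq (Tsca (a * b)) (Tmul (Tsca a) (Tsca b))
| HscaC a s : Heq (Tmul (Tsca a) s) (Tmul s (Tsca a))
| Hvec a u v : Heq (Tvec (a *: u + v)) (Tadd (Tmul (Tsca a) (Tvec u)) (Tvec v))
| Hcov a e f : Heq (Tcov (a *: e + f)) (Tadd (Tmul (Tsca a) (Tcov e)) (Tcov f))
| Hgrp1 (h1 : in_dihedral m 1%:M) : Heq (Tgrp h1) (Tsca 1)
| HgrpM g g' (hg : in_dihedral m g) (hg' : in_dihedral m g')
    (hgg' : in_dihedral m (g *m g')) :
    Heq (Tmul (Tgrp hg) (Tgrp hg')) (Tgrp hgg')
| HgrpV g (hg : in_dihedral m g) u :
    Heq (Tmul (Tgrp hg) (Tvec u)) (Tmul (Tvec (cplx g *m u)) (Tgrp hg))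
| HgrpF g (hg : in_dihedral m g) f :
    Heq (Tmul (Tgrp hg) (Tcov f)) (Tmul (Tcov (f *m cplx (invmx g))) (Tgrp hg))
| HvecC u v : Heq (Tmul (Tvec u) (Tvec v)) (Tmul (Tvec v) (Tvec u))
| HcovC e f : Heq (Tmul (Tcov e) (Tcov f)) (Tmul (Tcov f) (Tcov e))
| Hcomm u f :
    Heq (Tmul (Tvec u) (Tcov f)) (Tadd (Tmul (Tcov f) (Tvec u)) (Tcomm u f)).

HB.instance Definition _ := gen_eqMixin Hterm.
HB.instance Definition _ := gen_choiceMixin Hterm.

Definition Heqb : rel Hterm := fun s t => `[< Heq s t >].

Lemma Heqb_refl : reflexive Heqb.
Proof. by move=> s; apply/asboolP; exact: Heq_refl. Qed.

Lemma Heqb_sym : symmetric Heqb.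
Proof. by move=> s t; apply/asboolP/asboolP; exact: Heq_sym. Qed.

Lemma Heqb_trans : transitive Heqb.
Proof.
by move=> t s u /asboolP st /asboolP tu; apply/asboolP; exact: Heq_trans tu.
Qed.

Canonical Heqb_equiv := EquivRel Heqb Heqb_refl Heqb_sym Heqb_trans.

Definition Hc : Type := {eq_quot Heqb}%qT.
HB.instance Definition _ := Choice.on Hc.

Definition Hpi (t : Hterm) : Hc := \pi_({eq_quot Heqb})%qT t.

Lemma HpiP s t : Hpi s = Hpi t <-> Heq s t.
Proof.
split=> [/eqmodP/asboolP //|st]; apply/eqmodP/asboolP; exact: st.
Qed.

Lemma Hpi_surj (x : Hc) : {t | x = Hpi t}.
Proof. by exists (repr (x : {eq_quot Heqb}%qT)); rewrite /Hpi reprK. Qed.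

Definition Hadd (x y : Hc) : Hc := Hpi (Tadd (sval (Hpi_surj x)) (sval (Hpi_surj y))).
Definition Hmul (x y : Hc) : Hc := Hpi (Tmul (sval (Hpi_surj x)) (sval (Hpi_surj y))).
Definition Hopp (x : Hc) : Hc := Hmul (Hpi (Tsca (-1))) x.
Definition Hscale (a : C) (x : Hc) : Hc := Hmul (Hpi (Tsca a)) x.

Lemma HaddE s t : Hadd (Hpi s) (Hpi t) = Hpi (Tadd s t).
Proof.
apply/HpiP; apply: Heq_add; apply/HpiP.
- by case: (Hpi_surj (Hpi s)).
- by case: (Hpi_surj (Hpi t)).
Qed.

Lemma HmulE s t : Hmul (Hpi s) (Hpi t) = Hpi (Tmul s t).
Proof.
apply/HpiP; apply: Heq_mul; apply/HpiP.
- by case: (Hpi_surj (Hpi s)).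
- by case: (Hpi_surj (Hpi t)).
Qed.

Fact Hc_addA : associative Hadd.
Proof.
move=> x y z; have [s ->] := Hpi_surj x; have [t ->] := Hpi_surj y.
by have [u ->] := Hpi_surj z; rewrite !HaddE; apply/HpiP/HaddA.
Qed.

Fact Hc_addC : commutative Hadd.
Proof.
move=> x y; have [s ->] := Hpi_surj x; have [t ->] := Hpi_surj y.
by rewrite !HaddE; apply/HpiP/HaddC.
Qed.

Fact Hc_add0 : left_id (Hpi (Tsca 0)) Hadd.
Proof. by move=> x; have [s ->] := Hpi_surj x; rewrite HaddE; apply/HpiP/Hadd0. Qed.

Fact Hc_addN : left_inverse (Hpi (Tsca 0)) Hopp Hadd.
Proof.
move=> x; have [s ->] := Hpi_surj x.
by rewrite /Hopp HmulE HaddE; apply/HpiP/HaddN.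
Qed.

HB.instance Definition _ :=
  GRing.isZmodule.Build Hc Hc_addA Hc_addC Hc_add0 Hc_addN.

Fact Hc_mulA : associative Hmul.
Proof.
move=> x y z; have [s ->] := Hpi_surj x; have [t ->] := Hpi_surj y.
by have [u ->] := Hpi_surj z; rewrite !HmulE; apply/HpiP/HmulA.
Qed.

Fact Hc_mul1l : left_id (Hpi (Tsca 1)) Hmul.
Proof. by move=> x; have [s ->] := Hpi_surj x; rewrite HmulE; apply/HpiP/Hmul1. Qed.

Fact Hc_mul1r : right_id (Hpi (Tsca 1)) Hmul.
Proof.
move=> x; have [s ->] := Hpi_surj x; rewrite HmulE; apply/HpiP.
exact: Heq_trans (Heq_sym (HscaC 1 s)) (Hmul1 s).
Qed.

Fact Hc_mulDl : left_distributive Hmul Hadd.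
Proof.
move=> x y z; have [s ->] := Hpi_surj x; have [t ->] := Hpi_surj y.
by have [u ->] := Hpi_surj z; rewrite !(HmulE, HaddE); apply/HpiP/HmulDl.
Qed.

Fact Hc_mulDr : right_distributive Hmul Hadd.
Proof.
move=> x y z; have [s ->] := Hpi_surj x; have [t ->] := Hpi_surj y.
by have [u ->] := Hpi_surj z; rewrite !(HmulE, HaddE); apply/HpiP/HmulDr.
Qed.

(* A pzRing: that 1 != 0 in Hc is true but not needed to state anything. *)
HB.instance Definition _ := GRing.Zmodule_isPzRing.Build Hc
  Hc_mulA Hc_mul1l Hc_mul1r Hc_mulDl Hc_mulDr.

Fact Hc_scaleA a b x : Hscale a (Hscale b x) = Hscale (a * b) x.
Proof.
have [s ->] := Hpi_surj x; rewrite /Hscale !HmulE; apply/HpiP.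
apply: Heq_trans (HmulA _ _ _) _.
exact: Heq_mul (Heq_sym (HscaM a b)) (Heq_refl s).
Qed.

Fact Hc_scaleDl x : {morph Hscale^~ x : a b / a + b >-> a + b}.
Proof.
move=> a b; have [s ->] := Hpi_surj x.
rewrite /Hscale !HmulE [RHS]HaddE; apply/HpiP.
apply: Heq_trans (HmulDl _ _ _).
exact: Heq_mul (HscaD a b) (Heq_refl s).
Qed.

HB.instance Definition _ := GRing.Zmodule_isLmodule.Build C Hc
  Hc_scaleA Hc_mul1l (fun a => @Hc_mulDr (Hpi (Tsca a))) Hc_scaleDl.

Definition Hvector (u : 'cV[C]_2) : Hc := Hpi (Tvec u).
Definition Hcovector (f : 'rV[C]_2) : Hc := Hpi (Tcov f).
Definition Hrefl (j : 'I_m) : Hc := Hpi (Trefl j).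

Definition vxi : 'cV[C]_2 := delta_mx 0 0.
Definition veta : 'cV[C]_2 := delta_mx 1 0.
Definition vx : 'rV[C]_2 := delta_mx 0 0.
Definition vy : 'rV[C]_2 := delta_mx 0 1.

Definition Hxi := Hvector vxi.
Definition Heta := Hvector veta.
Definition Hx := Hcovector vx.
Definition Hy := Hcovector vy.
Definition Hz := Hcovector (vx + 'i *: vy).
Definition Hzb := Hcovector (vx - 'i *: vy).
Definition Hzeta := Hvector (2^-1 *: (vxi - 'i *: veta)).
Definition Hzetab := Hvector (2^-1 *: (vxi + 'i *: veta)).

Definition Hsigma : Hc := \sum_(j < m) (c (refl m j.+1))%:C *: Hrefl j.
Definition Eplus : Hc := 2^-1 *: (Hz * Hzb).
Definition Eminus : Hc := - 2 *: (Hzeta * Hzetab).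
Definition Z0 : Hc := Hzb * Hzetab - Hz * Hzeta.

(* xi, eta, x, y and the s_j generate Hc, so these equations determine st. *)
Definition is_star (st : Hc -> Hc) : Prop :=
  [/\ forall (a : C) h h', st (a *: h + h') = Num.conj a *: st h + st h',
      forall h h', st (h * h') = st h' * st h,
      forall h, st (st h) = h,
      [/\ st Hxi = Hx, st Hx = Hxi, st Heta = Hy & st Hy = Heta] &
      forall j, st (Hrefl j) = Hrefl j].

End Cherednik.
Arguments Hc {R} m c.
Arguments Hvector {R m c} u.
Arguments Hcovector {R m c} f.
Arguments Hrefl {R m c} j.
Arguments Hxi {R m c}.
Arguments Heta {R m c}.
Arguments Hx {R m c}.
Arguments Hy {R m c}.
Arguments Hz {R m c}.
Arguments Hzb {R m c}.
Arguments Hzeta {R m c}.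
Arguments Hzetab {R m c}.
Arguments Hsigma {R m c}.
Arguments Eplus {R m c}.
Arguments Eminus {R m c}.
Arguments Z0 {R m c}.

(* [Chi u] is chi_0 for u = false and chi_1 for u = true; [Rho u] is rho^(u). *)
Inductive irrep := Triv | Sign | Chi of bool | Rho of nat.

(* q = uphalf m both for m = 2q and for m = 2q - 1. *)
Definition is_irrep (m : nat) (tau : irrep) : bool :=
  match tau with
  | Triv | Sign => true
  | Chi _ => ~~ odd m
  | Rho u => (0 < u < uphalf m)%N
  end.

Definition dimV (tau : irrep) : nat := if tau is Rho _ then 2 else 1.

Section Representations.
Variables (R : realType) (m : nat) (c : 'M[R]_2 -> R).
Local Notation C := (R[i]).

Definition omega : C := cos (2 * pi / m%:R) +i* sin (2 * pi / m%:R).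

(* The matrix of s_j on V(tau) = C^(dimV tau); for rho^(u) the basis z, zbar
   of V(tau) consists of the standard basis vectors 0 and 1. The s_j generate
   G, so these matrices determine the representation. *)
Definition repr_refl (tau : irrep) (j : nat) : 'M[C]_(dimV tau) :=
  match tau return 'M[C]_(dimV tau) with
  | Triv => 1%:M
  | Sign => (-1)%:M
  | Chi u => (if odd j == u then -1 else 1)%:M
  | Rho u => \matrix_(a, b) (if a == b then 0
                             else if b == 0 then omega ^+ (j * u)
                             else omega ^- (j * u))
  end.

Definition Nc (tau : irrep) : C :=
  xget 0 [set a : C | \sum_(j < m) (c (refl m j.+1))%:C *: repr_refl tau j.+1
                      = a%:M]%classic.

Definition sigma_par (k : int) (u : bool) : C :=
  \sum_(j < m | odd j.+1 == u) (c (refl m j.+1))%:C * omega ^ (k * j.+1%:Z).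

Definition sigma_int (k : int) : C := sigma_par k false + sigma_par k true.

(* sigma(tau)_k as a family labelled by 'I_(dimV tau); for rho^(u), label 0 is
   sigma_(k+u) and label 1 is sigma_(k-u). *)
Definition sigma_tau (tau : irrep) (k : int) (i : 'I_(dimV tau)) : C :=
  match tau with
  | Triv => sigma_int k
  | Sign => - sigma_int k
  | Chi false => - sigma_par k false + sigma_par k true
  | Chi true => sigma_par k false - sigma_par k true
  | Rho u => if i == 0 :> nat then sigma_int (k + u%:Z) else sigma_int (k - u%:Z)
  end.

(* z(sigma) and zbar(sigma). For rho^(u): z(sigma_(k+u)) = z = e_0,
   zbar(sigma_(k+u)) = zbar = e_1, z(sigma_(k-u)) = zbar = e_1 and
   zbar(sigma_(k-u)) = z = e_0. In dimension 1 both are the basis vector. *)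
Definition zlab (tau : irrep) (i : 'I_(dimV tau)) : 'cV[C]_(dimV tau) :=
  delta_mx i 0.
Definition zblab (tau : irrep) (i : 'I_(dimV tau)) : 'cV[C]_(dimV tau) :=
  delta_mx (rev_ord i) 0.

End Representations.
Arguments omega {R} m.
Arguments repr_refl {R} m tau j.
Arguments zlab {R tau} i.
Arguments zblab {R tau} i.

(* M_c(tau) is the tensor product of Hc and V(tau) over the subalgebra
   G x| C[E^*] of Hc, which is generated by the s_j and by E: the formal sums
   of pure tensors modulo C-bilinearity and balancing over these generators,
   where E acts on V(tau) by 0. *)
Section StandardModule.
Variables (R : realType) (m : nat) (c : 'M[R]_2 -> R) (tau : irrep).
Local Notation C := (R[i]).
Local Notation V := ('cV[C]_(dimV tau)).
Local Notation H := (Hc m c).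

Inductive Mterm : Type :=
| Mtens of H & V
| Mzero
| Msca of C & Mterm
| Madd of Mterm & Mterm.

Inductive Meq : Mterm -> Mterm -> Prop :=
| Meq_refl p : Meq p p
| Meq_sym p q : Meq p q -> Meq q p
| Meq_trans p q r : Meq p q -> Meq q r -> Meq p r
| Meq_add p p' q q' : Meq p p' -> Meq q q' -> Meq (Madd p q) (Madd p' q')
| Meq_sca a p p' : Meq p p' -> Meq (Msca a p) (Msca a p')
| MaddA p q r : Meq (Madd p (Madd q r)) (Madd (Madd p q) r)
| MaddC p q : Meq (Madd p q) (Madd q p)
| Madd0 p : Meq (Madd Mzero p) p
| MaddN p : Meq (Madd (Msca (-1) p) p) Mzero
| MscaA a b p : Meq (Msca a (Msca b p)) (Msca (a * b) p)
| Msca1 p : Meq (Msca 1 p) p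
| MscaDr a p q : Meq (Msca a (Madd p q)) (Madd (Msca a p) (Msca a q))
| MscaDl a b p : Meq (Msca (a + b) p) (Madd (Msca a p) (Msca b p))
| MtensDl a h h' v :
    Meq (Mtens (a *: h + h') v) (Madd (Msca a (Mtens h v)) (Mtens h' v))
| MtensDr a h v v' :
    Meq (Mtens h (a *: v + v')) (Madd (Msca a (Mtens h v)) (Mtens h v'))
| MtensG h (j : 'I_m) v :
    Meq (Mtens (h * Hrefl j) v) (Mtens h (repr_refl m tau j.+1 *m v))
| MtensE h u v : Meq (Mtens (h * Hvector u) v) Mzero.

HB.instance Definition _ := gen_eqMixin Mterm.
HB.instance Definition _ := gen_choiceMixin Mterm.

Definition Meqb : rel Mterm := fun p q => `[< Meq p q >].

Lemma Meqb_refl : reflexive Meqb.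
Proof. by move=> p; apply/asboolP; exact: Meq_refl. Qed.

Lemma Meqb_sym : symmetric Meqb.
Proof. by move=> p q; apply/asboolP/asboolP; exact: Meq_sym. Qed.

Lemma Meqb_trans : transitive Meqb.
Proof.
by move=> q p r /asboolP pq /asboolP qr; apply/asboolP; exact: Meq_trans qr.
Qed.

Canonical Meqb_equiv := EquivRel Meqb Meqb_refl Meqb_sym Meqb_trans.

Definition Mc : Type := {eq_quot Meqb}%qT.
HB.instance Definition _ := Choice.on Mc.

Definition Mpi (t : Mterm) : Mc := \pi_({eq_quot Meqb})%qT t.

Lemma MpiP p q : Mpi p = Mpi q <-> Meq p q.
Proof.
split=> [/eqmodP/asboolP //|pq]; apply/eqmodP/asboolP; exact: pq.
Qed.

Lemma Mpi_surj (x : Mc) : {t | x = Mpi t}.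
Proof. by exists (repr (x : {eq_quot Meqb}%qT)); rewrite /Mpi reprK. Qed.

Definition Mc_add (x y : Mc) : Mc :=
  Mpi (Madd (sval (Mpi_surj x)) (sval (Mpi_surj y))).
Definition Mc_scale (a : C) (x : Mc) : Mc := Mpi (Msca a (sval (Mpi_surj x))).

Lemma Mc_addE p q : Mc_add (Mpi p) (Mpi q) = Mpi (Madd p q).
Proof.
apply/MpiP; apply: Meq_add; apply/MpiP.
- by case: (Mpi_surj (Mpi p)).
- by case: (Mpi_surj (Mpi q)).
Qed.

Lemma Mc_scaleE a p : Mc_scale a (Mpi p) = Mpi (Msca a p).
Proof. by apply/MpiP; apply: Meq_sca; apply/MpiP; case: (Mpi_surj (Mpi p)). Qed.

Fact Mc_addA : associative Mc_add.
Proof.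
move=> x y z; have [s ->] := Mpi_surj x; have [t ->] := Mpi_surj y.
by have [u ->] := Mpi_surj z; rewrite !Mc_addE; apply/MpiP/MaddA.
Qed.

Fact Mc_addC : commutative Mc_add.
Proof.
move=> x y; have [s ->] := Mpi_surj x; have [t ->] := Mpi_surj y.
by rewrite !Mc_addE; apply/MpiP/MaddC.
Qed.

Fact Mc_add0 : left_id (Mpi Mzero) Mc_add.
Proof. by move=> x; have [s ->] := Mpi_surj x; rewrite Mc_addE; apply/MpiP/Madd0. Qed.

Fact Mc_addN : left_inverse (Mpi Mzero) (Mc_scale (-1)) Mc_add.
Proof.
move=> x; have [s ->] := Mpi_surj x.
by rewrite Mc_scaleE Mc_addE; apply/MpiP/MaddN.
Qed.

HB.instance Definition _ :=
  GRing.isZmodule.Build Mc Mc_addA Mc_addC Mc_add0 Mc_addN.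

Fact Mc_scaleA a b x : Mc_scale a (Mc_scale b x) = Mc_scale (a * b) x.
Proof.
by have [s ->] := Mpi_surj x; rewrite !Mc_scaleE; apply/MpiP/MscaA.
Qed.

Fact Mc_scale1 : left_id 1 Mc_scale.
Proof. by move=> x; have [s ->] := Mpi_surj x; rewrite Mc_scaleE; apply/MpiP/Msca1. Qed.

Fact Mc_scaleDr : right_distributive Mc_scale +%R.
Proof.
move=> a x y; have [s ->] := Mpi_surj x; have [t ->] := Mpi_surj y.
rewrite [Mpi s + _]Mc_addE !Mc_scaleE [RHS]Mc_addE; exact/MpiP/MscaDr.
Qed.

Fact Mc_scaleDl x : {morph Mc_scale^~ x : a b / a + b >-> a + b}.
Proof.
move=> a b; have [s ->] := Mpi_surj x.
rewrite !Mc_scaleE [RHS]Mc_addE; exact/MpiP/MscaDl.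
Qed.

HB.instance Definition _ := GRing.Zmodule_isLmodule.Build C Mc
  Mc_scaleA Mc_scale1 Mc_scaleDr Mc_scaleDl.

Definition tens (h : H) (v : V) : Mc := Mpi (Mtens h v).

Fixpoint Mterm_act (h : H) (p : Mterm) : Mterm :=
  match p with
  | Mtens h' v => Mtens (h * h') v
  | Mzero => Mzero
  | Msca a q => Msca a (Mterm_act h q)
  | Madd q r => Madd (Mterm_act h q) (Mterm_act h r)
  end.

Definition act (h : H) (x : Mc) : Mc := Mpi (Mterm_act h (sval (Mpi_surj x))).

Lemma Hscale_mulr (a : C) (h h' : H) : h * (a *: h') = a *: (h * h').
Proof.
have [s ->] := Hpi_surj h; have [t ->] := Hpi_surj h'.
rewrite [RHS]Hc_mulA [LHS]Hc_mulA; congr (Hmul _ _).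
by rewrite !HmulE; apply/HpiP/Heq_sym/HscaC.
Qed.

Lemma Mterm_act_eq h p q : Meq p q -> Meq (Mterm_act h p) (Mterm_act h q).
Proof.
elim=> {p q} /=.
- by move=> p; exact: Meq_refl.
- by move=> p q _; exact: Meq_sym.
- by move=> p q r _ IH1 _ IH2; exact: Meq_trans IH1 IH2.
- by move=> p p' q q' _ IHp _ IHq; exact: Meq_add.
- by move=> a p p' _; exact: Meq_sca.
- by move=> p q r; exact: MaddA.
- by move=> p q; exact: MaddC.
- by move=> p; exact: Madd0.
- by move=> p; exact: MaddN.
- by move=> a b p; exact: MscaA.
- by move=> p; exact: Msca1.
- by move=> a p q; exact: MscaDr.
- by move=> a b p; exact: MscaDl.
- by move=> a h1 h2 v; rewrite mulrDr Hscale_mulr; exact: MtensDl.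
- by move=> a h1 v v'; exact: MtensDr.
- by move=> h1 j v; rewrite mulrA; exact: MtensG.
- by move=> h1 u v; rewrite mulrA; exact: MtensE.
Qed.

Lemma act_pi h p : act h (Mpi p) = Mpi (Mterm_act h p).
Proof.
by apply/MpiP; apply: Mterm_act_eq; apply/MpiP; case: (Mpi_surj (Mpi p)).
Qed.

Lemma act_tens h h' v : act h (tens h' v) = tens (h * h') v.
Proof. exact: act_pi. Qed.

Definition submodule (S : Mc -> Prop) : Prop :=
  [/\ S 0, forall p q, S p -> S q -> S (p + q) & forall h p, S p -> S (act h p)].

Definition irreducible_module : Prop :=
  (exists p : Mc, p <> 0) /\
  forall S, submodule S -> (forall p, S p -> p = 0) \/ (forall p, S p).

(* {dot Mc for conj}: positive definite Hermitian forms on Mc, linear in the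
   first argument; both st and beta (up to a positive factor) are unique. *)
Definition unitarisable : Prop :=
  exists (st : H -> H) (beta : {dot Mc for (@Num.conj C)}),
    [/\ is_star st,
        forall h p q, beta (act h p) q = beta p (act (st h) q),
        forall (j : 'I_m) v w,
          beta (tens 1 (repr_refl m tau j.+1 *m v))
               (tens 1 (repr_refl m tau j.+1 *m w))
          = beta (tens 1 v) (tens 1 w) &
        forall v, v != 0 -> 0 < beta (tens 1 v) (tens 1 v)].

(* M_c(tau)_k = C[E]_k (x) V(tau), where C[E] = C[z, zbar]. *)
Definition homogeneous (k : nat) (p : Mc) : Prop :=
  exists v : 'I_k.+1 -> V,
    p = \sum_(a < k.+1) tens (Hz ^+ a * Hzb ^+ (k - a)) (v a).

Definition harmonic (k : nat) (p : Mc) : Prop :=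
  homogeneous k p /\ act Eminus p = 0.

Variable eps : R.

Local Notation N := (Nc m c tau).
Local Notation e := (eps%:C).

Definition Zeps : H := Z0 + e *: Hsigma.

Definition pochhammer (a : C) (j : nat) : C := \prod_(i < j) (a + i%:R).

Definition Proj (k : nat) (p : Mc) : Mc :=
  \sum_(j < k./2.+1)
    ((-1) ^+ j / (j`!%:R * pochhammer (N - k%:R + 1) j))
      *: act (Eplus ^+ j * Eminus ^+ j) p.

(* The sign is b = true for +, b = false for -. *)
Definition lam (k : nat) (i : 'I_(dimV tau)) (b : bool) : C :=
  (if b then 1 else -1)
  * sqrtC ((k%:R - N) ^+ 2 - (1 - e ^+ 2) * sigma_tau m c k%:Z i ^+ 2).

Definition hvec (k : nat) (i : 'I_(dimV tau)) (b : bool) : Mc :=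
  let s := sigma_tau m c k%:Z i in
  Proj k
    (if b then
       (k%:R - N + lam k i true) *: tens (Hzb ^+ k) (zblab i)
       - (s * (1 - e)) *: tens (Hz ^+ k) (zlab i)
     else
       (k%:R - N - lam k i false) *: tens (Hz ^+ k) (zlab i)
       - (s * (1 + e)) *: tens (Hzb ^+ k) (zblab i)).

(* The eigenvalue on the degree-0 part; for one-dimensional tau the family
   sigma(tau)_0 has a single member, so the choice of i is immaterial. *)
Definition lam0 (i : 'I_(dimV tau)) : C :=
  if tau is Rho _ then 0 else e * sigma_tau m c 0 i.

Definition eigenvector (h : H) (l : C) (p : Mc) : Prop :=
  p != 0 /\ act h p = l *: p.

Inductive listed : C -> Mc -> Prop :=
| listed0 i v : v != 0 -> listed (lam0 i) (tens 1 v)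
| listedS k i b : (0 < k)%N -> listed (lam k i b) (hvec k i b).

End StandardModule.
Arguments tens {R m c tau} h v.
Arguments act {R m c tau} h x.
Arguments homogeneous {R m c tau} k p.
Arguments harmonic {R m c tau} k p.
Arguments Zeps {R m c} eps.
Arguments Proj {R m c tau} k p.
Arguments eigenvector {R m c tau} h l p.
Arguments lam {R} m c tau eps k i b.
Arguments hvec {R} m c tau eps k i b.
Arguments lam0 {R} m c tau eps i.
Arguments listed {R m c tau} eps l p.

(* Main.v *)
Require Import Defs.
From HB Require Import structures.
From mathcomp Require Import all_boot all_order all_algebra.
From mathcomp Require Import complex.
From mathcomp Require Import boolp classical_sets reals trigo.
From mathcomp Require Import ring lra.
(** The reason for the theorem is that [E_+], [E_-] and [H] form an sl2-triple in
    the algebra which commutes with [Z_0] and [sigma].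

    By unitarity [E_+] and [- E_-] are adjoint. Therefore the harmonics of degree
    [k] are the orthogonal complement of [E_+ M_(k - 2)] in [M_k], and [Proj k],
    the projection to the lowest weight vectors given by sl2-theory, kills
    [E_+ M_(k - 2)] ([proj_harmonic], [proj_Ep]). The only monomials that are not
    divisible by [z zbar = 2 E_+] are [z^k] and [zbar^k], so the harmonics of
    degree [k > 0] are spanned by the projections of [z^k (x) v] and
    [zbar^k (x) v] ([hom_top], [top_span]).

    Modulo the image of [E_+], the operator [Z_0] acts on [zbar^k (x) v] by
    [(k - N) - sigma] and on [z^k (x) v] by [- (k - N) + sigma] ([Z0_zb], [Z0_z]).
    Since [sigma] exchanges [z^k (x) z(s)] and [zbar^k (x) zbar(s)] with the
    coefficient [s = sigma_(tau, k)] ([sigma_z], [sigma_zb]), the operator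
    [Z_0 + eps sigma] splits into 2 x 2 blocks with trace zero and determinant
    [- ((k - N)^2 - (1 - eps^2) s^2)]. This gives the eigenvalues and the
    eigenvectors ([eigvecP]).

    The eigenvectors form a basis because the eigenvalues are nonzero reals, which
    is again unitarity: [k - N > 0], as [1 - N] is the quotient of the squared
    norms of [E_+ v] and [v] for [v] of degree 0 ([sl2_weight_gt0]), and
    [(k - N)^2 > s^2], as [Z_0] is self-adjoint and [Z_0^2] is the scalar
    [(k - N)^2 - s^2] on a block ([gap_gt0]). It is also needed that there are no
    linear relations between the top monomials modulo the image of [E_+]
    ([tens_top_free]). The algebra and the module are given by generators and
    relations, so this takes a model in which the monomials are visibly
    independent: vector-valued polynomials, on which [E] acts by Dunkl operators
    ([Heval_sound], [phi]). The main step towards the model is the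
    commutativity of the Dunkl operators ([dunkl_comm]).

    At last, every vector is a sum of raised harmonics [E_+^n h]
    ([finite_sum_all], [wt_strings]), hence a combination of raised eigenvectors
    from the list; as [E_+] commutes with [Z_0 + eps sigma], in an eigenvector the
    terms with a different eigenvalue cancel ([eigen_filter]). *)
Set Implicit Arguments.
Unset Strict Implicit.
Unset Printing Implicit Defensive.
Import Order.TTheory GRing.Theory Num.Theory.
Local Open Scope ring_scope.

(** * Projection onto the lowest weight vectors of an sl2-module *)
Section HarmonicProjection.
Variables (K : numFieldType) (M : lmodType K) (Ep Em : {linear M -> M}) (N : K).

(** [Ep], [Em], [Hd] stand for [E_+], [E_-], [H]; [wt d] is homogeneity of degree
    [d], on which [H] is the scalar [d + 1 - N]. *)
Variable wt : nat -> M -> Prop.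
Variable Hd : M -> M.
Hypothesis Em_Ep : forall p, Em (Ep p) = Ep (Em p) - Hd p.
Hypothesis wt_Hd : forall d p, wt d p -> Hd p = (d%:R + 1 - N) *: p.
Hypothesis wt_Ep : forall d p, wt d p -> wt d.+2 (Ep p).
Hypothesis wt_Em : forall d p, wt d.+2 p -> wt d (Em p).
Hypothesis wt_Em0 : forall d p, (d < 2)%N -> wt d p -> Em p = 0.

Lemma wt_iter_Ep d n p : wt d p -> wt (d + n.*2) (iter n Ep p).
Proof.
move=> dp; elim: n => [|n IHn]; first by rewrite addn0.
by rewrite doubleS !addnS; exact: wt_Ep.
Qed.

(** The usual sl2 identity for [f e^n], summed up from the weights
    [d + 1 - N, d + 3 - N, ...] of the vectors [Ep^i p]. *)
Lemma Em_iter_Ep d n p : wt d p ->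
  Em (iter n Ep p) = iter n Ep (Em p) - (n%:R * (d%:R + n%:R - N)) *: iter n.-1 Ep p.
Proof.
move=> dp; elim: n => [|n IHn]; first by rewrite mul0r scale0r subr0.
rewrite iterS Em_Ep IHn linearB linearZ /= -addrA -opprD; congr (_ - _).
rewrite (wt_Hd (wt_iter_Ep n dp)).
have -> : (n%:R * (d%:R + n%:R - N)) *: Ep (iter n.-1 Ep p) =
    (n%:R * (d%:R + n%:R - N)) *: iter n Ep p.
  by case: n {IHn} => [|n //]; rewrite mul0r !scale0r.
rewrite -scalerDl; congr (_ *: _).
by rewrite natrD -muln2 natrM -[n.+1]addn1 natrD; ring.
Qed.

Lemma wt_iter_Em d n p : wt (d + n.*2) p -> wt d (iter n Em p).
Proof.
elim: n d p => [|n IHn] d p; first by rewrite addn0.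
by rewrite doubleS !addnS iterSr => /wt_Em/IHn.
Qed.

Definition poch (a : K) (j : nat) : K := \prod_(i < j) (a + i%:R).

Lemma pochS a j : poch a j.+1 = poch a j * (a + j%:R).
Proof. exact: big_ord_recr. Qed.

(** The coefficients that make [Em_hproj_sum] telescope. *)
Definition hcoef k j : K := (-1) ^+ j / (j`!%:R * poch (N - k%:R + 1) j).

Definition hproj (k : nat) (p : M) : M :=
  \sum_(j < k./2.+1) hcoef k j *: iter j Ep (iter j Em p).

Variable k : nat.
(** No denominator of [hproj k] vanishes. *)
Hypothesis N_neq : forall j, (0 < j <= k./2)%N -> N - k%:R + j%:R != 0.

Lemma poch_neq0 j : (j <= k./2)%N -> poch (N - k%:R + 1) j != 0.
Proof.
move=> jk; rewrite /poch; apply/prodf_neq0 => i _.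
have -> : N - k%:R + 1 + i%:R = N - k%:R + i.+1%:R by rewrite -[i.+1]add1n natrD addrA.
by apply: N_neq; rewrite /= (leq_trans (ltn_ord i)).
Qed.

Lemma hcoefS j : (j.+1 <= k./2)%N ->
  hcoef k j.+1 * (j.+1%:R * (N - k%:R + j.+1%:R)) = - hcoef k j.
Proof.
move=> jk; have nj : N - k%:R + j.+1%:R != 0 by exact: N_neq.
have pj := poch_neq0 (ltnW jk); have fj : j`!%:R != 0 :> K by rewrite pnatr_eq0 -lt0n fact_gt0.
have sj : j.+1%:R != 0 :> K by rewrite pnatr_eq0.
rewrite /hcoef pochS factS natrM exprS.
have -> : N - k%:R + 1 + j%:R = N - k%:R + j.+1%:R by rewrite -[j.+1]add1n natrD addrA.
move: (poch _ _) (N - k%:R + j.+1%:R) (j`!%:R) (j.+1%:R) ((-1) ^+ j) pj nj fj sj => x y u v w x0 y0 u0 v0.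
by field; rewrite x0 y0 u0 v0.
Qed.

(** The partial sums telescope under [Em]. *)
Lemma Em_hproj_sum n p : wt k p -> (n <= k./2)%N ->
  Em (\sum_(j < n.+1) hcoef k j *: iter j Ep (iter j Em p)) =
  hcoef k n *: iter n Ep (iter n.+1 Em p).
Proof.
move=> kp; elim: n => [|n IHn] nk.
  by rewrite big_ord_recl big_ord0 addr0 linearZ.
rewrite big_ord_recr linearD IHn ?(ltnW nk) //= linearZ /=.
have le : (n.+1.*2 <= k)%N by rewrite -geq_half_double.
have wn : wt (k - n.+1.*2) (iter n.+1 Em p) by apply: wt_iter_Em; rewrite subnK.
rewrite (Em_iter_Ep n.+1 wn) scalerBr /= scalerA.
rewrite addrCA -[RHS]addr0; congr (_ + _).
rewrite -scalerBl -[X in X *: _]opprB.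
rewrite natrB // -muln2 natrM.
have -> : k%:R - n.+1%:R * 2 + n.+1%:R - N = - (N - k%:R + n.+1%:R) :> K by ring.
by rewrite mulrN mulrN hcoefS // opprK subrr oppr0 scale0r.
Qed.

Lemma Em_hproj p : wt k p -> Em (hproj k p) = 0.
Proof.
move=> kp; rewrite Em_hproj_sum //.
have wn : wt (odd k) (iter k./2 Em p).
  by apply: wt_iter_Em; rewrite odd_double_half.
rewrite iterS (wt_Em0 _ wn); last by case: odd.
have -> : iter k./2 Ep 0 = 0 by elim: (k./2) => //= n ->; rewrite linear0.
by rewrite scaler0.
Qed.

Lemma hproj_id p : Em p = 0 -> hproj k p = p.
Proof.
move=> p0; have Z n : iter n.+1 Em p = 0.
  by rewrite iterSr p0; elim: n => //= n ->; exact: linear0.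
have Z' n : iter n Ep 0 = 0 by elim: n => //= n ->; rewrite linear0.
rewrite /hproj big_ord_recl big1 => [|i _].
  by rewrite addr0 /hcoef /poch big_ord0 fact0 expr0 mulr1 divr1 scale1r.
by rewrite (Z i : iter (lift ord0 i) Em p = 0) Z' scaler0.
Qed.

Lemma hproj_is_linear : linear (hproj k).
Proof.
move=> x p q; rewrite /hproj scaler_sumr -big_split; apply: eq_bigr => j _ /=.
have iter_linear (F : {linear M -> M}) n u v :
    iter n F (x *: u + v) = x *: iter n F u + iter n F v.
  by elim: n => //= n ->; rewrite linearP.
by rewrite !iter_linear scalerDr !scalerA mulrC.
Qed.

(** Whatever commutes with the sl2-triple commutes with the projection. *)
Lemma hproj_comm (T : {linear M -> M}) p :
  (forall p, T (Ep p) = Ep (T p)) -> (forall p, T (Em p) = Em (T p)) ->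
  T (hproj k p) = hproj k (T p).
Proof.
move=> TEp TEm; rewrite linear_sum; apply: eq_bigr => j _.
rewrite linearZ /=; congr (_ *: _).
have iter_comm (F : M -> M) n u : (forall p, T (F p) = F (T p)) ->
    T (iter n F u) = iter n F (T u).
  by move=> TF; elim: n => //= n <-; rewrite TF.
by rewrite !iter_comm.
Qed.

(** Homogeneity of degree [d - 2], where the negative degrees are zero. *)
Definition low (d : nat) (q : M) : Prop := if d is d'.+2 then wt d' q else q = 0.

Hypothesis wt0 : forall d, wt d 0.
Hypothesis wtD : forall d p q, wt d p -> wt d q -> wt d (p + q).
Hypothesis wtZ : forall d x p, wt d p -> wt d (x *: p).

Lemma wt_sum d n (F : 'I_n -> M) : (forall i, wt d (F i)) -> wt d (\sum_(i < n) F i).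
Proof. by move=> dF; apply: (big_ind (wt d)) => // p q; apply: wtD. Qed.

Lemma hprojE p : wt k p -> exists2 q, low k q & hproj k p = p + Ep q.
Proof.
move=> kp; exists (\sum_(j < k./2) hcoef k j.+1 *: iter j Ep (iter j.+1 Em p)).
  case: k kp => [|[|d]] dp /=; rewrite ?big_ord0 //.
  apply: wt_sum => j; apply: wtZ.
  have jd : (j.*2 <= d)%N by rewrite -geq_half_double -ltnS ltn_ord.
  have : wt (d - j.*2 + j.*2) (iter j Ep (iter j.+1 Em p)).
    apply: wt_iter_Ep; apply: wt_iter_Em.
    by rewrite doubleS !addnS subnK.
  by rewrite subnK.
rewrite /hproj big_ord_recl linear_sum; congr (_ + _).
  by rewrite /hcoef /poch big_ord0 fact0 expr0 mulr1 divr1 scale1r.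
by apply: eq_bigr => j _; rewrite linearZ.
Qed.

Lemma low_wt q : low k q -> wt k (Ep q).
Proof. by case: k => [|[|d]] /= dq; [rewrite dq linear0 | rewrite dq linear0 | exact: wt_Ep]. Qed.

End HarmonicProjection.

(** For a positive definite form that makes [Ep] and [- Em] adjoint, the image of
    [Ep] is orthogonal to the harmonics, so that the projection kills it, and the
    weights are positive, so that the projection is defined. *)
Section UnitaryProjection.
Variables (K : numClosedFieldType) (M : lmodType K) (Ep Em : {linear M -> M}) (N : K).
Variables (wt : nat -> M -> Prop) (Hd : M -> M).
Hypothesis Em_Ep : forall p, Em (Ep p) = Ep (Em p) - Hd p.
Hypothesis wt_Hd : forall d p, wt d p -> Hd p = (d%:R + 1 - N) *: p.
Hypothesis wt_Ep : forall d p, wt d p -> wt d.+2 (Ep p).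
Hypothesis wt_Em : forall d p, wt d.+2 p -> wt d (Em p).
Hypothesis wt_Em0 : forall d p, (d < 2)%N -> wt d p -> Em p = 0.
Hypothesis wt0 : forall d, wt d 0.
Hypothesis wtD : forall d p q, wt d p -> wt d q -> wt d (p + q).
Hypothesis wtZ : forall d x p, wt d p -> wt d (x *: p).

Variable form : M -> M -> K.
Hypothesis formZl : forall x p r, form (x *: p) r = x * form p r.
Hypothesis form_conj : forall p q, form q p = (form p q)^*.
Hypothesis form_gt0 : forall p, p != 0 -> 0 < form p p.
Hypothesis form_Ep : forall p q, form (Ep p) q = - form p (Em q).

Lemma formZr x p r : form p (x *: r) = x^* * form p r.
Proof. by rewrite form_conj formZl rmorphM /= -form_conj. Qed.

Lemma formNr p r : form p (- r) = - form p r.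
Proof. by rewrite -scaleN1r formZr rmorphN1 mulN1r. Qed.

Lemma form_eq0 p : form p p = 0 -> p = 0.
Proof.
move=> pp; apply/eqP; apply: contraTT isT => /form_gt0.
by rewrite pp ltxx.
Qed.

(** The image of [Ep] is orthogonal to the kernel of [Em], hence meets it in 0. *)
Lemma harmonic_image_eq0 q : Em (Ep q) = 0 -> Ep q = 0.
Proof. by move=> h; apply: form_eq0; rewrite form_Ep h -(scale0r 0) formZr rmorph0 mul0r oppr0. Qed.

Variable v0 : M.
Hypotheses (wt_v0 : wt 0 v0) (v0_neq0 : v0 != 0) (Ep_v0 : Ep v0 != 0).

Let v0_norm : form (Ep v0) (Ep v0) = (1 - N)^* * form v0 v0.
Proof.
rewrite form_Ep Em_Ep (wt_Em0 _ wt_v0) // linear0 add0r formNr opprK.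
by rewrite (wt_Hd wt_v0) formZr add0r.
Qed.

(** [(1 - N) (v0, v0)] is the squared norm of [Ep v0]. *)
Lemma sl2_weight_gt0 : 0 < 1 - N.
Proof.
have := form_gt0 Ep_v0; rewrite v0_norm.
rewrite pmulr_lgt0 ?form_gt0 // => gt0.
by rewrite -(conjCK (1 - N)) (conj_Creal (gtr0_real gt0)).
Qed.

Lemma sl2_weightS_gt0 d : 0 < d.+1%:R - N.
Proof.
have -> : d.+1%:R - N = d%:R + (1 - N) by rewrite -[d.+1]addn1 natrD addrA.
by rewrite ltr_wpDl ?ler0n ?sl2_weight_gt0.
Qed.

Lemma sl2_weight_neq0 k j : (0 < j <= k./2)%N -> N - k%:R + j%:R != 0.
Proof.
case/andP=> j0 jk.
have jk' : (j < k)%N.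
  move: jk; rewrite geq_half_double -addnn; apply: leq_trans.
  by rewrite -{1}[j]add0n ltn_add2r.
have E : N - k%:R + j%:R = - ((k - j).-1.+1%:R - N).
  by rewrite prednK ?subn_gt0 // natrB ?(ltnW jk') //; ring.
by rewrite E oppr_eq0 gt_eqF // sl2_weightS_gt0.
Qed.

Variable k : nat.
Local Notation proj := (hproj Ep Em N k).
Local Notation low := (low wt k).

Lemma proj_harmonic p : wt k p -> Em (proj p) = 0.
Proof. by apply: (Em_hproj (Hd := Hd)) => // j; exact: sl2_weight_neq0. Qed.

Lemma projE p : wt k p -> exists2 q, low q & proj p = p + Ep q.
Proof. exact: hprojE. Qed.

(** The projection changes [Ep q] by an element of the image of [Ep] only, and
    it maps it to a harmonic. *)
Lemma proj_Ep q : low q -> proj (Ep q) = 0.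
Proof.
move=> lq; have wq : wt k (Ep q) by apply: low_wt lq.
have [q' _ Eq] := projE wq; have := proj_harmonic wq.
by rewrite Eq -linearD; exact: harmonic_image_eq0.
Qed.

Lemma wt_proj p : wt k p -> wt k (proj p).
Proof.
by move=> kp; have [q lq ->] := projE kp; apply: wtD => //; apply: low_wt lq.
Qed.

End UnitaryProjection.

(** The strings [h, Ep h, Ep^2 h, ...] of the harmonics [h]. *)
Section Strings.
Variables (K : numClosedFieldType) (M : lmodType K) (Ep Em : {linear M -> M}) (N : K).
Variables (wt : nat -> M -> Prop) (Hd : M -> M).
Hypothesis Em_Ep : forall p, Em (Ep p) = Ep (Em p) - Hd p.
Hypothesis wt_Hd : forall d p, wt d p -> Hd p = (d%:R + 1 - N) *: p.
Hypothesis wt_Ep : forall d p, wt d p -> wt d.+2 (Ep p).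
Hypothesis weight_gt0 : forall d, 0 < d.+1%:R - N.

Lemma iter_Ep_neq0 d n p : wt d p -> Em p = 0 -> p != 0 -> iter n Ep p != 0.
Proof.
move=> dp p0 pn0; elim: n => // n IHn; apply: contraNneq IHn => E.
have := Em_iter_Ep Em_Ep wt_Hd wt_Ep n.+1 dp; rewrite E p0 linear0.
have -> : iter n.+1 Ep 0 = 0 by elim: n.+1 => //= l ->; rewrite linear0.
rewrite sub0r => /eqP; rewrite eq_sym oppr_eq0 scaler_eq0 mulf_eq0 pnatr_eq0 /=.
by rewrite -natrD addnS gt_eqF ?weight_gt0.
Qed.

Hypothesis harmonic_split : forall d p, wt d p ->
  exists h q, [/\ wt d h, Em h = 0, low wt d q & p = h + Ep q].

(** By induction on the degree, [p = h + Ep q = h + Ep h' + Ep^2 h'' + ...]. *)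
Lemma wt_strings (Q : M -> Prop) :
  (forall p q, Q p -> Q q -> Q (p + q)) ->
  (forall d n h, wt d h -> Em h = 0 -> Q (iter n Ep h)) ->
  forall d p, wt d p -> Q p.
Proof.
move=> QD Qh d p dp; suff G n : Q (iter n Ep p) by exact: (G 0).
elim/ltn_ind: d p n dp => d IHd p n dp.
have [h [q [dh h0 lq ->]]] := harmonic_split dp.
have -> : iter n Ep (h + Ep q) = iter n Ep h + iter n.+1 Ep q.
  by rewrite iterSr; elim: n => //= n ->; rewrite linearD.
have iter0 l : iter l Ep 0 = 0 by elim: l => //= l ->; rewrite linear0.
case: d IHd lq dh {dp} => [|[|d]] IHd /= lq dh.
- by rewrite lq -/(iter n.+1 Ep 0) iter0 addr0; exact: Qh dh h0.
- by rewrite lq -/(iter n.+1 Ep 0) iter0 addr0; exact: Qh dh h0.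
- by apply: QD; [exact: Qh dh h0 | exact: (IHd d _ q n.+1 lq)].
Qed.

End Strings.

(** * Eigenvectors of a self-adjoint block matrix *)
Section Combinations.
Variables (K : comPzRingType) (M : lmodType K).

Lemma combB (x y z w t u : K) (p q : M) :
  x *: (z *: p - w *: q) - y *: (t *: q + u *: p) =
  (x * z - y * u) *: p - (x * w + y * t) *: q.
Proof.
rewrite scalerBr scalerDr !scalerA scalerBl scalerDl !opprD.
by rewrite [- (_ *: q) - _ in LHS]addrC addrACA.
Qed.

Lemma combD (x y z w t u : K) (p q : M) :
  x *: (z *: p + w *: q) - y *: (t *: q - u *: p) =
  (x * z + y * u) *: p - (y * t - x * w) *: q.
Proof. by rewrite scalerBr scalerDr !scalerA scalerBl scalerDl !opprB addrACA. Qed.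

End Combinations.

(** The abstract form of the eigenvalue problem: in the basis [b i], [a i] the
    operators [T] and [S] stand for [Z_0] and [sigma], and [T + e S] consists of
    the 2 x 2 blocks with rows [P, s (1 + e)] and [- s (1 - e), - P]. *)
Section Eigenbasis.
Variables (K : numClosedFieldType) (M : lmodType K) (I : finType) (a b : I -> M).
Variables (T S : {linear M -> M}) (P : K) (s : I -> K).
Hypotheses (Tb : forall i, T (b i) = P *: b i - s i *: a i)
  (Ta : forall i, T (a i) = - P *: a i + s i *: b i)
  (Sb : forall i, S (b i) = s i *: a i) (Sa : forall i, S (a i) = s i *: b i).
Hypothesis ab_free : forall x y : I -> K,
  \sum_i (x i *: a i + y i *: b i) = 0 -> forall i, x i = 0 /\ y i = 0.
Hypothesis P_gt0 : 0 < P.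
Hypothesis s_real : forall i, s i \is Num.real.

Variable form : M -> M -> K.
Hypothesis formZl : forall x p r, form (x *: p) r = x * form p r.
Hypothesis form_gt0 : forall p, p != 0 -> 0 < form p p.
Hypothesis form_T : forall p q, form (T p) q = form p (T q).

Lemma ab_free1 i x y : x *: a i + y *: b i = 0 -> x = 0 /\ y = 0.
Proof.
move=> E; have := ab_free (x := fun j => x *+ (j == i)) (y := fun j => y *+ (j == i)) _ i.
rewrite eqxx !mulr1n; apply; rewrite (bigD1 i) //= eqxx !mulr1n E add0r.
by apply: big1 => j /negPf ->; rewrite !mulr0n !scale0r addr0.
Qed.

(** [T^2] is the scalar [P^2 - s^2] on the span of [a i] and [b i], and it is
    positive there because [T] is self-adjoint and [T (b i) != 0]. *)
Lemma gap_gt0 i : 0 < P ^+ 2 - s i ^+ 2.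
Proof.
have b0 : b i != 0.
  apply/eqP => b0; have [] := @ab_free1 i 0 1; first by rewrite b0 scale0r scaler0 addr0.
  by move=> _ /eqP; rewrite oner_eq0.
have Tb0 : T (b i) != 0.
  apply/eqP => Tb0; have [] := @ab_free1 i (- s i) P.
    by rewrite addrC scaleNr -Tb.
  by move=> _ P0; move: P_gt0; rewrite P0 ltxx.
have T2 : T (T (b i)) = (P ^+ 2 - s i ^+ 2) *: b i.
  rewrite {1}Tb linearB [T (P *: _)]linearZ [T (s i *: _)]linearZ /= Tb Ta combB.
  by rewrite mulrN [s i * P]mulrC subrr scale0r subr0 !expr2.
have := form_gt0 Tb0; rewrite -form_T T2 formZl pmulr_lgt0 //.
exact: form_gt0.
Qed.

Variable e : K.
Hypothesis e_real : e \is Num.real.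

Definition tilted (p : M) : M := T p + e *: S p.
Local Notation Te := tilted.

(** The square root of minus the determinant of the i-th block, whose trace is
    zero. *)
Definition root_disc i := sqrtC (P ^+ 2 - (1 - e ^+ 2) * s i ^+ 2).
Local Notation L := root_disc.

Lemma root_disc_gt0 i : 0 < L i.
Proof.
rewrite sqrtC_gt0.
have -> : P ^+ 2 - (1 - e ^+ 2) * s i ^+ 2 = (P ^+ 2 - s i ^+ 2) + (e * s i) ^+ 2 by ring.
by rewrite ltr_wpDr ?gap_gt0 // real_exprn_even_ge0 ?rpredM.
Qed.

Lemma root_disc_sqr i : L i ^+ 2 = P ^+ 2 - (1 - e ^+ 2) * s i ^+ 2.
Proof. exact: sqrtCK. Qed.

Definition eigval i (d : bool) : K := (if d then 1 else -1) * L i.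

Definition eigvec i (d : bool) : M :=
  if d then (P + L i) *: b i - (s i * (1 - e)) *: a i
  else (P + L i) *: a i - (s i * (1 + e)) *: b i.

Let Teb i : Te (b i) = P *: b i - (s i * (1 - e)) *: a i.
Proof.
rewrite /Te Tb Sb scalerA -addrA -scaleNr -scalerDl -scaleNr.
by congr (_ + _ *: _); ring.
Qed.

Let Tea i : Te (a i) = - P *: a i + (s i * (1 + e)) *: b i.
Proof. by rewrite /Te Ta Sa scalerA -addrA -scalerDl mulrDr mulr1 (mulrC e). Qed.

Let TeB x y p q : Te (x *: p - y *: q) = x *: Te p - y *: Te q.
Proof.
have lin_comb (F : {linear M -> M}) : F (x *: p - y *: q) = x *: F p - y *: F q.
  by rewrite linearB [F (x *: _)]linearZ [F (y *: _)]linearZ.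
rewrite /Te !lin_comb scalerBr !scalerA addrACA -opprD ![e * _]mulrC.
by rewrite -!scalerA -!scalerDr.
Qed.

Lemma eigvecP i d : Te (eigvec i d) = eigval i d *: eigvec i d.
Proof.
have sq := root_disc_sqr i.
rewrite /eigvec /eigval; case: d; rewrite TeB Tea Teb ?combB ?combD scalerBr !scalerA.
all: by congr (_ *: _ - _ *: _); ring: sq.
Qed.

(** The matrix of [eigvec i] in [b i], [a i] has determinant [2 L (P + L)]. *)
Lemma eigvec_det_neq0 i : 2 * L i * (P + L i) != 0.
Proof.
have L0 := root_disc_gt0 i.
by rewrite !mulf_neq0 ?pnatr_eq0 ?gt_eqF // addr_gt0.
Qed.

Lemma sum_eigvec (x : {ffun I * bool -> K}) :
  \sum_ib x ib *: eigvec ib.1 ib.2 =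
  \sum_i ((x (i, false) * (P + L i) - x (i, true) * (s i * (1 - e))) *: a i +
          (x (i, true) * (P + L i) - x (i, false) * (s i * (1 + e))) *: b i).
Proof.
rewrite (eq_bigr (fun ib => x (ib.1, ib.2) *: eigvec ib.1 ib.2)) => [|[i d] _ //].
rewrite -(pair_bigA _ (fun i d => x (i, d) *: eigvec i d)) /=.
apply: eq_bigr => i _; rewrite big_bool /= /eigvec !scalerBr !scalerA !scalerBl.
rewrite [RHS]addrC [X in _ + X = _]addrC addrACA; congr (_ + _).
exact: addrC.
Qed.

Lemma eigvec_free (x : {ffun I * bool -> K}) :
  \sum_ib x ib *: eigvec ib.1 ib.2 = 0 -> x = [ffun => 0].
Proof.
rewrite sum_eigvec => E; apply/ffunP => -[i d]; rewrite ffunE.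
have [E1 E2] := ab_free (x := fun i => _) (y := fun i => _) E i.
have D := eigvec_det_neq0 i; have sq := root_disc_sqr i.
apply: (mulIf D); rewrite mul0r; move: E1 E2 sq.
case: d; move: (x (i, true)) (x (i, false)) (L i) (s i) => u v l t E1 E2 sq.
- rewrite -[RHS](mulr0 (P + l)) -E2 -[RHS]addr0 -(mulr0 (t * (1 + e))) -E1.
  by ring: sq.
- rewrite -[RHS](mulr0 (P + l)) -E1 -[RHS]addr0 -(mulr0 (t * (1 - e))) -E2.
  by ring: sq.
Qed.

Lemma eigvec_span (x y : I -> K) : exists z : {ffun I * bool -> K},
  \sum_i (x i *: a i + y i *: b i) = \sum_ib z ib *: eigvec ib.1 ib.2.
Proof.
pose D i := 2 * L i * (P + L i).
exists [ffun ib => if ib.2 then (y ib.1 * (P + L ib.1) + x ib.1 * (s ib.1 * (1 + e))) / D ib.1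
  else (y ib.1 * (s ib.1 * (1 - e)) + x ib.1 * (P + L ib.1)) / D ib.1].
rewrite sum_eigvec; apply: eq_bigr => i _; rewrite !ffunE /=.
have sq := root_disc_sqr i; have := eigvec_det_neq0 i; rewrite -/(D i) => D0.
have DE : D i = (P + L i) ^+ 2 - s i * (1 - e) * (s i * (1 + e)).
  by rewrite /D; ring: sq.
by congr (_ *: _ + _ *: _); apply: (mulIf D0);
  rewrite mulrBl [X in _ = X - _]mulrAC [X in _ = _ - X]mulrAC !divfK // DE; ring.
Qed.

End Eigenbasis.

Section EigenFilter.
Variables (K : fieldType) (M : lmodType K) (T : {linear M -> M}).

(** The product of the operators [T - nu] for [nu] in [s]. *)
Definition kill (s : seq K) (p : M) : M := foldr (fun nu q => T q - nu *: q) p s.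

(** A polynomial in [T] acts on an eigenvector by its value at the eigenvalue. *)
Lemma kill_eigen s l x : T x = l *: x -> kill s x = (\prod_(nu <- s) (l - nu)) *: x.
Proof.
move=> Tx; elim: s => [|nu s IHs] /=; first by rewrite big_nil scale1r.
rewrite IHs big_cons linearZ /= Tx !scalerA -scalerBl; congr (_ *: _); ring.
Qed.

Lemma kill_sum s (J : Type) (r : seq J) (x : J -> M) :
  kill s (\sum_(t <- r) x t) = \sum_(t <- r) kill s (x t).
Proof.
elim: s => [|nu s IHs] //=.
by rewrite IHs linear_sum scaler_sumr -sumrB.
Qed.

(** An eigenvector that is a sum of eigenvectors is the sum of those of them that
    have the same eigenvalue: apply the product of [T - nu] over the others. *)
Lemma eigen_filter (J : eqType) (r : seq J) (x : J -> M) (l : J -> K) mu :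
  (forall t, T (x t) = l t *: x t) ->
  T (\sum_(t <- r) x t) = mu *: \sum_(t <- r) x t ->
  \sum_(t <- r) x t = \sum_(t <- r | l t == mu) x t.
Proof.
move=> Tx Tp; pose s := [seq l t | t <- r & l t != mu].
have s0 : \prod_(nu <- s) (mu - nu) != 0.
  rewrite prodf_seq_neq0; apply/allP => nu /mapP[t]; rewrite mem_filter => /andP[lt _] ->.
  by rewrite subr_eq0 eq_sym.
have E := kill_eigen s Tp; rewrite kill_sum in E.
apply: (scalerI s0); rewrite -E scaler_sumr [RHS]big_mkcond.
apply: eq_big_seq => t tr; rewrite (kill_eigen _ (Tx t)).
case: eqP => [-> //|/eqP lt].
suff -> : \prod_(nu <- s) (l t - nu) = 0 by rewrite scale0r.
apply/eqP; rewrite prodf_seq_eq0; apply/hasP; exists (l t); last by rewrite /= subrr eqxx.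
by apply/mapP; exists t; rewrite // mem_filter lt.
Qed.

End EigenFilter.

(** * Isotropic coordinates of the plane *)
Section ComplexCoordinates.
Variable K : numClosedFieldType.
Local Notation x0 := (delta_mx 0 0 : 'rV[K]_2).
Local Notation y0 := (delta_mx 0 1 : 'rV[K]_2).
Local Notation xi0 := (delta_mx 0 0 : 'cV[K]_2).
Local Notation eta0 := (delta_mx 1 0 : 'cV[K]_2).

Lemma i_mul_i : 'i * 'i = -1 :> K. Proof. by rewrite -expr2 sqrCi. Qed.

Lemma mul_row2 (f : 'rV[K]_2) (u : 'cV[K]_2) :
  (f *m u) 0 0 = f 0 0 * u 0 0 + f 0 1 * u 1 0.
Proof.
rewrite mxE !big_ord_recl big_ord0 addr0.
by have -> : lift 0 0 = 1 :> 'I_2 by apply/val_inj.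
Qed.

Lemma zf_entries : ((x0 + 'i *: y0) 0 0 = 1) * ((x0 + 'i *: y0) 0 1 = 'i).
Proof. by rewrite !mxE /= !(mulr0, mulr1, addr0, add0r). Qed.

Lemma zbf_entries : ((x0 - 'i *: y0) 0 0 = 1) * ((x0 - 'i *: y0) 0 1 = - 'i).
Proof. by rewrite !mxE /= !(mulr0, mulr1, addr0, add0r, oppr0). Qed.

Lemma zeta_entries : ((2^-1 *: (xi0 - 'i *: eta0)) 0 0 = 2^-1) *
  ((2^-1 *: (xi0 - 'i *: eta0)) 1 0 = - 'i / 2).
Proof.
rewrite !mxE /= !(mulr0, mulr1, addr0, add0r, oppr0); split=> //.
by rewrite mulrC.
Qed.

Lemma zetab_entries : ((2^-1 *: (xi0 + 'i *: eta0)) 0 0 = 2^-1) *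
  ((2^-1 *: (xi0 + 'i *: eta0)) 1 0 = 'i / 2).
Proof.
rewrite !mxE /= !(mulr0, mulr1, addr0, add0r, oppr0); split=> //.
by rewrite mulrC.
Qed.

(** Computes the pairings between [z, zbar] and [zeta, zetab]. *)
Definition pairE := (mul_row2, zf_entries, zbf_entries, zeta_entries, zetab_entries).

Lemma pair_z_zeta : ((x0 + 'i *: y0) *m (2^-1 *: (xi0 - 'i *: eta0))) 0 0 = 1.
Proof. rewrite !pairE; have := i_mul_i; move: ('i : K) => i i2; by field: i2. Qed.

Lemma pair_zb_zeta : ((x0 - 'i *: y0) *m (2^-1 *: (xi0 - 'i *: eta0))) 0 0 = 0.
Proof. rewrite !pairE; have := i_mul_i; move: ('i : K) => i i2; by field: i2. Qed.

Lemma pair_z_zetab : ((x0 + 'i *: y0) *m (2^-1 *: (xi0 + 'i *: eta0))) 0 0 = 0.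
Proof. rewrite !pairE; have := i_mul_i; move: ('i : K) => i i2; by field: i2. Qed.

Lemma pair_zb_zetab : ((x0 - 'i *: y0) *m (2^-1 *: (xi0 + 'i *: eta0))) 0 0 = 1.
Proof. rewrite !pairE; have := i_mul_i; move: ('i : K) => i i2; by field: i2. Qed.

(** The coefficients [<f, alpha> <a, u>] of the commutators of [zeta, zetab] with
    [z, zbar], for a root with coordinates [s], [- t] on the unit circle; [w] is
    the rotation by twice its angle. *)
Section Root.
Variables (s t : K) (al : 'cV[K]_2) (co : 'rV[K]_2) (w w' : K).
Hypotheses (al0 : al 0 0 = s) (al1 : al 1 0 = - t) (co0 : co 0 0 = s) (co1 : co 0 1 = - t).
Hypotheses (st : s * s = 1 - t * t) (ww : w = (t + 'i * s) ^+ 2) (ww' : w' = (t - 'i * s) ^+ 2).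

Let rootE := (pairE, al0, al1, co0, co1).

Lemma root_z_zeta : ((x0 + 'i *: y0) *m al) 0 0 *
  (co *m (2^-1 *: (xi0 - 'i *: eta0))) 0 0 = 2^-1.
Proof. rewrite !rootE; have := i_mul_i; move: ('i : K) => i i2; by field: i2 st. Qed.

Lemma root_zb_zetab : ((x0 - 'i *: y0) *m al) 0 0 *
  (co *m (2^-1 *: (xi0 + 'i *: eta0))) 0 0 = 2^-1.
Proof. rewrite !rootE; have := i_mul_i; move: ('i : K) => i i2; by field: i2 st. Qed.

Lemma root_zb_zeta : ((x0 - 'i *: y0) *m al) 0 0 *
  (co *m (2^-1 *: (xi0 - 'i *: eta0))) 0 0 = - w' / 2.
Proof. rewrite !rootE ww'; have := i_mul_i; move: ('i : K) => i i2; by field: i2 st. Qed.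

Lemma root_z_zetab : ((x0 + 'i *: y0) *m al) 0 0 *
  (co *m (2^-1 *: (xi0 + 'i *: eta0))) 0 0 = - w / 2.
Proof. rewrite !rootE ww; have := i_mul_i; move: ('i : K) => i i2; by field: i2 st. Qed.

End Root.

Lemma row2P (f g : 'rV[K]_2) : f 0 0 = g 0 0 -> f 0 1 = g 0 1 -> f = g.
Proof.
move=> f0 f1; apply/matrixP => i j; rewrite ord1.
by case: j => [[|[|//]]] ?; [move: f0 | move: f1]; do !congr (_ = _); congr (_ _ _); apply/val_inj.
Qed.

Lemma col2P (u v : 'cV[K]_2) : u 0 0 = v 0 0 -> u 1 0 = v 1 0 -> u = v.
Proof.
move=> u0 u1; apply/matrixP => j i; rewrite ord1.
by case: j => [[|[|//]]] ?; [move: u0 | move: u1]; do !congr (_ = _); congr (_ _ _); apply/val_inj.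
Qed.

(** A reflection exchanges the two isotropic lines. *)
Section ReflectionMatrix.
Variables (p q : K) (A : 'M[K]_2).
Hypotheses (A00 : A 0 0 = p) (A01 : A 0 1 = q) (A10 : A 1 0 = q) (A11 : A 1 1 = - p).

Let row_mulE (f : 'rV[K]_2) k : (f *m A) 0 k = f 0 0 * A 0 k + f 0 1 * A 1 k.
Proof.
rewrite mxE !big_ord_recl big_ord0 addr0.
by have -> : lift 0 0 = 1 :> 'I_2 by apply/val_inj.
Qed.

Let col_mulE (u : 'cV[K]_2) k : (A *m u) k 0 = A k 0 * u 0 0 + A k 1 * u 1 0.
Proof.
rewrite mxE !big_ord_recl big_ord0 addr0.
by have -> : lift 0 0 = 1 :> 'I_2 by apply/val_inj.
Qed.

Let scale_rowE a (f : 'rV[K]_2) k : (a *: f) 0 k = a * f 0 k.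
Proof. by rewrite mxE. Qed.

Let scale_colE a (f : 'cV[K]_2) k : (a *: f) k 0 = a * f k 0.
Proof. by rewrite mxE. Qed.

Let mulAE := (row_mulE, col_mulE, A00, A01, A10, A11, scale_rowE).

Lemma refl_zf : (x0 + 'i *: y0) *m A = (p + 'i * q) *: (x0 - 'i *: y0).
Proof.
by apply: row2P; rewrite !mulAE !pairE; have := i_mul_i; move: ('i : K) => i i2;
  ring: i2.
Qed.

Lemma refl_zbf : (x0 - 'i *: y0) *m A = (p - 'i * q) *: (x0 + 'i *: y0).
Proof.
by apply: row2P; rewrite !mulAE !pairE; have := i_mul_i; move: ('i : K) => i i2;
  ring: i2.
Qed.

Lemma refl_zeta : A *m (2^-1 *: (xi0 - 'i *: eta0)) =
  (p - 'i * q) *: (2^-1 *: (xi0 + 'i *: eta0)).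
Proof.
apply: col2P; rewrite col_mulE [RHS]scale_colE !mulAE !pairE;
by have := i_mul_i; move: ('i : K) => i i2; ring: i2.
Qed.

Lemma refl_zetab : A *m (2^-1 *: (xi0 + 'i *: eta0)) =
  (p + 'i * q) *: (2^-1 *: (xi0 - 'i *: eta0)).
Proof.
apply: col2P; rewrite col_mulE [RHS]scale_colE !mulAE !pairE;
by have := i_mul_i; move: ('i : K) => i i2; ring: i2.
Qed.

End ReflectionMatrix.

Let half2 : (2 : K) * 2^-1 = 1.
Proof. by rewrite divff // pnatr_eq0. Qed.

Lemma row_zE (f : 'rV[K]_2) : f = (2^-1 * (f 0 0 - 'i * f 0 1)) *: (x0 + 'i *: y0) +
    (2^-1 * (f 0 0 + 'i * f 0 1)) *: (x0 - 'i *: y0).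
Proof.
have E (a b : K) (p q : 'rV[K]_2) k : (a *: p + b *: q) 0 k = a * p 0 k + b * q 0 k.
  by rewrite !mxE.
apply: row2P; rewrite E !pairE; move: (f 0 0) (f 0 1) => x y;
  have i2 := i_mul_i; move: ('i : K) (2^-1 : K) half2 i2 => i h hh i2.
  have -> : h * (x - i * y) * 1 + h * (x + i * y) * 1 = (2 * h) * x by ring.
  by rewrite hh mul1r.
have -> : h * (x - i * y) * i + h * (x + i * y) * - i = - (2 * h) * (i * i) * y by ring.
by rewrite hh i2 mulrNN mul1r mul1r.
Qed.

Lemma col_zetaE (u : 'cV[K]_2) : u =
    (u 0 0 + 'i * u 1 0) *: (2^-1 *: (xi0 - 'i *: eta0)) +
    (u 0 0 - 'i * u 1 0) *: (2^-1 *: (xi0 + 'i *: eta0)).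
Proof.
have E (a b : K) (p q : 'cV[K]_2) k : (a *: p + b *: q) k 0 = a * p k 0 + b * q k 0.
  by rewrite !mxE.
apply: col2P; rewrite E !pairE; move: (u 0 0) (u 1 0) => x y;
  have i2 := i_mul_i; move: ('i : K) (2^-1 : K) half2 i2 => i h hh i2.
  have -> : (x + i * y) * h + (x - i * y) * h = (2 * h) * x by ring.
  by rewrite hh mul1r.
have -> : (x + i * y) * (- i * h) + (x - i * y) * (i * h) = - (2 * h) * (i * i) * y by ring.
by rewrite hh i2 mulrNN mul1r mul1r.
Qed.

End ComplexCoordinates.

Local Open Scope complex_scope.

(** * Roots of unity and the dihedral group *)
Section Angles.
Variables (R : realType) (m : nat).
Hypothesis m_gt0 : (0 < m)%N.
Local Notation C := (R[i]).
Local Notation om := (@omega R m).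

(** The exponential [exp (i t)]. *)
Definition cis (t : R) : C := (cos t)%:C + 'i * (sin t)%:C.

Lemma cisE t : cis t = cos t +i* sin t.
Proof. by rewrite [RHS]complexE /= complexiE. Qed.

Lemma cisD s t : cis (s + t) = cis s * cis t.
Proof.
rewrite /cis cosD sinD rmorphB rmorphD !rmorphM /=.
have i2 : 'i * 'i = -1 :> C by rewrite -expr2 sqrCi.
ring: i2.
Qed.

Lemma cisN t : cis (- t) = (cos t)%:C - 'i * (sin t)%:C.
Proof. by rewrite /cis cosN sinN rmorphN mulrN. Qed.

Lemma cisNr t : cis t * cis (- t) = 1.
Proof. by rewrite -cisD subrr /cis cos0 sin0 mulr0 addr0. Qed.

Lemma conj_real (x : R) : Num.conj x%:C = x%:C :> C.
Proof. exact: conjc_real. Qed.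

Lemma conjE (x y : R) : Num.conj (x +i* y) = x -i* y :> C.
Proof. by []. Qed.

Lemma cis_conj t : Num.conj (cis t) = cis (- t).
Proof. by rewrite cisN /cis rmorphD rmorphM /= conjCi mulNr !conj_real. Qed.

Lemma omegaXE j : om ^+ j = cis (angle m j *+ 2).
Proof.
rewrite /angle.
elim: j => [|j IHj]; first by rewrite mulr0 mul0r mul0rn /cis cos0 sin0 mulr0 addr0.
rewrite exprSr IHj /omega.
have -> : (cos (2 * pi / m%:R) +i* sin (2 * pi / m%:R)) = cis (2 * pi / m%:R) :> C.
  by rewrite cisE.
rewrite -cisD; congr cis.
by rewrite -[j.+1]addn1 natrD; ring.
Qed.

Lemma omega_neq0 : om != 0.
Proof.
apply/eqP => om0; have := cisNr (angle m 1 *+ 2).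
by rewrite -omegaXE expr1 om0 mul0r => /eqP; rewrite eq_sym oner_eq0.
Qed.

Lemma omegaXm : om ^+ m = 1.
Proof.
rewrite omegaXE /angle mulfK ?pnatr_eq0 -?lt0n //.
by rewrite /cis cos2pi sin2pi mulr0 addr0.
Qed.

Lemma omega_conj j : Num.conj (om ^+ j) = om ^- j.
Proof.
rewrite omegaXE cis_conj; apply: (mulfI (x := cis (angle m j *+ 2))).
  by rewrite -omegaXE expf_neq0 ?omega_neq0.
by rewrite cisNr -omegaXE divff ?expf_neq0 ?omega_neq0.
Qed.

Lemma omegaX_neq1 j : (0 < j < m)%N -> om ^+ j != 1.
Proof.
case/andP=> j_gt0 j_lt; apply/eqP => omj.
have /(congr1 (@complex.Re R)) : cis (angle m j *+ 2) = 1 by rewrite -omegaXE.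
rewrite cisE /=.
have: 0 < sin (angle m j : R).
  apply: sin_gt0_pi; rewrite /angle divr_gt0 ?mulr_gt0 ?pi_gt0 ?ltr0n //=.
  by rewrite ltr_pdivrMr ?ltr0n // ltr_pM2l ?pi_gt0 // ltr_nat.
rewrite cos_mulr2n => s_gt0 c1; have := cos2Dsin2 (angle m j : R).
have := exprn_gt0 2 s_gt0; lra.
Qed.

(** Every index is congruent modulo [m] to one of the indices [1, ..., m] that
    label the reflections. *)
Lemma omegaX_ord j : exists i : 'I_m, om ^+ j = om ^+ i.+1.
Proof.
exists (Ordinal (ltn_pmod (j + m.-1) m_gt0)) => /=.
rewrite exprS expr_mod ?omegaXm // -exprS.
by rewrite -addnS prednK // exprD omegaXm mulr1.
Qed.

(** Conjugation by a reflection acts on the indices of the reflections by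
    [j |-> r - j] modulo [m], which permutes the residues; here [r - j] is
    written [r + (m - j)] to remain a natural number. *)
Lemma sum_periodic_reflect (U : nmodType) (F : nat -> U) r :
  (forall j, F (j + m)%N = F j) ->
  \sum_(i < m) F i.+1 = \sum_(i < m) F (r + (m - i.+1))%N.
Proof.
have shift (G : nat -> U) : (forall j, G (j + m)%N = G j) ->
    \sum_(i < m) G i.+1 = \sum_(i < m) G i.
  case: (m) m_gt0 => // n _ Gm.
  rewrite big_ord_recr [RHS]big_ord_recl addrC /= -[n.+1]add0n Gm.
  by congr (_ + _).
move=> Fm; rewrite shift //; transitivity (\sum_(i < m) F (r + i)%N).
  elim: r => [|r ->]; first exact: eq_bigr.
  rewrite -(shift (fun i => F (r + i)%N)) => [|j]; last by rewrite addnA Fm.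
  by apply: eq_bigr => i _; rewrite addnS.
by rewrite (reindex_inj rev_ord_inj).
Qed.

(** The orthogonal matrix whose first column is [w] and which is a reflection
    if [b] holds and a rotation otherwise. *)
Definition Gmx (w : C) (b : bool) : 'M[R]_2 :=
  \matrix_(i, j) (if j == 0 then (if i == 0 then complex.Re w else complex.Im w)
    else (-1) ^+ b * (if i == 0 then - complex.Im w else complex.Re w)).

Lemma GmxM w a w' b :
  Gmx w a *m Gmx w' b = Gmx (w * (if a then Num.conj w' else w')) (a (+) b).
Proof.
apply/matrixP => i j; rewrite !mxE !big_ord_recl big_ord0 !mxE /=.
case: w w' => [x y] [x' y']; rewrite conjE /=.
case: i => [[|[|//]]] ? /=; case: j => [[|[|//]]] ? /=;
  by case: a; case: b => /=; ring.
Qed.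

Lemma Gmx1 : 1%:M = Gmx 1 false.
Proof.
apply/matrixP => i j; rewrite !mxE /=.
by case: i => [[|[|//]]] ? /=; case: j => [[|[|//]]] ? /=; rewrite /= ?oppr0 ?mulr0 ?mulr1.
Qed.

Lemma reflE j : refl m j = Gmx (om ^+ j) true.
Proof.
rewrite omegaXE cisE; apply/matrixP => i k.
rewrite !mxE !big_ord_recl big_ord0 !mxE /=.
have := cos2Dsin2 (angle m j : R).
rewrite cos_mulr2n sin_mulr2n.
by case: i => [[|[|//]]] ? /=; case: k => [[|[|//]]] ? /=; lra.
Qed.

Lemma refl_mul j k : refl m j *m refl m k = Gmx (om ^+ j * om ^- k) false.
Proof. by rewrite !reflE GmxM omega_conj. Qed.

Lemma reflK j : refl m j *m refl m j = 1%:M :> 'M[R]_2.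
Proof. by rewrite refl_mul divff ?expf_neq0 ?omega_neq0 // -Gmx1. Qed.

Lemma invmx_refl j : invmx (refl m j) = refl m j :> 'M[R]_2.
Proof.
have U : (refl m j : 'M[R]_2) \in unitmx by case: (mulmx1_unit (reflK j)).
by apply: (can_inj (mulKmx U)); rewrite mulmxV // reflK.
Qed.

(** The elements of the group are determined by an [m]-th root of unity and a
    parity; [w ^+ m = 1] and [Num.conj w = w^-1] are what is needed to read a
    representation off from these data. *)
Lemma dihedralP g : in_dihedral m g ->
  exists w b, [/\ g = Gmx w b, w ^+ m = 1 & Num.conj w = w^-1].
Proof.
elim=> [|j h _ [w [b [-> wm wc]]]].
  by exists 1, false; rewrite Gmx1 expr1n rmorph1 invr1.
exists (om ^+ j.+1 * w^-1), (~~ b); split.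
- by rewrite reflE GmxM wc.
- by rewrite exprMn exprAC omegaXm expr1n exprVn wm invr1 mulr1.
by rewrite rmorphM fmorphV /= omega_conj wc invfM.
Qed.

Lemma in_dihedral_reflX j : in_dihedral m (refl m j : 'M[R]_2).
Proof.
have [i omi] := omegaX_ord j.
by rewrite reflE omi -reflE; exact: in_dihedral_refl.
Qed.

(** [s_k s_j s_k] is the reflection with index [2k - j]. *)
Lemma conj_invariant_refl (c : 'M[R]_2 -> R) j j' k : conj_invariant m c ->
  om ^+ j' * om ^+ j = om ^+ k.*2 -> c (refl m j') = c (refl m j).
Proof.
move=> cinv jk; have [i omi] := omegaX_ord j.
have := cinv _ (in_dihedral_reflX k) i.
rewrite invmx_refl [refl m i.+1]reflE -omi -reflE => <-; congr c.
rewrite refl_mul !reflE GmxM -[RHS]/(Gmx (_ * _) true); congr Gmx.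
have: om ^+ j != 0 by rewrite expf_neq0 ?omega_neq0.
by move=> /mulIf; apply; rewrite jk -addnn exprD mulrAC mulfVK ?expf_neq0 ?omega_neq0.
Qed.

End Angles.

(** * Polynomials on the plane *)
Section PlanePolynomials.
Variable K : fieldType.
Local Notation D := {poly {poly K}}.

(** Polynomial functions on the plane are polynomials in [x] with coefficients in
    the polynomials in [y]; [kst] embeds the scalars, as constants, and [lin]
    embeds the dual of the plane. *)
Definition kst : K -> D := polyC \o polyC.
HB.instance Definition _ := GRing.RMorphism.copy kst (polyC \o polyC).

Lemma kst_inj : injective kst.
Proof. by move=> a b /polyC_inj/polyC_inj. Qed.

Lemma kstM a b : kst (a * b) = kst a * kst b. Proof. exact: rmorphM. Qed.
Lemma kstD a b : kst (a + b) = kst a + kst b. Proof. exact: rmorphD. Qed.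
Lemma kstN a : kst (- a) = - kst a. Proof. exact: rmorphN. Qed.
Lemma kst0 : kst 0 = 0. Proof. exact: rmorph0. Qed.
Lemma kst1 : kst 1 = 1. Proof. exact: rmorph1. Qed.
Lemma kstN1 : kst (-1) = -1. Proof. exact: rmorphN1. Qed.

Definition lin (f : 'rV[K]_2) : D := kst (f 0 0) * 'X + kst (f 0 1) * 'X%:P.

Lemma linD e f : lin (e + f) = lin e + lin f.
Proof. by rewrite /lin !mxE !rmorphD !mulrDl addrACA. Qed.

Lemma linZ a f : lin (a *: f) = kst a * lin f.
Proof. by rewrite /lin !mxE !rmorphM mulrDr !mulrA. Qed.

Lemma linBZ f k a : lin (f - k *: a) = lin f - kst k * lin a.
Proof. by rewrite -scaleNr linD linZ rmorphN mulNr. Qed.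

(** The algebra of polynomials is generated by the linear forms. This is the
    induction principle by which everything below is proved, free of coordinates. *)
Lemma plane_ind (P : D -> Prop) :
  (forall a, P (kst a)) -> (forall f, P (lin f)) ->
  (forall p q, P p -> P q -> P (p + q)) ->
  (forall p q, P p -> P q -> P (p * q)) -> forall p, P p.
Proof.
move=> Pk Pl PD PM.
have PX : P 'X.
  have := Pl (delta_mx 0 0).
  by rewrite /lin !mxE /= !raddf0 rmorph1 mul1r mul0r addr0.
have PY : P 'X%:P.
  have := Pl (delta_mx 0 1).
  by rewrite /lin !mxE /= !raddf0 rmorph1 mul1r mul0r add0r.
have P0 : P 0 by rewrite -(rmorph0 kst).
have PC q : P q%:P.
  elim/poly_ind: q => [|q a IHq]; first by rewrite polyC0.
  by rewrite polyCD polyCM; apply: PD; [exact: PM | exact: Pk].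
elim/poly_ind => [|p q IHp]; first exact: P0.
exact: (PD _ _ (PM _ _ IHp PX) (PC _)).
Qed.

(** [K]-linearity, spelled out because [D] is a module over [{poly K}] and not
    over [K]. *)
Definition klin (F : D -> D) : Prop :=
  (forall p q, F (p + q) = F p + F q) /\ (forall a p, F (kst a * p) = kst a * F p).

Lemma klin0 F : klin F -> F 0 = 0.
Proof. by case=> _ /(_ 0 0); rewrite rmorph0 !mul0r. Qed.

Lemma klin_sum F (I : Type) (r : seq I) (G : I -> D) : klin F ->
  F (\sum_(i <- r) G i) = \sum_(i <- r) F (G i).
Proof. by move=> FK; apply: (big_morph F (proj1 FK)); apply: klin0. Qed.

Lemma map_mx_klin F n l (M : 'M[K]_(n, l)) (P : 'cV[D]_l) : klin F ->
  map_mx F (map_mx kst M *m P) = map_mx kst M *m map_mx F P.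
Proof.
move=> FK; apply/matrixP => i j; rewrite !mxE klin_sum //.
by apply: eq_bigr => k _; rewrite !mxE (proj2 FK).
Qed.

Section Substitution.
Variable g : 'M[K]_2.

Definition sub_inner : {poly K} -> D :=
  horner_eval (lin (row 1 g)) \o map_poly kst.
HB.instance Definition _ := GRing.RMorphism.copy sub_inner
  (horner_eval (lin (row 1 g)) \o map_poly kst).

(** The endomorphism induced by the linear substitution [f |-> f *m g]. *)
Definition sub : D -> D := horner_eval (lin (row 0 g)) \o map_poly sub_inner.
HB.instance Definition _ := GRing.RMorphism.copy sub
  (horner_eval (lin (row 0 g)) \o map_poly sub_inner).

Lemma sub_kst a : sub (kst a) = kst a.
Proof.
rewrite /sub /= /kst /= map_polyC /= /sub_inner /= map_polyC /= /horner_eval.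
by rewrite !hornerC.
Qed.

Lemma sub_lin f : sub (lin f) = lin (f *m g).
Proof.
rewrite {1}/lin rmorphD !rmorphM /= !sub_kst.
have -> : sub 'X = lin (row 0 g) by rewrite /sub /= map_polyX /horner_eval hornerX.
have -> : sub 'X%:P = lin (row 1 g).
  rewrite /sub /= map_polyC /= /horner_eval hornerC.
  by rewrite /sub_inner /= map_polyX /horner_eval hornerX.
rewrite /lin !mxE !big_ord_recl !big_ord0 !addr0 !rmorphD !rmorphM /=.
have -> : lift 0 0 = 1 :> 'I_2 by apply/val_inj.
ring.
Qed.

Lemma subD p q : sub (p + q) = sub p + sub q. Proof. exact: rmorphD. Qed.
Lemma subB p q : sub (p - q) = sub p - sub q. Proof. exact: rmorphB. Qed.
Lemma subM p q : sub (p * q) = sub p * sub q. Proof. exact: rmorphM. Qed.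

Lemma sub_klin : klin sub.
Proof. by split=> [p q|a p]; rewrite ?rmorphD ?rmorphM /= ?sub_kst. Qed.

End Substitution.

Lemma sub_comp g h p : sub g (sub h p) = sub (h *m g) p.
Proof.
elim/plane_ind: p => [a|f|p q IHp IHq|p q IHp IHq].
- by rewrite !sub_kst.
- by rewrite !sub_lin mulmxA.
- by rewrite !rmorphD /= IHp IHq.
- by rewrite !rmorphM /= IHp IHq.
Qed.

Lemma sub1 p : sub 1%:M p = p.
Proof.
elim/plane_ind: p => [a|f|p q IHp IHq|p q IHp IHq].
- by rewrite sub_kst.
- by rewrite sub_lin mulmx1.
- by rewrite rmorphD /= IHp IHq.
- by rewrite rmorphM /= IHp IHq.
Qed.

(** The derivative in the direction [u]. *)
Definition der (u : 'cV[K]_2) (p : D) : D :=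
  kst (u 0 0) * p^`() + kst (u 1 0) * map_poly (@deriv K) p.

Lemma map_deriv_mul (p q : D) : map_poly (@deriv K) (p * q) =
  map_poly (@deriv K) p * q + p * map_poly (@deriv K) q.
Proof.
apply/polyP => n; rewrite coefD !coefM coef_map coefM /= raddf_sum -big_split.
by apply: eq_bigr => i _ /=; rewrite derivM !coef_map.
Qed.

Lemma derD u p q : der u (p + q) = der u p + der u q.
Proof. by rewrite /der derivD raddfD !mulrDr addrACA. Qed.

Lemma derM u p q : der u (p * q) = der u p * q + p * der u q.
Proof. by rewrite /der derivM map_deriv_mul; ring. Qed.

Lemma der_kst u a : der u (kst a) = 0.
Proof. by rewrite /der derivC map_polyC /= derivC polyC0 !mulr0 addr0. Qed.

Lemma der_lin u f : der u (lin f) = kst ((f *m u) 0 0).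
Proof.
have dX : der u 'X = kst (u 0 0).
  rewrite /der derivX (_ : map_poly _ _ = 0) ?mulr0 ?mulr1 ?addr0 //.
  apply/polyP => n; rewrite coef_map coefX coef0.
  by case: eqP => _ /=; rewrite ?raddf0 // -[1]/(1%:P) derivC.
have dY : der u 'X%:P = kst (u 1 0).
  by rewrite /der derivC map_polyC /= derivX mulr0 mulr1 add0r.
rewrite /lin derD !derM !der_kst dX dY !mul0r !add0r -!rmorphM -rmorphD /=.
congr kst; rewrite !mxE !big_ord_recl !big_ord0 addr0.
by have -> : lift 0 0 = 1 :> 'I_2 by apply/val_inj.
Qed.

Lemma der_klin u : klin (der u).
Proof. by split=> [p q|a p]; rewrite ?derD // derM der_kst mul0r add0r. Qed.

Lemma der_linear a u v p : der (a *: u + v) p = kst a * der u p + der v p.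
Proof. by rewrite /der !mxE !rmorphD !rmorphM /=; ring. Qed.

Lemma sub_der g h u p : h *m g = 1%:M ->
  sub g (der u p) = der (h *m u) (sub g p).
Proof.
move=> hg; have gh := mulmx1C hg.
elim/plane_ind: p => [a|f|p q IHp IHq|p q IHp IHq].
- by rewrite sub_kst !der_kst rmorph0.
- by rewrite sub_lin !der_lin sub_kst mulmxA -(mulmxA f) gh mulmx1.
- by rewrite derD [in LHS]subD IHp IHq [in RHS]subD derD.
- rewrite derM [in LHS]subD [X in X + _]subM [X in _ + X]subM IHp IHq.
  by rewrite [in RHS]subM derM.
Qed.

Lemma lin_eq0 f : (lin f == 0) = (f == 0).
Proof.
apply/eqP/eqP => [lf0|->]; last by rewrite /lin !mxE !raddf0 !mul0r addr0.
have d (u : 'cV_2) : (f *m u) 0 0 = 0.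
  by apply: kst_inj; move: (der_lin u f); rewrite lf0 (klin0 (der_klin u)) rmorph0.
apply/matrixP => i j; rewrite ord1 mxE -[RHS](d (delta_mx j 0)).
by rewrite -colE mxE.
Qed.

End PlanePolynomials.
Arguments kst {K} a.

(** Divided differences along a reflection [1 - 2 b a] of the plane: [p] and its
    reflection agree on the line [a = 0]. *)
Section DividedDifference.
Variables (K : fieldType) (b : 'cV[K]_2) (a : 'rV[K]_2).
Local Notation D := {poly {poly K}}.
Definition refl_mx : 'M[K]_2 := 1%:M - 2 *: (b *m a).

Lemma mul_refl_mx f : f *m refl_mx = f - (2 * (f *m b) 0 0) *: a.
Proof.
rewrite mulmxBr mulmx1 -scalemxAr mulmxA -scalerA; congr (_ - _ *: _).
by rewrite {1}[f *m b]mx11_scalar mul_scalar_mx.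
Qed.

Lemma dd_exists (p : D) : exists q, p - sub refl_mx p = lin a * q.
Proof.
elim/plane_ind: p => [k|f|p q [p' Ep] [q' Eq]|p q [p' Ep] [q' Eq]].
- by exists 0; rewrite sub_kst subrr mulr0.
- exists (kst (2 * (f *m b) 0 0)).
  by rewrite sub_lin mul_refl_mx linBZ subKr mulrC.
- by exists (p' + q'); rewrite subD mulrDr -Ep -Eq; ring.
- exists (p' * q + sub refl_mx p * q').
  by rewrite subM mulrDr mulrA -Ep mulrCA -Eq; ring.
Qed.

(** [(p - s p) / a], as any quotient: it is unique once [a != 0]. *)
Definition dd (p : D) : D := sval (cid (dd_exists p)).

Lemma ddE p : p - sub refl_mx p = lin a * dd p.
Proof. by rewrite /dd; case: cid. Qed.

Hypothesis a_neq0 : a != 0.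

Lemma ddP p q : p - sub refl_mx p = lin a * q -> dd p = q.
Proof. by rewrite ddE => /mulfI; apply; rewrite lin_eq0. Qed.

Lemma ddD p q : dd (p + q) = dd p + dd q.
Proof. by apply: ddP; rewrite subD mulrDr -!ddE; ring. Qed.

Lemma dd_kst k : dd (kst k) = 0.
Proof. by apply: ddP; rewrite sub_kst subrr mulr0. Qed.

Lemma dd_kstM k p : dd (kst k * p) = kst k * dd p.
Proof. by apply: ddP; rewrite subM sub_kst mulrCA -ddE mulrBr. Qed.

(** The twisted Leibniz rule for a linear form. *)
Lemma dd_linM f p :
  dd (lin f * p) = lin f * dd p + kst (2 * (f *m b) 0 0) * sub refl_mx p.
Proof.
apply: ddP; rewrite subM sub_lin mulrDr mulrCA -ddE mul_refl_mx.
rewrite linBZ; move: (kst _) (sub _ p) => k q; ring.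
Qed.

Lemma dd_klin : klin dd.
Proof. by split; [exact: ddD | exact: dd_kstM]. Qed.

End DividedDifference.

Lemma sub_dd (K : fieldType) (b b' : 'cV[K]_2) (a a' : 'rV[K]_2) (g : 'M[K]_2) p :
  a' != 0 -> a *m g = a' -> g *m refl_mx b' a' = refl_mx b a *m g ->
  sub g (dd b a p) = dd b' a' (sub g p).
Proof.
move=> a'0 ag gs; symmetry; apply: ddP => //.
rewrite sub_comp gs -sub_comp -ag -sub_lin -subM -ddE.
by rewrite subB.
Qed.

Lemma ddN (K : fieldType) (b : 'cV[K]_2) (a : 'rV[K]_2) p : a != 0 ->
  dd (- b) (- a) p = - dd b a p.
Proof.
move=> a0; apply: ddP; first by rewrite oppr_eq0.
have -> : refl_mx (- b) (- a) = refl_mx b a by rewrite /refl_mx mulNmx mulmxN opprK.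
by rewrite ddE -scaleN1r linZ rmorphN1 mulN1r mulrNN.
Qed.

(** * The representations on the whole dihedral group *)
Section GroupRepresentation.
Variables (R : realType) (m : nat) (m_gt0 : (0 < m)%N).
Variables (tau : irrep) (tau_irr : is_irrep m tau).
Local Notation C := (R[i]).
Local Notation om := (@omega R m).

(** The representation on [Gmx w b]. Its values on the reflections alone are not
    enough to make the whole group act, so a formula in [w] and [b] replaces
    products of the matrices of the [s_j]. *)
Definition rho (w : C) (b : bool) : 'M[C]_(dimV tau) :=
  match tau return 'M[C]_(dimV tau) with
  | Triv => 1%:M
  | Sign => ((-1) ^+ b)%:M
  | Chi u => ((-1) ^+ (b && ~~ u) * w ^+ m./2)%:M
  | Rho u => \matrix_(i, j) (if (i == j) == b then 0
                             else if (j == 0) == b then w ^+ u else w ^- u)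
  end.

Lemma rho_refl j : repr_refl m tau j = rho (om ^+ j) true.
Proof.
rewrite /rho /repr_refl; case: tau tau_irr => [||u|u] //= irr.
- congr (_ %:M).
  have -> : om ^+ j ^+ m./2 = (-1) ^+ j.
    rewrite exprAC omegaXE; congr (_ ^+ _).
    have -> : angle m m./2 *+ 2 = pi :> R.
      rewrite /angle -mulrnAl -mulrnAr -mulrnA muln2 halfK (negPf irr) subn0.
      by rewrite mulfK // pnatr_eq0 -lt0n.
    by rewrite cisE cospi sinpi -(@rmorphN1 _ _ (@real_complex R)).
  rewrite -(signr_odd _ j); case: (odd j); case: u {irr} => //=; rewrite /= ?expr1 ?expr0; ring.
- apply/matrixP => a b; rewrite !mxE; case: eqP => //= _.
  by rewrite exprM; case: (b == 0).
Qed.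

Lemma rho1 : rho 1 false = 1%:M.
Proof.
rewrite /rho; case: tau => [||u|u] //=; first by rewrite mul1r expr1n.
apply/matrixP => a b; rewrite !mxE expr1n invr1 !if_same.
by case: (a == b).
Qed.

Lemma rhoM w a w' b : w ^+ m = 1 -> w' ^+ m = 1 ->
  rho w a *m rho w' b = rho (w * (if a then w'^-1 else w')) (a (+) b).
Proof.
move=> wm w'm.
have U (x : C) : x ^+ m = 1 -> x != 0.
  by move=> xm; apply/eqP => x0; move: xm; rewrite x0 expr0n gtn_eqF // => /eqP; rewrite eq_sym oner_eq0.
have w0 := U _ wm; have w'0 := U _ w'm.
rewrite /rho; case: tau tau_irr => [||u|u] /= irr.
- by rewrite mul1mx.
- by rewrite -scalar_mxM signr_addb.
- rewrite -scalar_mxM; congr (_ %:M).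
  have inv : w'^-1 ^+ m./2 = w' ^+ m./2.
    rewrite exprVn; apply: (mulfI (x := w' ^+ m./2)); first by rewrite expf_neq0.
    by rewrite divff ?expf_neq0 // -exprD addnn halfK (negPf irr) subn0.
  rewrite exprMn; case: a; case: b; case: u {irr}; rewrite /= ?inv ?expr1 ?expr0; ring.
- have w'u : w' ^+ u != 0 by rewrite expf_neq0.
  have wu : w ^+ u != 0 by rewrite expf_neq0.
  apply/matrixP => i j; rewrite !mxE !big_ord_recl big_ord0 !mxE /=.
  case: i => [[|[|//]]] ? /=; case: j => [[|[|//]]] ? /=;
  case: a; case: b; rewrite /= ?exprMn ?exprVn ?invfM ?invrK; field; rewrite ?wu ?w'u //.
Qed.

(** [rotcoef] and [is_reflection] recover [w] and [b] from [Gmx w b]. *)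
Definition rotcoef (g : 'M[R]_2) : C := g 0 0 +i* g 1 0.
Definition is_reflection (g : 'M[R]_2) : bool := g 0 0 * g 1 1 < g 0 1 * g 1 0.

(** The matrix of [g] on the representation space. *)
Definition grep g := rho (rotcoef g) (is_reflection g).

Lemma grep_Gmx w b : w ^+ m = 1 -> Num.conj w = w^-1 -> grep (Gmx w b) = rho w b.
Proof.
move=> wm wc; rewrite /grep; congr rho.
  by rewrite /rotcoef !mxE /=; case: (w).
have w0 : w != 0.
  by apply/eqP => x0; move: wm; rewrite x0 expr0n gtn_eqF // => /eqP; rewrite eq_sym oner_eq0.
have : w * Num.conj w = 1 by rewrite wc divff.
case: w {wm wc w0} => x y; rewrite conjE => /(congr1 (@complex.Re R)) /= xy.
rewrite /is_reflection !mxE /=; case: b; rewrite /= ?expr1 ?expr0.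
  by apply/idP; lra.
by apply/negP; lra.
Qed.

Lemma grep_refl j : grep (refl m j) = repr_refl m tau j.
Proof.
rewrite reflE // grep_Gmx ?rho_refl //; last exact: omega_conj.
by rewrite exprAC omegaXm ?expr1n.
Qed.

Lemma grep1 : grep 1%:M = 1%:M.
Proof. by rewrite Gmx1 grep_Gmx ?rho1 ?expr1n // rmorph1 invr1. Qed.

Lemma grepM g h : in_dihedral m g -> in_dihedral m h ->
  grep (g *m h) = grep g *m grep h.
Proof.
move=> /(dihedralP m_gt0)[w [a [-> wm wc]]] /(dihedralP m_gt0)[w' [b [-> w'm w'c]]].
rewrite GmxM !grep_Gmx // ?rhoM //; first by case: (a); rewrite // w'c.
  by case: (a); rewrite exprMn wm mul1r // w'c exprVn w'm invr1.
by case: (a); rewrite rmorphM /= wc ?conjCK ?w'c invfM // invrK.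
Qed.

End GroupRepresentation.

(** * Dunkl operators *)
Section VectorPolynomials.
Variables (K : fieldType) (d : nat).
Local Notation D := {poly {poly K}}.
Local Notation W := ('cV[D]_d).

(** The analogue of [klin] for vector-valued polynomials. *)
Definition klinW (F : W -> W) : Prop :=
  (forall P Q, F (P + Q) = F P + F Q) /\ (forall a P, F (kst a *: P) = kst a *: F P).

Lemma addWE (P Q : W) i j : (P + Q) i j = P i j + Q i j.
Proof. by rewrite mxE. Qed.

Lemma scaleWE p (P : W) i j : (p *: P) i j = p * P i j.
Proof. by rewrite mxE. Qed.

Lemma mapWE (F : D -> D) (P : W) i j : (map_mx F P) i j = F (P i j).
Proof. by rewrite mxE. Qed.

Lemma map_mx_scale (F G : D -> D) p q r (P : W) :
  (forall x, F (p * x) = q * F x + r * G x) ->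
  map_mx F (p *: P) = q *: map_mx F P + r *: map_mx G P.
Proof.
by move=> FE; apply/matrixP => i j; rewrite addWE !scaleWE !mapWE scaleWE FE.
Qed.

Lemma map_mx_scale1 (F : D -> D) p q (P : W) :
  (forall x, F (p * x) = q * F x) -> map_mx F (p *: P) = q *: map_mx F P.
Proof. by move=> FE; apply/matrixP => i j; rewrite scaleWE !mapWE scaleWE FE. Qed.

Lemma map_mx_scale2 (F : D -> D) p q r (P : W) :
  (forall x, F (p * x) = q * F x + r * x) ->
  map_mx F (p *: P) = q *: map_mx F P + r *: P.
Proof.
by move=> FE; apply/matrixP => i j; rewrite addWE !scaleWE !mapWE scaleWE FE.
Qed.

Lemma map_mx_eq (F G H : D -> D) q (P : W) :
  (forall x, F x = q * G x + H x) -> map_mx F P = q *: map_mx G P + map_mx H P.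
Proof.
by move=> FE; apply/matrixP => i j; rewrite addWE !scaleWE !mapWE FE.
Qed.

Lemma map_mx_comp (F G F' G' : D -> D) (P : W) :
  (forall x, F (G x) = F' (G' x)) ->
  map_mx F (map_mx G P) = map_mx F' (map_mx G' P).
Proof. by move=> FE; apply/matrixP => i j; rewrite !mapWE FE. Qed.

Lemma map_klinD F (P Q : W) : klin F -> map_mx F (P + Q) = map_mx F P + map_mx F Q.
Proof. by case=> FD _; apply/matrixP => i j; rewrite !mxE FD. Qed.

Lemma map_klinZ F a (P : W) : klin F -> map_mx F (kst a *: P) = kst a *: map_mx F P.
Proof. by case=> _ FZ; apply: map_mx_scale1. Qed.

Lemma klinW_sum F (I : Type) (r : seq I) (G : I -> W) : klinW F ->
  F (\sum_(i <- r) G i) = \sum_(i <- r) F (G i).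
Proof.
case=> FD FZ; apply: (big_morph F FD).
by have := FZ 0 0; rewrite rmorph0 !scale0r.
Qed.

Lemma klinWB F P Q : klinW F -> F (P - Q) = F P - F Q.
Proof.
case=> FD FZ.
have N : F (- Q) = - F Q.
  by have := FZ (-1) Q; rewrite kstN1 !scaleN1r.
by rewrite FD N.
Qed.

(** A group element acts on vector-valued polynomials through a matrix [A] on the
    values and a substitution [h] in the argument. *)
Definition gact (A : 'M[K]_d) (h : 'M[K]_2) (P : W) : W :=
  map_mx kst A *m map_mx (sub h) P.

Lemma gact_klin A h : klinW (gact A h).
Proof.
split=> [P Q|e P]; rewrite /gact.
  by rewrite map_klinD ?mulmxDr //; exact: sub_klin.
by rewrite map_klinZ -?scalemxAr //; exact: sub_klin.
Qed.

Lemma gact_lin A h f P : gact A h (lin f *: P) = lin (f *m h) *: gact A h P.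
Proof.
rewrite /gact [RHS]scalemxAr; congr (_ *m _).
by apply: map_mx_scale1 => x; rewrite subM sub_lin.
Qed.

Lemma gact_const A h (v : 'cV[K]_d) :
  gact A h (map_mx kst v) = map_mx kst (A *m v).
Proof.
rewrite /gact map_mxM; congr (_ *m _).
by apply/matrixP => i l; rewrite !mxE sub_kst.
Qed.

Lemma gact1 P : gact 1%:M 1%:M P = P.
Proof.
rewrite /gact map_mx1 mul1mx.
by apply/matrixP => i l; rewrite mxE sub1.
Qed.

Lemma gactM A h B l P : gact A h (gact B l P) = gact (A *m B) (l *m h) P.
Proof.
rewrite /gact map_mx_klin; last exact: sub_klin.
rewrite mulmxA -map_mxM; congr (_ *m _).
by apply/matrixP => i j; rewrite !mapWE sub_comp.
Qed.

Lemma klinW_comp F G : klinW F -> klinW G -> klinW (F \o G).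
Proof. by move=> [FD FZ] [GD GZ]; split=> [P Q|e P] /=; rewrite ?GD ?FD ?GZ ?FZ. Qed.

Lemma scaleWC p q (P : W) : p *: (q *: P) = q *: (p *: P).
Proof. by rewrite !scalerA mulrC. Qed.

Lemma klinW_scale p : klinW (fun P => p *: P).
Proof. by split=> [P Q|e P]; [rewrite scalerDr | rewrite !scalerA mulrC]. Qed.

Lemma klinW_add F G : klinW F -> klinW G -> klinW (fun P => F P + G P).
Proof.
move=> [FD FZ] [GD GZ]; split=> [P Q|e P]; first by rewrite FD GD addrACA.
by rewrite FZ GZ scalerDr.
Qed.

Lemma klinW_sub F G : klinW F -> klinW G -> klinW (fun P => F P - G P).
Proof.
move=> [FD FZ] [GD GZ]; split=> [P Q|e P].
  by rewrite FD GD opprD addrACA.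
by rewrite FZ GZ scalerBr.
Qed.

(** The next four identities isolate rearrangements used for Dunkl operators, with
    the operators replaced by variables. *)
Lemma scale_add_sub p (P Q X Y : W) :
  X = Y -> (p *: P + X) - (p *: Q + Y) = p *: (P - Q).
Proof. by move=> ->; rewrite opprD addrACA subrr addr0 scalerBr. Qed.

Lemma sum_scale_opp n (e e' : 'I_n -> K) (X : 'I_n -> W) :
  (forall i, e i = - e' i) ->
  \sum_(i < n) kst (e i) *: X i = - \sum_(i < n) kst (e' i) *: X i.
Proof.
by move=> ee; rewrite -sumrN; apply: eq_bigr => i _; rewrite ee kstN scaleNr.
Qed.

Lemma swap_sum n p q (P Q : W) (F G : 'I_n -> W) : (forall i, F i = G i) ->
  p *: P + q *: Q - \sum_(i < n) F i = q *: Q + p *: P - \sum_(i < n) G i.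
Proof. by move=> FG; rewrite addrC [q *: Q + _]addrC addrC (eq_bigr _ (fun i _ => FG i)). Qed.

Lemma swap_sum3 p q r e e' (P Q S : W) : e = e' ->
  p *: (q *: P + r *: Q + kst e *: S) = p *: (r *: Q + q *: P + kst e' *: S).
Proof. by move=> ->; rewrite [r *: Q + _]addrC. Qed.

End VectorPolynomials.

(** Dunkl operators for an abstract system of roots [b j] and coroots [a j] with
    multiplicities [k j] and matrices [r j] of the reflections. The system extends
    to all indices [j : nat] with period [m] up to sign, so that conjugation by a
    reflection can be expressed by arithmetic on the indices. *)
Section Dunkl.
Variables (K : fieldType) (d m : nat).
Variables (b : nat -> 'cV[K]_2) (a : nat -> 'rV[K]_2).
Variables (k : nat -> K) (r : nat -> 'M[K]_d).
Local Notation D := {poly {poly K}}.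
Local Notation W := ('cV[D]_d).
Local Notation s j := (refl_mx (b j) (a j)).

Hypothesis a_neq0 : forall j, a j != 0.

(** [T_u = d_u - sum_j k_j <a_j, u> r_j (1 - s_j) / a_j]. *)
Definition dunkl (u : 'cV[K]_2) (P : W) : W :=
  map_mx (der u) P - \sum_(i < m) kst (k i.+1 * (a i.+1 *m u) 0 0) *:
    (map_mx kst (r i.+1) *m map_mx (dd (b i.+1) (a i.+1)) P).

Definition ract (j : nat) : W -> W := gact (r j) (s j).

Lemma dunkl_klin u : klinW (dunkl u).
Proof.
have L j : klin (dd (b j) (a j)) := dd_klin _ (a_neq0 j).
split=> [P Q|e P]; rewrite /dunkl.
  rewrite map_klinD; last exact: der_klin.
  rewrite addrACA -opprD -big_split; congr (_ - _); apply: eq_bigr => i _ /=.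
  by rewrite map_klinD // mulmxDr scalerDr.
rewrite map_klinZ; last exact: der_klin.
rewrite scalerBr scaler_sumr; congr (_ - _); apply: eq_bigr => i _ /=.
by rewrite map_klinZ // -scalemxAr !scalerA mulrC.
Qed.

Lemma dunkl_linear e u v P : dunkl (e *: u + v) P = kst e *: dunkl u P + dunkl v P.
Proof.
rewrite /dunkl scalerBr addrACA -opprD; congr (_ - _).
  exact/map_mx_eq/der_linear.
rewrite scaler_sumr -big_split; apply: eq_bigr => i _ /=.
rewrite scalerA -scalerDl -rmorphM -rmorphD; congr (kst _ *: _).
by rewrite mulmxDr -scalemxAr !mxE; ring.
Qed.

(** The commutator of [T_u] with a linear form is the one prescribed in the
    Cherednik algebra. *)
Lemma dunkl_lin u f P : dunkl u (lin f *: P) = lin f *: dunkl u P +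
  (kst ((f *m u) 0 0) *: P -
   \sum_(i < m) kst (2 * k i.+1 * (f *m b i.+1) 0 0 * (a i.+1 *m u) 0 0) *:
     ract i.+1 P).
Proof.
rewrite /dunkl.
have -> : map_mx (der u) (lin f *: P) =
    lin f *: map_mx (der u) P + kst ((f *m u) 0 0) *: P.
  by apply: map_mx_scale2 => x; rewrite derM der_lin addrC.
have E i : map_mx (dd (b i) (a i)) (lin f *: P) =
    lin f *: map_mx (dd (b i) (a i)) P +
    kst (2 * (f *m b i) 0 0) *: map_mx (sub (s i)) P.
  by apply: map_mx_scale => x; rewrite dd_linM.
rewrite [X in _ - X](_ : _ =
    lin f *: (\sum_(i < m) kst (k i.+1 * (a i.+1 *m u) 0 0) *:
      (map_mx kst (r i.+1) *m map_mx (dd (b i.+1) (a i.+1)) P)) +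
    \sum_(i < m) kst (2 * k i.+1 * (f *m b i.+1) 0 0 * (a i.+1 *m u) 0 0) *:
     ract i.+1 P).
  by rewrite opprD addrACA -scalerBr.
rewrite scaler_sumr -big_split; apply: eq_bigr => i _ /=.
rewrite E mulmxDr scalerDr -!scalemxAr !scalerA -rmorphM [_ * lin f]mulrC.
by congr (_ + kst _ *: _); ring.
Qed.

Lemma dunkl_const u (v : 'cV[K]_d) : dunkl u (map_mx kst v) = 0.
Proof.
rewrite /dunkl [X in X - _](_ : _ = 0) ?sub0r; last first.
  by apply/matrixP => i j; rewrite !mxE der_kst.
rewrite big1 ?oppr0 // => i _.
rewrite [map_mx (dd _ _) _](_ : _ = 0) ?mulmx0 ?scaler0 //.
apply/matrixP => j l; rewrite mapWE [RHS]mxE.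
have -> : (map_mx kst v) j l = kst (v j l) by rewrite mxE.
exact: dd_kst.
Qed.

Hypothesis a_mul_b : forall j, (a j *m b j) 0 0 = 1.
Hypothesis m_gt0 : (0 < m)%N.
Hypotheses (aDm : forall j, a (j + m)%N = - a j) (bDm : forall j, b (j + m)%N = - b j)
  (kDm : forall j, k (j + m)%N = k j) (rDm : forall j, r (j + m)%N = r j).
Hypotheses
  (a_reflect : forall i j, (j <= m)%N -> a j *m s i = a (i.*2 + (m - j))%N)
  (s_reflect : forall i j, (j <= m)%N -> s i *m s (i.*2 + (m - j)) = s j *m s i)
  (k_reflect : forall i j, (j <= m)%N -> k (i.*2 + (m - j))%N = k j)
  (r_reflect : forall i j, (j <= m)%N -> r (i.*2 + (m - j)) *m r i = r i *m r j).

Lemma sK j : s j *m s j = 1%:M.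
Proof.
rewrite {1}/refl_mx mulmxBl mul1mx -scalemxAl -mulmxA mul_refl_mx a_mul_b.
rewrite mulr1 scaler_nat mulr2n opprD addNKr mulmxN scalerN opprK.
by rewrite /refl_mx subrK.
Qed.

(** Equivariance of Dunkl operators: conjugation by [s_j] permutes the terms of
    the sum over the reflections. *)
Lemma ract_dunkl j u P : ract j (dunkl u P) = dunkl (s j *m u) (ract j P).
Proof.
pose F i := kst (k i * (a i *m (s j *m u)) 0 0) *:
    (map_mx kst (r i) *m map_mx (dd (b i) (a i)) (ract j P)).
have FDm i : F (i + m)%N = F i.
  rewrite /F kDm rDm aDm bDm mulNmx [(- _ : 'M_1) 0 0]mxE mulrN.
  have -> : map_mx (dd (- b i) (- a i)) (ract j P) =
      kst (-1) *: map_mx (dd (b i) (a i)) (ract j P).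
    by apply/matrixP => x y; rewrite scaleWE !mapWE ddN // kstN1 mulN1r.
  rewrite -scalemxAr scalerA -rmorphM.
  by rewrite mulrN1 opprK.
rewrite [RHS]/dunkl -[X in _ = _ - X]/(\sum_(i < m) F i.+1).
rewrite (sum_periodic_reflect m_gt0 j.*2 FDm).
rewrite /dunkl klinWB; last exact: gact_klin.
rewrite klinW_sum; last exact: gact_klin.
congr (_ - _).
  rewrite /ract /gact map_mx_klin; last exact: der_klin.
  congr (_ *m _); apply: map_mx_comp => x.
  by apply: sub_der; exact: sK.
have [_ rZ] : klinW (ract j) := gact_klin _ _.
apply: eq_bigr => i _; rewrite rZ /F.
have im : (i.+1 <= m)%N by [].
rewrite -a_reflect // k_reflect // -mulmxA [s j *m _]mulmxA sK mul1mx.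
congr (_ *: _); rewrite /ract /gact.
rewrite map_mx_klin; last exact: sub_klin.
rewrite a_reflect // map_mx_klin; last exact/dd_klin.
rewrite !mulmxA -!map_mxM r_reflect //; congr (_ *m _).
apply: map_mx_comp => x.
by apply: sub_dd => //; [exact: a_reflect | exact: s_reflect].
Qed.

Lemma refl_mul_vec j u : s j *m u = (- 2 * (a j *m u) 0 0) *: b j + u.
Proof.
rewrite /refl_mx mulmxBl mul1mx -scalemxAl -mulmxA {1}[a j *m u]mx11_scalar.
by rewrite mul_mx_scalar scalerA mulNr scaleNr addrC.
Qed.

(** The value of [dunkl u \o dunkl v] on [lin f *: P], with the symmetric part
    of the sum over the reflections made explicit. *)
Lemma dunkl2_lin u v f P : dunkl u (dunkl v (lin f *: P)) =
  lin f *: dunkl u (dunkl v P) +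
  (kst ((f *m u) 0 0) *: dunkl v P + kst ((f *m v) 0 0) *: dunkl u P -
   \sum_(i < m) kst (2 * k i.+1 * (f *m b i.+1) 0 0) *:
     (kst ((a i.+1 *m u) 0 0) *: dunkl v (ract i.+1 P) +
      kst ((a i.+1 *m v) 0 0) *: dunkl u (ract i.+1 P) +
      kst (-2 * (a i.+1 *m u) 0 0 * (a i.+1 *m v) 0 0) *:
        dunkl (b i.+1) (ract i.+1 P))).
Proof.
have [TD TZ] := dunkl_klin u; have TB := klinWB _ _ (dunkl_klin u).
rewrite dunkl_lin TD TB TZ dunkl_lin -addrA; congr (_ + _).
rewrite (klinW_sum _ _ (dunkl_klin u)) addrACA; congr (_ + _).
rewrite -opprD -big_split; congr (- _); apply: eq_bigr => i _ /=.
rewrite TZ ract_dunkl refl_mul_vec dunkl_linear.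
move: (dunkl _ _) (dunkl _ _) (dunkl _ _) => B X Y.
rewrite !scalerDr !scalerA -!kstM -addrA addrC; congr (_ + _ + _ *: _).
by congr kst; ring.
Qed.

(** By [dunkl2_lin], which is symmetric in [u] and [v] apart from its first term,
    the commutator [Q] of two Dunkl operators commutes with linear forms, hence
    with all polynomials; and it kills the constants. *)
Lemma dunkl_comm u v P : dunkl u (dunkl v P) = dunkl v (dunkl u P).
Proof.
pose Q P := dunkl u (dunkl v P) - dunkl v (dunkl u P).
have QK : klinW Q.
  by apply: klinW_sub; apply: klinW_comp; exact: dunkl_klin.
have Qlin f P1 : Q (lin f *: P1) = lin f *: Q P1.
  have E1 := dunkl2_lin u v f P1; have E2 := dunkl2_lin v u f P1.
  have := congr2 (fun A B => A - B) E1 E2.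
  rewrite (scale_add_sub _ _ _ _) => [E|]; first exact: E.
  apply: swap_sum => i; apply: swap_sum3.
  by rewrite mulrAC.
have QM p P1 : Q (p *: P1) = p *: Q P1.
  elim/plane_ind: p P1 => [e|f|p q IHp IHq|p q IHp IHq] P1.
  - exact: (proj2 QK).
  - exact: Qlin.
  - by rewrite !scalerDl (proj1 QK) IHp IHq.
  by rewrite -!scalerA IHp IHq.
suff QP : Q P = 0 by apply/eqP; rewrite -subr_eq0; apply/eqP.
have -> : P = \sum_i P i 0 *: map_mx kst (delta_mx i 0).
  apply/matrixP => i j; rewrite ord1 summxE (bigD1 i) //= big1 => [|l li].
    by rewrite !mxE !eqxx rmorph1 mulr1 addr0.
  by rewrite !mxE eq_sym (negPf li) rmorph0 mulr0.
rewrite (klinW_sum _ _ QK); apply: big1 => i _.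
have Z w : dunkl w 0 = 0.
  by have := proj2 (dunkl_klin w) 0 0; rewrite rmorph0 !scale0r.
by rewrite QM /Q !dunkl_const !Z subrr scaler0.
Qed.

End Dunkl.

(** * The Dunkl operator model of the Cherednik algebra *)
Lemma invmx_mul (K : comUnitRingType) n (A B : 'M[K]_n) :
  A \in unitmx -> B \in unitmx -> invmx (A *m B) = invmx B *m invmx A.
Proof.
move=> AU BU; have ABU : A *m B \in unitmx by rewrite unitmx_mul AU.
apply: (can_inj (mulKmx ABU)).
by rewrite mulmxV // -mulmxA (mulmxA B) mulmxV // mul1mx mulmxV.
Qed.

Section Model.
Variables (R : realType) (m : nat) (m_gt0 : (0 < m)%N).
Variables (c : 'M[R]_2 -> R) (c_inv : conj_invariant m c).
Variables (tau : irrep) (tau_irr : is_irrep m tau).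
Local Notation C := (R[i]).
Local Notation om := (@omega R m).
Local Notation D := {poly {poly C}}.
Local Notation W := ('cV[D]_(dimV tau)).

Local Notation al j := (cplx (alpha m j) : 'cV[C]_2).
Local Notation co j := (cplx (coalpha m j) : 'rV[C]_2).
Local Notation cj j := ((c (refl m j))%:C : C).
Local Notation rr j := (repr_refl m tau j : 'M[C]_(dimV tau)).

Lemma refl_mxE j : refl_mx (al j) (co j) = cplx (refl m j).
Proof.
rewrite /refl /refl_mx map_mxB map_mx1 map_mxZ map_mxM.
by rewrite (rmorph_nat (real_complex R)).
Qed.

Lemma co_mul_al j : (co j *m al j) 0 0 = 1.
Proof.
rewrite -map_mxM mxE !mxE !big_ord_recl big_ord0 !mxE /= addr0.
by rewrite mulrNN -!expr2 addrC cos2Dsin2.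
Qed.

Lemma co_neq0 j : co j != 0.
Proof.
apply/eqP => co0; have := co_mul_al j.
by rewrite co0 mul0mx mxE => /eqP; rewrite eq_sym oner_eq0.
Qed.

Lemma angleD j : angle m (j + m) = angle m j + pi :> R.
Proof. by rewrite /angle natrD mulrDr mulrDl mulfK // pnatr_eq0 -lt0n. Qed.

Lemma alDm j : al (j + m)%N = - al j.
Proof.
apply/matrixP => i k; rewrite !mxE angleD sinDpi cosDpi.
by case: (i == 0); rewrite rmorphN.
Qed.

Lemma coDm j : co (j + m)%N = - co j.
Proof.
apply/matrixP => i k; rewrite !mxE angleD sinDpi cosDpi.
by case: (k == 0); rewrite rmorphN.
Qed.

Lemma reflDm j : refl m (j + m) = refl m j :> 'M[R]_2.
Proof. by rewrite !reflE // exprD omegaXm ?mulr1. Qed.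

Lemma coalpha_refl j k : (j <= m)%N ->
  coalpha m j *m refl m k = coalpha m (k.*2 + (m - j)) :> 'rV[R]_2.
Proof.
move=> jm; have -> : coalpha m (k.*2 + (m - j)) =
    \row_i (if i == 0 then - sin (angle m k *+ 2 - angle m j)
            else cos (angle m k *+ 2 - angle m j)) :> 'rV[R]_2.
  have E : angle m (k.*2 + (m - j)) = angle m k *+ 2 - angle m j + pi :> R.
    rewrite /angle natrD natrB // -muln2 natrM.
    have : m%:R != 0 :> R by rewrite pnatr_eq0 -lt0n.
    move: (m%:R : R) pi => M p M0; by field.
  by apply/matrixP => i l; rewrite !mxE E sinDpi cosDpi opprK.
apply/matrixP => i l; rewrite !mxE !big_ord_recl big_ord0 !mxE /= !big_ord_recl !big_ord0 !mxE /=.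
rewrite sinB cosB cos_mulr2n sin_mulr2n.
have c2 : cos (angle m k) ^+ 2 = 1 - sin (angle m k) ^+ 2 :> R.
  by rewrite -(cos2Dsin2 (angle m k)) addrK.
by case: l => [[|[|//]]] ? /=; ring: c2.
Qed.

Lemma co_refl j k : (j <= m)%N ->
  co j *m cplx (refl m k) = co (k.*2 + (m - j))%N.
Proof. by move=> jm; rewrite -map_mxM coalpha_refl. Qed.

Lemma omega_reflect j k : (j <= m)%N ->
  om ^+ (k.*2 + (m - j)) * om ^+ j = om ^+ k.*2.
Proof. by move=> jm; rewrite -exprD -addnA subnK // exprD omegaXm ?mulr1. Qed.

Lemma refl_reflect j k : (j <= m)%N ->
  refl m (k.*2 + (m - j)) *m refl m k = refl m k *m refl m j :> 'M[R]_2.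
Proof.
move=> jm; rewrite !refl_mul //; congr Gmx.
have n0 i : om ^+ i != 0 by rewrite expf_neq0 ?omega_neq0.
apply: (mulfI (n0 j)); rewrite mulrA [om ^+ j * _]mulrC omega_reflect //.
by rewrite mulrCA divff // mulr1 -addnn exprD mulfK.
Qed.

Local Notation alj := (fun j => al j).
Local Notation coj := (fun j => co j).
Local Notation kj := (fun j => cj j).
Local Notation rj := (fun j => rr j).

Definition hdunkl (u : 'cV[C]_2) (P : W) : W := dunkl m alj coj kj rj u P.

(** The action of [g] on vector-valued polynomials. *)
Definition hgact (g : 'M[R]_2) (P : W) : W :=
  gact (grep m tau g) (cplx (invmx g)) P.

Lemma hgact_refl j P : hgact (refl m j) P = ract alj coj rj j P.
Proof.
have E : cplx (invmx (refl m j)) = refl_mx (al j) (co j).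
  by rewrite refl_mxE invmx_refl.
by rewrite /hgact E (@grep_refl _ _ m_gt0 _ tau_irr).
Qed.

Lemma reprDm j : rr (j + m)%N = rr j.
Proof. by rewrite !rho_refl // exprD omegaXm ?mulr1. Qed.

Lemma cDm j : cj (j + m)%N = cj j.
Proof. by rewrite reflDm. Qed.

Lemma c_reflect i j : (j <= m)%N -> cj (i.*2 + (m - j))%N = cj j.
Proof.
by move=> jm; rewrite (conj_invariant_refl m_gt0 c_inv (omega_reflect i jm)).
Qed.

Lemma repr_reflect i j : (j <= m)%N ->
  rr (i.*2 + (m - j))%N *m rr i = rr i *m rr j.
Proof.
have G l := @grep_refl R _ m_gt0 _ tau_irr l.
have I l := @in_dihedral_reflX R _ m_gt0 l.
move=> jm; rewrite -(G (i.*2 + (m - j))%N) -(G i) -(G j).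
have M h l := @grepM R _ m_gt0 _ tau_irr _ _ (I h) (I l).
exact: etrans (esym (M (i.*2 + (m - j))%N i))
  (etrans (congr1 (grep m tau) (refl_reflect i jm)) (M i j)).
Qed.

Lemma s_reflect i j : (j <= m)%N ->
  refl_mx (al i) (co i) *m refl_mx (al (i.*2 + (m - j))) (co (i.*2 + (m - j))) =
  refl_mx (al j) (co j) *m refl_mx (al i) (co i).
Proof.
move=> jm; rewrite !refl_mxE -!map_mxM; congr (map_mx _ _).
have swap (S S' T : 'M[R]_2) : S *m S = 1%:M -> S' *m S = S *m T -> S *m S' = T *m S.
  move=> SS ST; rewrite -[LHS]mulmx1 -SS mulmxA -(mulmxA S S' S) ST mulmxA SS.
  by rewrite mul1mx.
exact: swap (reflK _ _ i) (refl_reflect i jm).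
Qed.

Lemma a_reflect i j : (j <= m)%N ->
  co j *m refl_mx (al i) (co i) = co (i.*2 + (m - j))%N.
Proof. by move=> jm; rewrite refl_mxE co_refl. Qed.

Lemma hdunkl_commute u v P : hdunkl u (hdunkl v P) = hdunkl v (hdunkl u P).
Proof.
exact: (dunkl_comm co_neq0 co_mul_al m_gt0 coDm alDm cDm reprDm a_reflect s_reflect
  c_reflect repr_reflect).
Qed.

Lemma hgact_hdunkl_refl j u P : hgact (refl m j) (hdunkl u P) =
  hdunkl (cplx (refl m j) *m u) (hgact (refl m j) P).
Proof.
rewrite !hgact_refl /hdunkl -refl_mxE.
exact: (ract_dunkl co_neq0 co_mul_al m_gt0 coDm alDm cDm reprDm a_reflect s_reflect
  c_reflect repr_reflect).
Qed.

Lemma hgact1 P : hgact 1%:M P = P.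
Proof. by rewrite /hgact grep1 // invmx1 map_mx1 gact1. Qed.

Lemma dihedral_unit (g : 'M[R]_2) : in_dihedral m g -> g \in unitmx.
Proof.
elim=> [|j h _ hU]; first exact: unitmx1.
by rewrite unitmx_mul hU andbT; case: (mulmx1_unit (@reflK R m j.+1)).
Qed.

Lemma hgactM (g h : 'M[R]_2) P : in_dihedral m g -> in_dihedral m h ->
  hgact (g *m h) P = hgact g (hgact h P).
Proof.
move=> gG hG; have gU := dihedral_unit gG; have hU := dihedral_unit hG.
have E : invmx (g *m h) = invmx h *m invmx g := invmx_mul gU hU.
rewrite /hgact (grepM m_gt0 tau_irr gG hG) E map_mxM.
exact: esym (gactM _ _ _ _ _).
Qed.

(** It suffices to know the equivariance under reflections, which generate. *)
Lemma hgact_hdunkl (g : 'M[R]_2) u P : in_dihedral m g ->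
  hgact g (hdunkl u P) = hdunkl (cplx g *m u) (hgact g P).
Proof.
move=> gG; elim: gG u P => [|j h hG IH] u P; first by rewrite map_mx1 mul1mx !hgact1.
rewrite !hgactM //; try exact: in_dihedral_refl.
by rewrite IH hgact_hdunkl_refl map_mxM mulmxA.
Qed.

(** Expressions in the generators act on vector-valued polynomials: vectors by
    Dunkl operators, covectors by multiplication. *)
Fixpoint Heval (t : Hterm R m) (P : W) : W :=
  match t with
  | Tvec u => hdunkl u P
  | Tcov f => lin f *: P
  | Tgrp g _ => hgact g P
  | Tsca e => kst e *: P
  | Tadd s t => Heval s P + Heval t P
  | Tmul s t => Heval s (Heval t P)
  end.

Lemma Heval_klin t : klinW (Heval t).
Proof.
elim: t => [u|f|g h|e|s sL t tL|s sL t tL] /=.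
- exact: dunkl_klin co_neq0 u.
- exact: klinW_scale.
- exact: gact_klin.
- exact: klinW_scale.
- exact: klinW_add.
exact: (klinW_comp sL tL).
Qed.

Lemma Heval_comm u f P : Heval (Tcomm m c u f) P =
  kst ((f *m u) 0 0) *: P -
   \sum_(i < m) kst (2 * cj i.+1 * (f *m al i.+1) 0 0 * (co i.+1 *m u) 0 0) *:
     ract alj coj rj i.+1 P.
Proof.
have E (F : 'I_m -> Hterm R m) :
    Heval (\big[@Tadd R m/Tsca m 0]_(i < m) F i) P = \sum_(i < m) Heval (F i) P.
  apply: (big_morph (fun t => Heval t P)) => //=.
  by rewrite kst0 scale0r.
rewrite [LHS]/(kst _ *: P + Heval _ P) E; congr (_ + _).
apply: etrans (_ : \sum_(i < m)
    kst (- (2 * cj i.+1 * (f *m al i.+1) 0 0 * (co i.+1 *m u) 0 0)) *: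
    ract alj coj rj i.+1 P = _); last by apply: sum_scale_opp => i.
apply: eq_bigr => i _.
rewrite [LHS]/(kst _ *: hgact _ _) hgact_refl; congr (kst _ *: _).
by move: (cj _) (_ 0 0) (_ 0 0) => x y z; ring.
Qed.

(** The defining relations hold for the Dunkl operators. *)
Lemma Heval_sound s t : @Heq R m c s t -> forall P, Heval s P = Heval t P.
Proof.
elim=> {s t}.
- by [].
- by move=> s t _ IH P; rewrite IH.
- by move=> s t u _ IH1 _ IH2 P; rewrite IH1 IH2.
- by move=> s s' t t' _ IH1 _ IH2 P /=; rewrite IH1 IH2.
- by move=> s s' t t' _ IH1 _ IH2 P /=; rewrite IH2 IH1.
- by move=> s t u P /=; rewrite addrA.
- by move=> s t P /=; rewrite addrC.
- by move=> s P /=; rewrite kst0 scale0r add0r.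
- by move=> s P /=; rewrite kstN1 scaleN1r addNr kst0 scale0r.
- by [].
- by move=> s P /=; rewrite kst1 scale1r.
- by [].
- by move=> s t u P /=; rewrite (proj1 (Heval_klin s)).
- by move=> e f P /=; rewrite kstD scalerDl.
- by move=> e f P /=; rewrite kstM scalerA.
- by move=> e s P /=; rewrite (proj2 (Heval_klin s)).
- by move=> e u v P /=; exact: dunkl_linear.
- by move=> e f f' P /=; rewrite linD linZ scalerDl scalerA.
- by move=> h1 P /=; rewrite hgact1 kst1 scale1r.
- by move=> g g' hg hg' hgg' P /=; rewrite hgactM.
- by move=> g hg u P /=; exact: hgact_hdunkl.
- by move=> g hg f P /=; exact: gact_lin.
- by move=> u v P /=; exact: hdunkl_commute.
- by move=> e f P; exact: scaleWC.
move=> u f P.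
have E := dunkl_lin m alj kj rj co_neq0 u f P.
exact: etrans E (congr1 (fun X => lin f *: hdunkl u P + X) (esym (Heval_comm u f P))).
Qed.

End Model.

(** * The top monomials are independent *)
Section Evaluation.
Variable K : fieldType.
Local Notation D := {poly {poly K}}.

(** Restriction to the line [f = 0] kills the right-hand side and the second
    term, but not the first one. *)
Lemma lin_pow_free_l e f (g : 'M[K]_2) k s t (q : D) : (0 < k)%N ->
  e *m g != 0 -> f *m g = 0 ->
  kst s * lin e ^+ k + kst t * lin f ^+ k = lin e * lin f * q -> s = 0.
Proof.
move=> k_gt0 eg fg /(congr1 (sub g)).
have f0 : sub g (lin f) = 0 by rewrite sub_lin fg; apply/eqP; rewrite lin_eq0.
have subX h j : sub g (lin h ^+ j) = lin (h *m g) ^+ j.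
  by rewrite -sub_lin; exact: (rmorphXn (sub g)).
rewrite (subD g (kst s * _)) (subM g (kst s)) (subM g (kst t)) !subX.
rewrite (subM g (lin e * lin f)) (subM g (lin e)) f0 mulr0 mul0r sub_kst.
have l0 : lin (f *m g) = 0 by rewrite fg; apply/eqP; rewrite lin_eq0.
rewrite l0 expr0n gtn_eqF // mulr0 addr0 => /eqP.
rewrite mulf_eq0 expf_eq0 k_gt0 lin_eq0 (negPf eg) orbF => /eqP sk.
by apply: kst_inj; rewrite sk kst0.
Qed.

(** Evaluation along the line where [f] vanishes, and along the one where [e]
    does, recovers the two coefficient vectors. *)
Lemma lin_pow_free d e f (g g' : 'M[K]_2) k s (v v' : 'cV[K]_d) (P : 'cV[D]_d) :
  (0 < k)%N -> e *m g != 0 -> f *m g = 0 -> f *m g' != 0 -> e *m g' = 0 ->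
  lin e ^+ k *: map_mx kst v + lin f ^+ k *: map_mx kst v' =
    kst s *: (lin e *: (lin f *: P)) -> v = 0 /\ v' = 0.
Proof.
move=> k_gt0 eg fg fg' eg' /matrixP E.
have F i : kst (v i 0) * lin e ^+ k + kst (v' i 0) * lin f ^+ k =
    lin e * lin f * (kst s * P i 0).
  have := E i 0; rewrite addWE !scaleWE !mxE [_ * kst (v i 0)]mulrC.
  rewrite [_ * kst (v' i 0)]mulrC => ->.
  by rewrite [kst s * _]mulrC mulrA -!mulrA; congr (_ * (_ * _)); rewrite mulrC.
split; apply/matrixP => i j; rewrite ord1 [RHS]mxE.
  exact: lin_pow_free_l k_gt0 eg fg (F i).
have := F i; rewrite addrC [lin e * _]mulrC.
exact: lin_pow_free_l k_gt0 fg' eg'.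
Qed.

Lemma scale_lin_eq0 d e f s (v : 'cV[K]_d) : s != 0 -> e != 0 -> f != 0 ->
  kst s *: (lin e *: (lin f *: map_mx kst v)) = 0 -> v = 0.
Proof.
move=> s0 e0 f0 /matrixP E; have ks : kst s != 0.
  by apply: contraNneq s0 => ks; apply/eqP/kst_inj; rewrite ks kst0.
have le : lin e != 0 by rewrite lin_eq0.
have lf : lin f != 0 by rewrite lin_eq0.
apply/matrixP => i j; have := E i j; rewrite !scaleWE !mxE => /eqP.
rewrite !mulf_eq0 (negPf ks) (negPf le) (negPf lf) => /eqP vij.
by apply: kst_inj; rewrite vij kst0.
Qed.

End Evaluation.

Section Isotropic.
Variable K : numClosedFieldType.
Local Notation e0 := (delta_mx 0 0 : 'rV[K]_2).
Local Notation e1 := (delta_mx 0 1 : 'rV[K]_2).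

Lemma mul_coords (s t x y : K) :
  (s *: e0 + t *: e1) *m (x *: e0 + y *: e1)^T *m e0 = (s * x + t * y) *: e0.
Proof.
rewrite [_ *m _^T]mx11_scalar mul_scalar_mx; congr (_ *: _).
rewrite mxE !big_ord_recl big_ord0 !mxE /=.
by rewrite !(mulr0, mulr1, addr0, add0r).
Qed.

(** The isotropic lines [zbar = 0] and [z = 0] of the complexified plane. *)
Lemma isotropic : exists g g' : 'M[K]_2,
  [/\ (e0 + 'i *: e1) *m g != 0, (e0 - 'i *: e1) *m g = 0,
      (e0 - 'i *: e1) *m g' != 0 & (e0 + 'i *: e1) *m g' = 0].
Proof.
have i2 : 'i * 'i = -1 :> K by rewrite -expr2 sqrCi.
have e00 : e0 != 0.
  by apply/eqP => /matrixP/(_ 0 0); rewrite !mxE => /eqP; rewrite oner_eq0.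
have zE : e0 + 'i *: e1 = 1 *: e0 + 'i *: e1 by rewrite scale1r.
have zbE : e0 - 'i *: e1 = 1 *: e0 + (- 'i) *: e1 by rewrite scale1r scaleNr.
have nz s : s = 2 :> K -> s *: e0 != 0.
  by move=> ->; rewrite scaler_eq0 negb_or e00 pnatr_eq0.
exists ((1 *: e0 + (- 'i) *: e1)^T *m e0), ((1 *: e0 + 'i *: e1)^T *m e0).
rewrite zE zbE !mulmxA !mul_coords !mulrN !mulNr opprK i2 opprK mulr1 subrr scale0r.
by split=> //; apply: nz.
Qed.

End Isotropic.

Section StandardModel.
Variables (R : realType) (m : nat) (m_gt0 : (0 < m)%N).
Variables (c : 'M[R]_2 -> R) (c_inv : conj_invariant m c).
Variables (tau : irrep) (tau_irr : is_irrep m tau).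
Local Notation C := (R[i]).
Local Notation D := {poly {poly C}}.
Local Notation V := ('cV[C]_(dimV tau)).
Local Notation W := ('cV[D]_(dimV tau)).
Local Notation H := (Hc m c).
Local Notation M := (Mc m c tau).

(** The action of the Cherednik algebra itself on vector-valued polynomials. *)
Definition heval (h : H) : W -> W := Heval c (sval (Hpi_surj h)).

Lemma heval_pi t P : heval (Hpi c t) P = Heval c t P.
Proof.
rewrite /heval; case: (Hpi_surj _) => s /= ts.
by apply: (Heval_sound m_gt0 c_inv tau_irr); apply/HpiP.
Qed.

Lemma hevalD (h h' : H) P : heval (h + h') P = heval h P + heval h' P.
Proof.
have [s ->] := Hpi_surj h; have [t ->] := Hpi_surj h'.
by rewrite [_ + _ in LHS]HaddE !heval_pi.
Qed.

Lemma hevalM (h h' : H) P : heval (h * h') P = heval h (heval h' P).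
Proof.
have [s ->] := Hpi_surj h; have [t ->] := Hpi_surj h'.
by rewrite [_ * _ in LHS]HmulE !heval_pi.
Qed.

Lemma heval_klin (h : H) : klinW (heval h).
Proof. exact: Heval_klin. Qed.

Lemma hevalZ a (h : H) P : heval (a *: h) P = kst a *: heval h P.
Proof.
have [s ->] := Hpi_surj h.
by rewrite [_ *: _ in LHS]HmulE !heval_pi.
Qed.

Lemma heval1 P : heval 1 P = P.
Proof. by rewrite [1 in LHS]/(Hpi c (Tsca m 1)) heval_pi /= kst1 scale1r. Qed.

Lemma heval_cov f P : heval (Hcovector f) P = lin f *: P.
Proof. exact: heval_pi. Qed.

(** The standard module maps to vector-valued polynomials because Dunkl operators
    kill constants, so that constants satisfy the relations imposed on [V(tau)]. *)
Fixpoint Meval (p : Mterm m c tau) : W :=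
  match p with
  | Mtens h v => heval h (map_mx kst v)
  | Mzero => 0
  | Msca a p => kst a *: Meval p
  | Madd p q => Meval p + Meval q
  end.

Lemma Meval_sound p q : Meq p q -> Meval p = Meval q.
Proof.
elim=> {p q} /=.
- by [].
- by move=> p q _ ->.
- by move=> p q r _ -> _ ->.
- by move=> p p' q q' _ -> _ ->.
- by move=> a p p' _ ->.
- by move=> p q r; rewrite addrA.
- by move=> p q; rewrite addrC.
- by move=> p; rewrite add0r.
- by move=> p; rewrite kstN1 scaleN1r addNr.
- by move=> a b p; rewrite kstM scalerA.
- by move=> p; rewrite kst1 scale1r.
- by move=> a p q; rewrite scalerDr.
- by move=> a b p; rewrite kstD scalerDl.
- by move=> a h h' v; rewrite hevalD hevalZ.
- move=> a h v v'; have [hD hZ] := heval_klin h.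
  by rewrite map_mxD map_mxZ hD hZ.
- move=> h j v; rewrite hevalM heval_pi /=.
  by rewrite hgact_refl // /ract gact_const.
- move=> h u v; rewrite hevalM heval_pi /= /hdunkl dunkl_const.
    by have := proj2 (heval_klin h) 0 0; rewrite kst0 !scale0r.
  exact: co_neq0.
Qed.

(** The comparison map from the standard module to vector-valued polynomials. *)
Definition phi (x : M) : W := Meval (sval (Mpi_surj x)).

Lemma phi_pi p : phi (Mpi p) = Meval p.
Proof. by rewrite /phi; apply: Meval_sound; apply/MpiP; case: (Mpi_surj _). Qed.

Lemma phi_tens h v : phi (tens h v) = heval h (map_mx kst v).
Proof. exact: phi_pi. Qed.

Lemma phiD x y : phi (x + y) = phi x + phi y.
Proof.
have [s ->] := Mpi_surj x; have [t ->] := Mpi_surj y.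
by rewrite [_ + _ in LHS]Mc_addE !phi_pi.
Qed.

Lemma phiZ a x : phi (a *: x) = kst a *: phi x.
Proof. by have [s ->] := Mpi_surj x; rewrite [_ *: _ in LHS]Mc_scaleE !phi_pi. Qed.

Lemma phi_act h x : phi (act h x) = heval h (phi x).
Proof.
have [s ->] := Mpi_surj x; rewrite act_pi !phi_pi.
have [hD hZ] := heval_klin h.
elim: s => [h' v||a p IH|p IHp q IHq] /=.
- by rewrite hevalM.
- by have := hZ 0 0; rewrite kst0 !scale0r.
- by rewrite IH hZ.
- by rewrite IHp IHq hD.
Qed.

Local Notation zf := (vx R + 'i *: vy R : 'rV[C]_2).
Local Notation zbf := (vx R - 'i *: vy R : 'rV[C]_2).

Lemma heval_covX f k P : heval (Hcovector f ^+ k) P = lin f ^+ k *: P.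
Proof.
elim: k => [|k IHk]; first by rewrite !expr0 heval1 scale1r.
by rewrite !exprS hevalM IHk heval_cov scalerA.
Qed.

Lemma half_neq0 : (2^-1 : C) != 0.
Proof. by rewrite invr_neq0 // pnatr_eq0. Qed.

Lemma phi_Eplus q : phi (act Eplus q) = kst 2^-1 *: (lin zf *: (lin zbf *: phi q)).
Proof. by rewrite phi_act hevalZ hevalM !heval_cov. Qed.

(** The part of the PBW theorem that bounds the harmonics from below: mapped to
    polynomials, the image of [E_+] consists of multiples of [z zbar], which
    vanish on both isotropic lines, while [z^k] and [zbar^k] vanish on one. *)
Lemma tens_top_free k (v v' : V) (q : M) : (0 < k)%N ->
  tens (Hz ^+ k) v + tens (Hzb ^+ k) v' = act Eplus q -> v = 0 /\ v' = 0.
Proof.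
move=> k_gt0 /(congr1 phi); rewrite phiD !phi_tens phi_Eplus.
rewrite (heval_covX zf) (heval_covX zbf).
have [g [g' [zg zbg zbg' zg']]] := isotropic C.
exact: lin_pow_free k_gt0 zg zbg zbg' zg'.
Qed.

(** The other consequence of the polynomial model, by which [E_+] does not
    vanish and the lowest weight is positive. *)
Lemma Eplus_tens_neq0 (v : V) : act Eplus (tens 1 v : M) = 0 -> v = 0.
Proof.
move=> /(congr1 phi); rewrite phi_Eplus phi_tens heval1.
have -> : phi 0 = 0 by rewrite -(scale0r 0) phiZ kst0 scale0r.
have [g [g' [zg _ zbg' _]]] := isotropic C.
have nz (f : 'rV[C]_2) (h : 'M[C]_2) : f *m h != 0 -> f != 0.
  by apply: contraNneq => ->; rewrite mul0mx.
exact: scale_lin_eq0 half_neq0 (nz _ _ zg) (nz _ _ zbg').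
Qed.

End StandardModel.

(** * Relations in the Cherednik algebra *)
Section AlgebraRelations.
Variables (R : realType) (m : nat) (c : 'M[R]_2 -> R).
Local Notation C := (R[i]).
Local Notation H := (Hc m c).
Local Notation om := (@omega R m).
Local Notation cj j := ((c (refl m j))%:C : C).

Lemma Hscale_mull (a : C) (h h' : H) : (a *: h) * h' = a *: (h * h').
Proof. exact: esym (Hc_mulA _ _ _). Qed.

Lemma HscalE (a : C) : Hpi c (Tsca m a) = a *: (1 : H).
Proof. exact: esym (mulr1 (Hpi c (Tsca m a) : H)). Qed.

Lemma Hcovector_lin a e f :
  Hcovector (a *: e + f) = a *: Hcovector e + Hcovector f :> H.
Proof.
rewrite [_ *: _ in RHS]HmulE [_ + _ in RHS]HaddE; exact/HpiP/Hcov.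
Qed.

Lemma Hvector_lin a u v :
  Hvector (a *: u + v) = a *: Hvector u + Hvector v :> H.
Proof.
rewrite [_ *: _ in RHS]HmulE [_ + _ in RHS]HaddE; exact/HpiP/Hvec.
Qed.

Lemma HcovectorZ a e : Hcovector (a *: e) = a *: Hcovector e :> H.
Proof.
have Z : Hcovector 0 = 0 :> H.
  have := Hcovector_lin 1 0 0; rewrite !scale1r addr0 => E.
  by apply: (addrI (Hcovector 0 : H)); rewrite -E addr0.
by rewrite -[a *: e]addr0 Hcovector_lin Z addr0.
Qed.

Lemma HvectorZ a u : Hvector (a *: u) = a *: Hvector u :> H.
Proof.
have Z : Hvector 0 = 0 :> H.
  have := Hvector_lin 1 0 0; rewrite !scale1r addr0 => E.
  by apply: (addrI (Hvector 0 : H)); rewrite -E addr0.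
by rewrite -[a *: u]addr0 Hvector_lin Z addr0.
Qed.

Lemma Hrefl_cov (j : 'I_m) f : Hrefl j * Hcovector f =
  Hcovector (f *m cplx (refl m j.+1)) * Hrefl j :> H.
Proof.
rewrite [LHS]HmulE [RHS]HmulE; apply/HpiP.
by have := HgrpF c (in_dihedral_refl R j) f; rewrite invmx_refl.
Qed.

Lemma Hrefl_vec (j : 'I_m) u : Hrefl j * Hvector u =
  Hvector (cplx (refl m j.+1) *m u) * Hrefl j :> H.
Proof. rewrite [LHS]HmulE [RHS]HmulE; exact/HpiP/HgrpV. Qed.

Lemma Hvec_cov u f : (Hvector u * Hcovector f : H) = Hcovector f * Hvector u +
  ((f *m u) 0 0 *: (1 : H) + \sum_(j < m)
     (- 2 * cj j.+1 * (f *m cplx (alpha m j.+1)) 0 0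
        * (cplx (coalpha m j.+1) *m u) 0 0) *: (Hrefl j : H)).
Proof.
have E (F : 'I_m -> Hterm R m) :
    Hpi c (\big[@Tadd R m/Tsca m 0]_(i < m) F i) = \sum_(i < m) (Hpi c (F i) : H).
  apply: (big_morph (fun t => Hpi c t : H)) => // s t.
  by rewrite [RHS]HaddE.
apply: etrans (_ : Hpi c (Tadd (Tmul (Tcov m f) (Tvec m u)) (Tcomm m c u f)) = _).
  rewrite [LHS]HmulE; exact/HpiP/Hcomm.
rewrite -HaddE -HmulE /Tcomm -HaddE E -HscalE.
congr (Hadd _ (Hadd _ _)); apply: eq_bigr => j _.
by rewrite [RHS]HmulE.
Qed.

Lemma HzC : Hz * Hzb = Hzb * Hz :> H.
Proof. rewrite [LHS]HmulE [RHS]HmulE; exact/HpiP/HcovC. Qed.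

Lemma HzetaC : Hzeta * Hzetab = Hzetab * Hzeta :> H.
Proof. rewrite [LHS]HmulE [RHS]HmulE; exact/HpiP/HvecC. Qed.

Let entries (j : nat) : let w := (om ^+ j) in
  let p := (complex.Re w)%:C in let q := (complex.Im w)%:C in
  [/\ w = p + 'i%R * q, om ^- j = p - 'i%R * q,
     cplx (refl m j) 0 0 = p /\ cplx (refl m j) 0 1 = q &
     cplx (refl m j) 1 0 = q /\ cplx (refl m j) 1 1 = - p].
Proof.
move=> w p q; have E : w = p + 'i%R * q by rewrite -complexiE -complexE.
split=> //.
- by rewrite -omega_conj -/w {1}E rmorphD rmorphM /= conjCi !conj_real mulNr.
- by rewrite ![(map_mx _ _) _ _]mxE reflE -/w !mxE /= expr1 mulN1r opprK.
by rewrite ![(map_mx _ _) _ _]mxE reflE -/w !mxE /= expr1 mulN1r rmorphN.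
Qed.

Lemma Hrefl_z j : Hrefl j * Hz = om ^+ j.+1 *: (Hzb * Hrefl j) :> H.
Proof.
have [wE _ [e00 e01] [e10 e11]] := entries j.+1.
rewrite Hrefl_cov (refl_zf e00 e01 e10 e11) -wE HcovectorZ; exact: Hscale_mull.
Qed.

Lemma Hrefl_zb j : Hrefl j * Hzb = om ^- j.+1 *: (Hz * Hrefl j) :> H.
Proof.
have [_ wE [e00 e01] [e10 e11]] := entries j.+1.
rewrite Hrefl_cov (refl_zbf e00 e01 e10 e11) -wE HcovectorZ; exact: Hscale_mull.
Qed.

Lemma Hrefl_zeta j : Hrefl j * Hzeta = om ^- j.+1 *: (Hzetab * Hrefl j) :> H.
Proof.
have [_ wE [e00 e01] [e10 e11]] := entries j.+1.
rewrite Hrefl_vec (refl_zeta e00 e01 e10 e11) -wE HvectorZ; exact: Hscale_mull.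
Qed.

Lemma Hrefl_zetab j : Hrefl j * Hzetab = om ^+ j.+1 *: (Hzeta * Hrefl j) :> H.
Proof.
have [wE _ [e00 e01] [e10 e11]] := entries j.+1.
rewrite Hrefl_vec (refl_zetab e00 e01 e10 e11) -wE HvectorZ; exact: Hscale_mull.
Qed.

End AlgebraRelations.

(** The commutation relations between [z, z' = zbar] and [d = zeta, d' = zetab]
    involve the reflections only through [s = sigma], [k = [zeta, zbar]] and
    [k' = [zetab, z]]. The relations of these with the generators suffice to make
    [z z'] and [d d'] part of an sl2-triple that commutes with [s] and
    [z' d' - z d]. *)
Section DunklRelations.
Variables (A : pzRingType) (z z' d d' s k k' : A).
Hypotheses (zC : z * z' = z' * z) (dC : d * d' = d' * d)
  (dz : d * z = z * d + (1 - s)) (dz' : d' * z' = z' * d' + (1 - s))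
  (dk : d * z' = z' * d + k) (dk' : d' * z = z * d' + k')
  (zk : z * k = s * z') (zk' : z' * k' = s * z)
  (kz : k * z = z' * s) (kz' : k' * z' = z * s)
  (ks : d * k' = s * d') (ks' : d' * k = s * d)
  (ksr : k * d' = d * s) (ksr' : k' * d = d' * s).

Let e := z * z'.
Let f := d * d'.

Lemma rel_d_e : d * e = e * d + z'.
Proof.
rewrite /e mulrA dz mulrDl -mulrA dk mulrDr mulrA zk mulrBl mul1r -addrA.
by rewrite (addrC (s * _)) subrK.
Qed.

Lemma rel_d'_e : d' * e = e * d' + z.
Proof.
rewrite /e zC mulrA dz' mulrDl -mulrA dk' mulrDr mulrA zk' mulrBl mul1r -addrA.
by rewrite (addrC (s * _)) subrK.
Qed.

Lemma rel_f_e : f * e = e * f + (z' * d' + z * d + (1 - s)).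
Proof.
rewrite /f -mulrA rel_d'_e mulrDr mulrA rel_d_e mulrDl -mulrA dz -/f.
by rewrite !addrA.
Qed.

Lemma rel_f_z : f * z = z * f + d'.
Proof.
rewrite /f -mulrA dk' mulrDr mulrA dz ks mulrDl mulrBl mul1r -mulrA -addrA.
by rewrite subrK.
Qed.

Lemma rel_f_z' : f * z' = z' * f + d.
Proof.
rewrite /f dC -mulrA dk mulrDr mulrA dz' ks' mulrDl mulrBl mul1r -mulrA -addrA.
by rewrite subrK.
Qed.

Lemma rel_s_e : s * e = e * s.
Proof. by rewrite /e mulrA -zk' -mulrA kz' mulrA zC. Qed.

Lemma rel_s_f : s * f = f * s.
Proof. by rewrite {1}/f mulrA -ks' -mulrA ksr mulrA -dC. Qed.

Lemma rel_Z_e : (z' * d' - z * d) * e = e * (z' * d' - z * d).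
Proof.
rewrite mulrBl mulrBr -!mulrA rel_d_e rel_d'_e !mulrDr -zC -/e opprD.
have ez : z * e = e * z by rewrite /e -mulrA -zC.
have ez' : z' * e = e * z' by rewrite /e mulrA -zC.
by rewrite addrACA subrr addr0 (mulrA z' e) ez' (mulrA z e) ez -!mulrA.
Qed.

Lemma rel_f_Z : f * (z' * d' - z * d) = (z' * d' - z * d) * f.
Proof.
have fd : f * d = d * f by rewrite /f -mulrA -dC.
have fd' : f * d' = d' * f by rewrite /f mulrA -dC.
rewrite mulrBr mulrBl (mulrA f z') (mulrA f z) rel_f_z rel_f_z' !mulrDl -dC.
rewrite opprD addrACA subrr addr0 -(mulrA z' f) fd' -(mulrA z f) fd.
by rewrite (mulrA z') (mulrA z).
Qed.

(** The Euler element: its commutators with [z] and [z'] show that it measures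
    the degree. *)
Let h := z * d + z' * d' - s.

Lemma rel_h_z : h * z = z * h + z.
Proof.
have E1 : z * d * z = z * (z * d) + (z - z * s).
  by rewrite -mulrA dz mulrDr mulrBr mulr1.
have E2 : z' * d' * z = z * (z' * d') + s * z.
  by rewrite -mulrA dk' mulrDr zk' !mulrA -zC.
rewrite /h mulrBl mulrDl E1 E2 addrA addrK mulrBr mulrDr addrAC -!addrA.
by rewrite [z + _]addrC.
Qed.

Lemma rel_h_z' : h * z' = z' * h + z'.
Proof.
have E1 : z' * d' * z' = z' * (z' * d') + (z' - z' * s).
  by rewrite -mulrA dz' mulrDr mulrBr mulr1.
have E2 : z * d * z' = z' * (z * d) + s * z'.
  by rewrite -mulrA dk mulrDr zk !mulrA zC.
rewrite /h [z * d + _]addrC mulrBl mulrDl E1 E2 addrA addrK mulrBr mulrDr addrAC.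
by rewrite -!addrA [z' + _]addrC.
Qed.

End DunklRelations.

Section CherednikRelations.
Variables (R : realType) (m : nat) (c : 'M[R]_2 -> R).
Local Notation C := (R[i]).
Local Notation H := (Hc m c).
Local Notation om := (@omega R m).
Local Notation cj j := ((c (refl m j))%:C : C).

(** The commutators of [zeta] with [zbar] and of [zetab] with [z]; see [Hzeta_zb]
    and [Hzetab_z]. *)
Definition Hkap : H := \sum_(j < m) (cj j.+1 * om ^- j.+1) *: (Hrefl j : H).
Definition Hkapb : H := \sum_(j < m) (cj j.+1 * om ^+ j.+1) *: (Hrefl j : H).

(** Moving a coordinate past the reflections multiplies the j-th coefficient by a
    power of [omega^j] and exchanges the isotropic lines. *)
Lemma refl_sum_swap (a b w : 'I_m -> C) (X Y : H) :
  (forall j, Hrefl j * Y = w j *: (X * Hrefl j)) -> (forall j, b j = a j * w j) ->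
  X * (\sum_j b j *: (Hrefl j : H)) = (\sum_j a j *: (Hrefl j : H)) * Y.
Proof.
move=> rY ba; rewrite mulr_sumr mulr_suml; apply: eq_bigr => j _.
by rewrite Hscale_mulr Hscale_mull rY scalerA ba.
Qed.

Let omN j : om ^- j * om ^+ j = 1.
Proof. by rewrite mulVf // expf_neq0 // omega_neq0. Qed.
Let omV j : om ^+ j * om ^- j = 1.
Proof. by rewrite mulrC. Qed.

Lemma Hz_kap : Hz * Hkap = Hsigma * Hzb :> H.
Proof. by apply: (refl_sum_swap (w := fun j => om ^- j.+1)) => // j; exact: Hrefl_zb. Qed.

Lemma Hzb_kapb : Hzb * Hkapb = Hsigma * Hz :> H.
Proof. by apply: (refl_sum_swap (w := fun j => om ^+ j.+1)) => // j; exact: Hrefl_z. Qed.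

Lemma Hkap_z : Hkap * Hz = Hzb * Hsigma :> H.
Proof.
symmetry; apply: (refl_sum_swap (w := fun j => om ^+ j.+1)) => j; first exact: Hrefl_z.
by rewrite -mulrA omN mulr1.
Qed.

Lemma Hkapb_zb : Hkapb * Hzb = Hz * Hsigma :> H.
Proof.
symmetry; apply: (refl_sum_swap (w := fun j => om ^- j.+1)) => j; first exact: Hrefl_zb.
by rewrite -mulrA omV mulr1.
Qed.

Lemma Hzeta_kapb : Hzeta * Hkapb = Hsigma * Hzetab :> H.
Proof. by apply: (refl_sum_swap (w := fun j => om ^+ j.+1)) => // j; exact: Hrefl_zetab. Qed.

Lemma Hzetab_kap : Hzetab * Hkap = Hsigma * Hzeta :> H.
Proof. by apply: (refl_sum_swap (w := fun j => om ^- j.+1)) => // j; exact: Hrefl_zeta. Qed.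

Lemma Hkap_zetab : Hkap * Hzetab = Hzeta * Hsigma :> H.
Proof.
symmetry; apply: (refl_sum_swap (w := fun j => om ^+ j.+1)) => j; first exact: Hrefl_zetab.
by rewrite -mulrA omN mulr1.
Qed.

Lemma Hkapb_zeta : Hkapb * Hzeta = Hzetab * Hsigma :> H.
Proof.
symmetry; apply: (refl_sum_swap (w := fun j => om ^- j.+1)) => j; first exact: Hrefl_zeta.
by rewrite -mulrA omV mulr1.
Qed.

Lemma root_coords (j : nat) : let S := (sin (angle m j : R))%:C in
  let T := (cos (angle m j : R))%:C in
  let al : 'cV[C]_2 := cplx (alpha m j) in let co : 'rV[C]_2 := cplx (coalpha m j) in
  [/\ al 0 0 = S /\ al 1 0 = - T, co 0 0 = S /\ co 0 1 = - T,
      S * S = 1 - T * T, om ^+ j = (T + 'i%R * S) ^+ 2 & om ^- j = (T - 'i%R * S) ^+ 2].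
Proof.
move=> S T al co; split.
- by rewrite !mxE /= rmorphN.
- by rewrite !mxE /= rmorphN.
- rewrite -!rmorphM -(rmorph1 (real_complex R)) -rmorphB; congr (_%:C).
  by rewrite -!expr2 -(cos2Dsin2 (angle m j)) addrAC subrr add0r.
- by rewrite omegaXE mulr2n cisD -expr2.
by rewrite -omega_conj omegaXE mulr2n cisD -expr2 rmorphXn /= cis_conj cisN.
Qed.

Lemma Hzeta_z : Hzeta * Hz = Hz * Hzeta + (1 - Hsigma) :> H.
Proof.
rewrite [LHS]Hvec_cov; congr (_ + (_ + _)).
  by rewrite pair_z_zeta scale1r.
rewrite -sumrN; apply: eq_bigr => j _.
have [[al0 al1] [co0 co1] st ww ww'] := root_coords j.+1.
rewrite -mulrA (root_z_zeta al0 al1 co0 co1 st) -scaleNr; congr (_ *: _).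
by move: (cj _) => x; field.
Qed.

Lemma Hzetab_zb : Hzetab * Hzb = Hzb * Hzetab + (1 - Hsigma) :> H.
Proof.
rewrite [LHS]Hvec_cov; congr (_ + (_ + _)).
  by rewrite pair_zb_zetab scale1r.
rewrite -sumrN; apply: eq_bigr => j _.
have [[al0 al1] [co0 co1] st ww ww'] := root_coords j.+1.
rewrite -mulrA (root_zb_zetab al0 al1 co0 co1 st) -scaleNr; congr (_ *: _).
by move: (cj _) => x; field.
Qed.

Lemma Hzeta_zb : Hzeta * Hzb = Hzb * Hzeta + Hkap :> H.
Proof.
rewrite [LHS]Hvec_cov; congr (_ + _).
rewrite pair_zb_zeta scale0r add0r; apply: eq_bigr => j _.
have [[al0 al1] [co0 co1] st ww ww'] := root_coords j.+1.
rewrite -mulrA (root_zb_zeta al0 al1 co0 co1 st ww'); congr (_ *: _).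
by move: (cj _) (_ ^- _) => x y; field.
Qed.

Lemma Hzetab_z : Hzetab * Hz = Hz * Hzetab + Hkapb :> H.
Proof.
rewrite [LHS]Hvec_cov; congr (_ + _).
rewrite pair_z_zetab scale0r add0r; apply: eq_bigr => j _.
have [[al0 al1] [co0 co1] st ww ww'] := root_coords j.+1.
rewrite -mulrA (root_z_zetab al0 al1 co0 co1 st ww); congr (_ *: _).
by move: (cj _) (_ ^+ _) => x y; field.
Qed.

End CherednikRelations.

(** * Twisted sums over the reflections *)
Section ReflectionSums.
Variables (R : realType) (m : nat) (m_gt0 : (0 < m)%N).
Variables (c : 'M[R]_2 -> R) (c_inv : conj_invariant m c).
Variables (tau : irrep) (tau_irr : is_irrep m tau).
Local Notation C := (R[i]).
Local Notation om := (@omega R m).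
Local Notation cj j := ((c (refl m j))%:C : C).
Local Notation rr j := (repr_refl m tau j : 'M[C]_(dimV tau)).

(** All the numbers [sigma_k] and their variants have this form, with [x] given by
    the signs of a one-dimensional representation and [w] a power of [omega]. *)
Definition csum (x : nat -> C) (w : C) : C :=
  \sum_(j < m) cj j.+1 * x j.+1 * w ^+ j.+1.

Lemma c_shift2 j : cj (2 + j)%N = cj j.
Proof.
rewrite (conj_invariant_refl (j' := (2 + j)%N) (j := j) (k := j.+1) m_gt0 c_inv) //.
by rewrite -exprD doubleS -addnn -addnA add2n.
Qed.

(** [c], like [x], takes the same value on [s_j] and [s_(m - j)], because they are
    conjugate under [s_m]. *)
Lemma csumV (x : nat -> C) w : w ^+ m = 1 -> (forall j, x (j + m)%N = x j) ->
  (forall j, (j <= m)%N -> x (m - j)%N = x j) -> csum x w^-1 = csum x w.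
Proof.
move=> wm xm xr; rewrite /csum.
rewrite (sum_periodic_reflect m_gt0 0 (F := fun j => cj j * x j * w ^+ j)); last first.
  by move=> j /=; rewrite xm exprD wm mulr1 reflDm.
apply: eq_bigr => j _; rewrite add0n xr ?ltn_ord //.
have -> : cj (m - j.+1)%N = cj j.+1.
  by have := c_reflect m_gt0 c_inv 0 (ltn_ord j); rewrite add0n.
congr (_ * _); rewrite exprVn; have w0 : w ^+ j.+1 != 0.
  by rewrite expf_neq0 //; apply/eqP => w0; move: wm; rewrite w0 expr0n gtn_eqF // => /eqP; rewrite eq_sym oner_eq0.
by apply: (mulIf w0); rewrite mulVf // -exprD subnK ?ltn_ord.
Qed.

(** As [s_(j + 1)] conjugates [s_j] to [s_(j + 2)], shifting the index by 2
    multiplies the sum by [w ^+ 2]. *)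
Lemma csum_eq0 w : w ^+ m = 1 -> w ^+ 2 != 1 -> csum (fun => 1) w = 0.
Proof.
move=> wm w2; pose F j := cj j * 1 * w ^+ j.
have Fm j : F (j + m)%N = F j by rewrite /F exprD wm !mulr1 reflDm.
have E : csum (fun => 1) w = w ^+ 2 * csum (fun => 1) w.
  rewrite -[LHS]/(\sum_(j < m) F j.+1) (sum_periodic_reflect m_gt0 2 Fm).
  rewrite -[csum _ _]/(\sum_(j < m) F j.+1) (sum_periodic_reflect m_gt0 0 Fm).
  rewrite mulr_sumr; apply: eq_bigr => j _.
  by rewrite add0n /F c_shift2 exprD mulrCA.
apply/eqP; have /eqP := E; rewrite -subr_eq0 -{1}[csum _ _]mul1r -mulrBl mulf_eq0.
by rewrite subr_eq0 eq_sym (negPf w2).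
Qed.

Lemma csum_conj (x : nat -> C) w : (forall j, Num.conj (x j) = x j) ->
  Num.conj w = w^-1 -> Num.conj (csum x w) = csum x w^-1.
Proof.
move=> xc wc; rewrite rmorph_sum; apply: eq_bigr => j _ /=.
by rewrite !rmorphM rmorphXn /= wc xc conj_real.
Qed.

Lemma sigma_parE k u : sigma_par m c k u =
  csum (fun j => (odd j == u)%:R) (om ^ k).
Proof.
rewrite /sigma_par big_mkcond; apply: eq_bigr => j _.
case: ifP => _; rewrite ?mulr0 ?mul0r // mulr1; congr (_ * _).
by rewrite -exprz_exp.
Qed.

Lemma csumD (x y : nat -> C) w : csum (fun j => x j + y j) w = csum x w + csum y w.
Proof. by rewrite -big_split; apply: eq_bigr => j _; rewrite mulrDr mulrDl. Qed.

Lemma csumN (x : nat -> C) w : csum (fun j => - x j) w = - csum x w.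
Proof. by rewrite -sumrN; apply: eq_bigr => j _; rewrite mulrN mulNr. Qed.

Lemma eq_csum (x y : nat -> C) w : x =1 y -> csum x w = csum y w.
Proof. by move=> xy; apply: eq_bigr => j _; rewrite xy. Qed.

Lemma sigma_intE k : sigma_int m c k = csum (fun => 1) (om ^ k).
Proof.
rewrite /sigma_int !sigma_parE -csumD; apply: eq_csum => j.
by case: (odd j); rewrite ?addr0 ?add0r.
Qed.

(** The sign by which [s_j] acts; for [rho^(u)] the dependence on [j] is carried by
    [lab_root] alone. *)
Definition sgn (j : nat) : C :=
  match tau with
  | Triv | Rho _ => 1
  | Sign => -1
  | Chi u => if odd j == u then -1 else 1
  end.

(** The power of [omega] in the sum [sigma_(tau, k)] with label [i]. *)
Definition lab_root (k : int) (i : 'I_(dimV tau)) : C :=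
  if tau is Rho u then
    if i == 0 :> nat then om ^ (k + u%:Z) else om ^ (k - u%:Z)
  else om ^ k.

Lemma sigma_tauE k i : sigma_tau m c k i = csum sgn (lab_root k i).
Proof.
rewrite /sigma_tau /lab_root /sgn; case: tau i => [||u|u] i.
- exact: sigma_intE.
- by rewrite sigma_intE -csumN.
- by case: u i => _; rewrite !sigma_parE -csumN -csumD; apply: eq_csum => j;
    case: (odd j); rewrite /= ?oppr0 ?addr0 ?add0r.
- by case: ifP => _; rewrite sigma_intE.
Qed.

Lemma omegaz_m k : (om ^ k) ^+ m = 1.
Proof. by rewrite exprnP exprz_exp mulrC -exprz_exp -exprnP omegaXm // exp1rz. Qed.

Lemma omegaz_conj k : Num.conj (om ^ k) = (om ^ k)^-1.
Proof.
case: k => k; first exact: omega_conj.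
by rewrite -[om ^ Negz k]/(om ^- k.+1) fmorphV /= omega_conj.
Qed.

Lemma lab_root_m k i : lab_root k i ^+ m = 1.
Proof. by rewrite /lab_root; case: tau i => [||u|u] i //; try case: ifP => _; exact: omegaz_m. Qed.

Lemma lab_root_conj k i : Num.conj (lab_root k i) = (lab_root k i)^-1.
Proof. by rewrite /lab_root; case: tau i => [||u|u] i //; try case: ifP => _; exact: omegaz_conj. Qed.

Lemma sgnDm j : sgn (j + m) = sgn j.
Proof. by rewrite /sgn; case: tau tau_irr => [||u|u] //= /negPf mo; rewrite oddD mo addbF. Qed.

Lemma sgn_reflect j : (j <= m)%N -> sgn (m - j) = sgn j.
Proof. by move=> jm; rewrite /sgn; case: tau tau_irr => [||u|u] //= /negPf mo; rewrite oddB // mo. Qed.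

Lemma sgn_conj j : Num.conj (sgn j) = sgn j.
Proof.
rewrite /sgn; case: tau => [||u|u]; rewrite ?rmorph1 ?rmorphN1 //.
by case: ifP; rewrite ?rmorph1 ?rmorphN1.
Qed.

Lemma csum_lab_rootV k i : csum sgn (lab_root k i)^-1 = sigma_tau m c k i.
Proof.
rewrite csumV ?sigma_tauE //; first exact: lab_root_m.
- exact: sgnDm.
- exact: sgn_reflect.
Qed.

(** Complex conjugation inverts [w], which does not change the sum. *)
Lemma sigma_tau_real k (i : 'I_(dimV tau)) : sigma_tau m c k i \is Num.real.
Proof.
apply/CrealP; rewrite {1}sigma_tauE csum_conj ?csum_lab_rootV //.
  exact: sgn_conj.
exact: lab_root_conj.
Qed.

Local Notation V := ('cV[C]_(dimV tau)).

Lemma lab_rootM k i : lab_root k i = om ^ k * lab_root 0 i.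
Proof.
have om0 : om != 0 := omega_neq0 R m.
rewrite /lab_root; case: tau i => [||u|u] i; rewrite ?expr0z ?mulr1 //.
by case: ifP => _; rewrite add0r -expfzDr.
Qed.

Lemma repr_zlab j (i : 'I_(dimV tau)) :
  rr j *m zlab i = (sgn j * lab_root 0 i ^+ j) *: (zblab i : V).
Proof.
rewrite /zlab /zblab /lab_root /sgn /repr_refl; case: tau i => [||u|u] i /=.
- by rewrite (ord1 (rev_ord i : 'I_1)) (ord1 (i : 'I_1)) mul_scalar_mx expr0z expr1n mulr1.
- by rewrite (ord1 (rev_ord i : 'I_1)) (ord1 (i : 'I_1)) mul_scalar_mx expr0z expr1n mulr1.
- by rewrite (ord1 (rev_ord i : 'I_1)) (ord1 (i : 'I_1)) mul_scalar_mx expr0z expr1n mulr1.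
rewrite mul1r sub0r add0r -colE; apply/matrixP => x y; rewrite ord1 !mxE.
have omV : om ^ (- u%:Z) = om ^- u by rewrite -exprnN.
rewrite omV -exprnP eqxx andbT mulnC.
case: i x => [[|[|//]]] ? [[|[|//]]] ?; rewrite /= ?mulr0 ?mulr1 ?exprM //.
by rewrite exprVn.
Qed.

Lemma repr_zblab j (i : 'I_(dimV tau)) :
  rr j *m zblab i = (sgn j * (lab_root 0 i)^-1 ^+ j) *: (zlab i : V).
Proof.
rewrite /zlab /zblab /lab_root /sgn /repr_refl; case: tau i => [||u|u] i /=.
- by rewrite (ord1 (rev_ord i : 'I_1)) (ord1 (i : 'I_1)) mul_scalar_mx expr0z invr1 expr1n mulr1.
- by rewrite (ord1 (rev_ord i : 'I_1)) (ord1 (i : 'I_1)) mul_scalar_mx expr0z invr1 expr1n mulr1.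
- by rewrite (ord1 (rev_ord i : 'I_1)) (ord1 (i : 'I_1)) mul_scalar_mx expr0z invr1 expr1n mulr1.
rewrite mul1r sub0r add0r -colE; apply/matrixP => x y; rewrite ord1 !mxE.
have omV : om ^ (- u%:Z) = om ^- u by rewrite -exprnN.
rewrite omV -exprnP eqxx andbT mulnC.
case: i x => [[|[|//]]] ? [[|[|//]]] ?; rewrite /= ?mulr0 ?mulr1 ?invrK ?exprM //.
by rewrite exprVn.
Qed.

(** Together with [sum_repr_zblab] this is why the labels are paired with the
    basis vectors as they are: [sigma] exchanges [z^k (x) z(sigma)] and
    [zbar^k (x) zbar(sigma)], see [sigma_z] and [sigma_zb]. *)
Lemma sum_repr_zlab k (i : 'I_(dimV tau)) :
  \sum_(j < m) (cj j.+1 * (om ^+ j.+1) ^+ k) *: (rr j.+1 *m zlab i) =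
  sigma_tau m c k%:Z i *: (zblab i : V).
Proof.
rewrite sigma_tauE /csum scaler_suml; apply: eq_bigr => j _.
rewrite repr_zlab scalerA (lab_rootM k%:Z) exprMn -exprnP [_ ^+ k]exprAC; congr (_ *: _).
exact: mulrACA.
Qed.

Lemma sum_repr_zblab k (i : 'I_(dimV tau)) :
  \sum_(j < m) (cj j.+1 * (om ^- j.+1) ^+ k) *: (rr j.+1 *m zblab i) =
  sigma_tau m c k%:Z i *: (zlab i : V).
Proof.
rewrite -csum_lab_rootV /csum scaler_suml; apply: eq_bigr => j _.
rewrite repr_zblab scalerA (lab_rootM k%:Z) invfM exprMn -exprnP -!exprVn [_ ^+ k]exprAC.
congr (_ *: _); exact: mulrACA.
Qed.

(** For [rho^(u)] the scalar is 0, as [omega^(2u) != 1] by the range of [u]. *)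
Lemma Nc_spec : \sum_(j < m) cj j.+1 *: rr j.+1 = (Nc m c tau)%:M.
Proof.
apply: (@xgetPex _ _ [set a : C | \sum_(j < m) cj j.+1 *: rr j.+1 = a%:M]%classic).
have E (x : C) : (forall i : 'I_(dimV tau),
      \sum_(j < m) cj j.+1 *: (rr j.+1 *m zlab i) = x *: (zlab i : V)) ->
    \sum_(j < m) cj j.+1 *: rr j.+1 = x%:M.
  move=> H; apply/matrixP => k l; have /matrixP/(_ k 0) := H l.
  have -> : \sum_(j < m) cj j.+1 *: (rr j.+1 *m zlab l) =
      (\sum_(j < m) cj j.+1 *: rr j.+1) *m delta_mx l 0.
    by rewrite mulmx_suml; apply: eq_bigr => j _; rewrite scalemxAl.
  by rewrite -colE /zlab !mxE eqxx andbT mulr_natr.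
have F (i : 'I_(dimV tau)) : \sum_(j < m) cj j.+1 *: (rr j.+1 *m zlab i) =
    csum sgn (lab_root 0 i) *: (zblab i : V).
  rewrite /csum scaler_suml; apply: eq_bigr => j _.
  by rewrite repr_zlab scalerA mulrA.
have [rho|nrho] := boolP (if tau is Rho _ then true else false).
  exists 0; apply: E => i; rewrite F scale0r.
  suff -> : csum sgn (lab_root 0 i) = 0 by rewrite scale0r.
  rewrite (eq_csum (y := fun => 1)) => [|j]; last by rewrite /sgn; case: tau rho.
  apply: csum_eq0; first exact: lab_root_m.
  rewrite /lab_root; case: tau rho tau_irr i => // u _ /=.
  rewrite gtn_uphalf_double => /andP[u0 um] i.
  have w : om ^+ u ^+ 2 != 1.
    by rewrite -exprM muln2 omegaX_neq1 // double_gt0 u0.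
  have omV : om ^ (- u%:Z) = om ^- u by rewrite -exprnN.
  by case: ifP => _; rewrite add0r ?omV // exprVn invr_eq1.
exists (csum sgn 1); apply: E => i; rewrite F.
by rewrite /lab_root /zblab /zlab; case: tau nrho i => [||u|u] // _ i;
  rewrite (ord1 (rev_ord i : 'I_1)) (ord1 (i : 'I_1)).
Qed.

End ReflectionSums.

(** * The standard module and its grading *)
Section ModuleAction.
Variables (R : realType) (m : nat) (c : 'M[R]_2 -> R) (tau : irrep).
Local Notation C := (R[i]).
Local Notation V := ('cV[C]_(dimV tau)).
Local Notation H := (Hc m c).
Local Notation M := (Mc m c tau).

Lemma act_is_linear (h : H) : linear (act h : M -> M).
Proof.
move=> a x y; have [p ->] := Mpi_surj x; have [q ->] := Mpi_surj y.
rewrite [_ *: Mpi p]Mc_scaleE [_ + Mpi q]Mc_addE !act_pi.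
by rewrite [_ *: Mpi _]Mc_scaleE [_ + Mpi _]Mc_addE.
Qed.

HB.instance Definition _ (h : H) :=
  GRing.isLinear.Build C M M _ (act h : M -> M) (act_is_linear h).

Lemma tens_lin_l (a : C) (h h' : H) (v : V) :
  tens (a *: h + h') v = a *: tens h v + tens h' v :> M.
Proof. rewrite [_ *: tens _ _]Mc_scaleE [_ + tens _ _]Mc_addE; exact/MpiP/MtensDl. Qed.

Lemma tens_lin_r (a : C) (h : H) (v v' : V) :
  tens h (a *: v + v') = a *: tens h v + tens h v' :> M.
Proof. rewrite [_ *: tens _ _]Mc_scaleE [_ + tens _ _]Mc_addE; exact/MpiP/MtensDr. Qed.

Lemma tens0r (h : H) : tens h (0 : V) = 0 :> M.
Proof.
have := tens_lin_r 1 h 0 0; rewrite !scale1r addr0 => E.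
by apply: (addrI (tens h 0)); rewrite -E addr0.
Qed.

Lemma tensDr (h : H) (v v' : V) : tens h (v + v') = tens h v + tens h v' :> M.
Proof. by have := tens_lin_r 1 h v v'; rewrite !scale1r. Qed.

Lemma tensZr a (h : H) (v : V) : tens h (a *: v) = a *: tens h v :> M.
Proof. by have := tens_lin_r a h v 0; rewrite tens0r !addr0. Qed.

Lemma tens_sumr (I : Type) (r : seq I) (h : H) (F : I -> V) :
  tens h (\sum_(i <- r) F i) = \sum_(i <- r) (tens h (F i) : M).
Proof. apply: (big_morph (tens h)); [exact: tensDr | exact: tens0r]. Qed.

Lemma tens_refl (h : H) (j : 'I_m) (v : V) :
  tens (h * Hrefl j) v = tens h (repr_refl m tau j.+1 *m v) :> M.
Proof. exact/MpiP/MtensG. Qed.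

Lemma tens_vec (h : H) u (v : V) : tens (h * Hvector u) v = 0 :> M.
Proof. exact/MpiP/MtensE. Qed.

Lemma act_linear_l a (h h' : H) (x : M) :
  act (a *: h + h') x = a *: act h x + act h' x.
Proof.
have [p ->] := Mpi_surj x; elim: p => [k v||b p IHp|p IHp q IHq].
- by rewrite ![act _ (Mpi _)]act_tens mulrDl Hscale_mull tens_lin_l.
- have -> : Mpi (Mzero m c tau) = (0 : M) by [].
  by rewrite !linear0 ?scaler0 addr0.
- have -> : Mpi (Msca b p) = b *: (Mpi p : M) by rewrite [RHS]Mc_scaleE.
  by rewrite !linearZ /= IHp scalerDr !scalerA mulrC.
have -> : Mpi (Madd p q) = (Mpi p : M) + Mpi q by rewrite [RHS]Mc_addE.
by rewrite !linearD /= IHp IHq addrACA.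
Qed.

Lemma actM (h h' : H) (x : M) : act (h * h') x = act h (act h' x).
Proof.
have [p ->] := Mpi_surj x; elim: p => [k v||b p IHp|p IHp q IHq].
- by rewrite -[Mpi _]/(tens k v) !act_tens mulrA.
- have -> : Mpi (Mzero m c tau) = (0 : M) by [].
  by rewrite !linear0.
- have -> : Mpi (Msca b p) = b *: (Mpi p : M) by rewrite [RHS]Mc_scaleE.
  by rewrite !linearZ /= IHp.
have -> : Mpi (Madd p q) = (Mpi p : M) + Mpi q by rewrite [RHS]Mc_addE.
by rewrite !linearD /= IHp IHq.
Qed.

Lemma actD (h h' : H) (x : M) : act (h + h') x = act h x + act h' x.
Proof. by have := act_linear_l 1 h h' x; rewrite !scale1r. Qed.

Lemma act0 (x : M) : act 0 x = 0.
Proof. by apply: (addrI (act 0 x)); rewrite -actD !addr0. Qed.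

Lemma actZ a (h : H) (x : M) : act (a *: h) x = a *: act h x.
Proof. by have := act_linear_l a h 0 x; rewrite act0 !addr0. Qed.

Lemma actN (h : H) (x : M) : act (- h) x = - act h x.
Proof. by rewrite -scaleN1r actZ scaleN1r. Qed.

Lemma actB (h h' : H) (x : M) : act (h - h') x = act h x - act h' x.
Proof. by rewrite actD actN. Qed.

Lemma act_suml (I : Type) (r : seq I) (F : I -> H) (x : M) :
  act (\sum_(i <- r) F i) x = \sum_(i <- r) act (F i) x.
Proof. by apply: (big_morph (fun h => act h x)) => [h h'|]; [exact: actD | exact: act0]. Qed.

Lemma act1 (x : M) : act 1 x = x.
Proof.
have [p ->] := Mpi_surj x; elim: p => [k v||b p IHp|p IHp q IHq].
- by rewrite -[Mpi _]/(tens k v) act_tens mul1r.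
- have -> : Mpi (Mzero m c tau) = (0 : M) by [].
  by rewrite !linear0.
- have -> : Mpi (Msca b p) = b *: (Mpi p : M) by rewrite [RHS]Mc_scaleE.
  by rewrite !linearZ /= IHp.
have -> : Mpi (Madd p q) = (Mpi p : M) + Mpi q by rewrite [RHS]Mc_addE.
by rewrite !linearD /= IHp IHq.
Qed.

Lemma act_iter (h : H) n (x : M) : act (h ^+ n) x = iter n (act h) x.
Proof. by elim: n => [|n IHn]; rewrite ?expr0 ?act1 // exprS actM IHn. Qed.

End ModuleAction.

Section Grading.
Variables (R : realType) (m : nat) (c : 'M[R]_2 -> R) (tau : irrep).
Local Notation C := (R[i]).
Local Notation V := ('cV[C]_(dimV tau)).
Local Notation H := (Hc m c).
Local Notation M := (Mc m c tau).
Local Notation om := (@omega R m).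
Local Notation hom := (@homogeneous R m c tau).

Lemma homD k (p q : M) : hom k p -> hom k q -> hom k (p + q).
Proof.
move=> [v ->] [w ->]; exists (fun a => v a + w a).
by rewrite -big_split; apply: eq_bigr => a _; rewrite tensDr.
Qed.

Lemma homZ k x (p : M) : hom k p -> hom k (x *: p).
Proof.
move=> [v ->]; exists (fun a => x *: v a).
by rewrite scaler_sumr; apply: eq_bigr => a _; rewrite tensZr.
Qed.

Lemma hom0 k : hom k (0 : M).
Proof. by exists (fun=> 0); rewrite big1 // => a _; rewrite tens0r. Qed.

Lemma hom_sum k n (F : 'I_n -> M) : (forall i, hom k (F i)) -> hom k (\sum_i F i).
Proof. by move=> h; apply: (big_ind (hom k)) => [|p q|i _]; [exact: hom0 | exact: homD | exact: h]. Qed.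

Lemma HzbXz a b : Hzb * (Hz ^+ a * Hzb ^+ b) = Hz ^+ a * Hzb ^+ b.+1 :> H.
Proof.
rewrite mulrA exprS mulrA; congr (_ * _).
elim: a => [|a IHa]; first by rewrite expr0 mulr1 mul1r.
by rewrite exprS mulrA -HzC -mulrA IHa mulrA.
Qed.

Lemma hom_z k (p : M) : hom k p -> hom k.+1 (act Hz p).
Proof.
move=> [v ->]; exists (fun a => if unlift ord0 a is Some b then v b else 0).
rewrite [RHS]big_ord_recl unlift_none tens0r add0r linear_sum; apply: eq_bigr => a _.
by rewrite liftK [LHS]act_tens mulrA -exprS.
Qed.

Lemma hom_zb k (p : M) : hom k p -> hom k.+1 (act Hzb p).
Proof.
move=> [v ->]; exists (fun a => if unlift ord_max a is Some b then v b else 0).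
rewrite [RHS]big_ord_recr /= unlift_none tens0r addr0 linear_sum; apply: eq_bigr => a _.
have -> : widen_ord (leqnSn k.+1) a = lift ord_max a.
  by apply/val_inj; rewrite /= /bump leqNgt ltn_ord.
rewrite liftK [LHS]act_tens HzbXz; congr (tens (_ * _ ^+ _) _).
by rewrite subSn // -ltnS.
Qed.

Lemma hom_tens1 (v : V) : hom 0 (tens 1 v : M).
Proof. by exists (fun=> v); rewrite big_ord_recl big_ord0 addr0 expr0 mulr1. Qed.

Lemma hom0P (p : M) : hom 0 p <-> exists v, p = tens 1 v.
Proof.
split=> [[v ->]|[v ->]]; last exact: hom_tens1.
by exists (v ord0); rewrite big_ord_recl big_ord0 addr0 expr0 mulr1.
Qed.

(** Homogeneous vectors of degree [k + 1] are [z p + zbar q]. *)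
Lemma homS k (p : M) : hom k.+1 p ->
  exists p1 p2, [/\ hom k p1, hom k p2 & p = act Hz p1 + act Hzb p2].
Proof.
move=> [v ->]; exists (\sum_(a < k.+1) tens (Hz ^+ a * Hzb ^+ (k - a)) (v (lift ord0 a))).
exists (tens (Hzb ^+ k) (v ord0)); split.
- by exists (fun a => v (lift ord0 a)).
- exists (fun a => if a == ord0 then v ord0 else 0).
  rewrite big_ord_recl /= subn0 expr0 mul1r big1 ?addr0 // => a _; exact: tens0r.
rewrite big_ord_recl addrC linear_sum; congr (_ + _).
  by apply: eq_bigr => a _; rewrite [RHS]act_tens mulrA -exprS.
by rewrite [RHS]act_tens expr0 mul1r -exprS.
Qed.

(** Degree is generated by [z] and [zbar], so that properties of the action on
    homogeneous vectors reduce to commutation with [z] and [zbar]. *)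
Lemma homogeneous_ind (Q : nat -> M -> Prop) :
  (forall v, Q 0 (tens 1 v)) ->
  (forall k p q, hom k p -> hom k q -> Q k p -> Q k q -> Q k.+1 (act Hz p + act Hzb q)) ->
  forall k p, hom k p -> Q k p.
Proof.
move=> Q0 QS; elim=> [|k IHk] p; first by move=> /hom0P[v ->].
by move=> /homS[p1 [p2 [h1 h2 ->]]]; apply: QS => //; exact: IHk.
Qed.

Lemma hom_zX k (v : V) : hom k (tens (Hz ^+ k) v : M).
Proof.
elim: k => [|k IHk]; first by rewrite expr0; exact: hom_tens1.
by rewrite exprS -act_tens; exact: hom_z.
Qed.

Lemma hom_zbX k (v : V) : hom k (tens (Hzb ^+ k) v : M).
Proof.
elim: k => [|k IHk]; first by rewrite expr0; exact: hom_tens1.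
by rewrite exprS -act_tens; exact: hom_zb.
Qed.

End Grading.

Section DunklGrading.
Variables (R : realType) (m : nat) (m_gt0 : (0 < m)%N).
Variables (c : 'M[R]_2 -> R) (c_inv : conj_invariant m c).
Variables (tau : irrep) (tau_irr : is_irrep m tau).
Local Notation C := (R[i]).
Local Notation V := ('cV[C]_(dimV tau)).
Local Notation H := (Hc m c).
Local Notation M := (Mc m c tau).
Local Notation om := (@omega R m).
Local Notation hom := (@homogeneous R m c tau).
Local Notation N := (Nc m c tau).
Local Notation cj j := ((c (refl m j))%:C : C).

Let zC := HzC m c.
Let dC := HzetaC m c.
Let dz := Hzeta_z m c.
Let dz' := Hzetab_zb m c.
Let dk := Hzeta_zb m c.
Let dk' := Hzetab_z m c.
Let zk := Hz_kap m c.
Let zk' := Hzb_kapb m c.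
Let kz := Hkap_z m c.
Let kz' := Hkapb_zb m c.
Let ks := Hzeta_kapb m c.
Let ks' := Hzetab_kap m c.
Let ksr := Hkap_zetab m c.
Let ksr' := Hkapb_zeta m c.

Lemma hom_refl j k (p : M) : hom k p -> hom k (act (Hrefl j) p).
Proof.
move: k p; apply: (homogeneous_ind (Q := fun k p => hom k (act (Hrefl j) p))) => [v|k p q _ _ hp hq].
  by rewrite act_tens -[_ * _]mul1r mulr1 tens_refl; exact: hom_tens1.
rewrite linearD /= -!actM Hrefl_z Hrefl_zb !actZ !actM.
by apply: homD; apply: homZ; [exact: hom_zb | exact: hom_z].
Qed.

Lemma hom_refl_sum (x : 'I_m -> C) k (p : M) :
  hom k p -> hom k (act (\sum_j x j *: (Hrefl j : H)) p).
Proof.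
by move=> hp; rewrite act_suml; apply: hom_sum => j; rewrite actZ; apply/homZ/hom_refl.
Qed.

(** Membership in degree [k - 1], where degree [-1] is zero. *)
Definition lower k (q : M) : Prop := if k is k'.+1 then hom k' q else q = 0.

Lemma lower_z k q : lower k q -> hom k (act Hz q).
Proof. by case: k => [->|k]; [rewrite linear0; exact: hom0 | exact: hom_z]. Qed.

Lemma lower_zb k q : lower k q -> hom k (act Hzb q).
Proof. by case: k => [->|k]; [rewrite linear0; exact: hom0 | exact: hom_zb]. Qed.

Lemma zeta_lower k (p : M) : hom k p -> lower k (act Hzeta p).
Proof.
move: k p; apply: (homogeneous_ind (Q := fun k p => lower k (act Hzeta p))) => [v|k p q hp hq lp lq].
  by rewrite act_tens mulr1 /= -[Hzeta]mul1r; exact: tens_vec.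
rewrite linearD /= -!actM dz dk !actD actN act1 !actM.
apply: homD; apply: homD; [exact: lower_z| |exact: lower_zb|exact: hom_refl_sum].
by apply: homD => //; rewrite -scaleN1r; apply/homZ/hom_refl_sum.
Qed.

Lemma zetab_lower k (p : M) : hom k p -> lower k (act Hzetab p).
Proof.
move: k p; apply: (homogeneous_ind (Q := fun k p => lower k (act Hzetab p))) => [v|k p q hp hq lp lq].
  by rewrite act_tens mulr1 /= -[Hzetab]mul1r; exact: tens_vec.
rewrite linearD /= -!actM dz' dk' !actD actN act1 !actM.
apply: homD; apply: homD; [exact: lower_z|exact: hom_refl_sum|exact: lower_zb|].
by apply: homD => //; rewrite -scaleN1r; apply/homZ/hom_refl_sum.
Qed.

Lemma hom_Eplus k (p : M) : hom k p -> hom k.+2 (act Eplus p).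
Proof. by move=> hp; rewrite actZ actM; apply/homZ/hom_z/hom_zb. Qed.

Lemma hom_Eminus k (p : M) : hom k.+2 p -> hom k (act Eminus p).
Proof. by move=> /zetab_lower /= /zeta_lower hp; rewrite actZ actM; apply: homZ. Qed.

Lemma hom_Eminus0 k (p : M) : (k < 2)%N -> hom k p -> act Eminus p = 0.
Proof.
case: k => [|[|//]] _ /zetab_lower /= h; rewrite actZ actM.
  by rewrite h linear0 scaler0.
by rewrite (zeta_lower h) scaler0.
Qed.

(** [Hdeg] is the element [H] of the sl2-triple, and [Heuler] is [H - 1]. *)
Definition Hdeg : H := Hzb * Hzetab + Hz * Hzeta + (1 - Hsigma).
Definition Heuler : H := Hz * Hzeta + Hzb * Hzetab - Hsigma.

Lemma two_half : - 2 * 2^-1 = -1 :> C.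
Proof. by rewrite mulNr divff // pnatr_eq0. Qed.

Lemma Eminus_Eplus (p : M) : act Eminus (act Eplus p) =
  act Eplus (act Eminus p) - act Hdeg p.
Proof.
rewrite -!actM -actB; congr (act _ p).
rewrite /Eminus /Eplus !Hscale_mull !Hscale_mulr !scalerA [2^-1 * _]mulrC two_half.
by rewrite !scaleN1r (rel_f_e zC dz dz' dk dk' zk zk') opprD.
Qed.

Lemma sigma_tens1 v : act Hsigma (tens 1 v : M) = N *: tens 1 v.
Proof.
rewrite act_suml -tensZr -mul_scalar_mx -Nc_spec // mulmx_suml tens_sumr.
apply: eq_bigr => j _; rewrite actZ act_tens -[_ * _]mul1r mulr1 tens_refl.
by rewrite -tensZr scalemxAl.
Qed.

Lemma Heuler_hom k (p : M) : hom k p -> act Heuler p = (k%:R - N) *: p.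
Proof.
move: k p; apply: (homogeneous_ind (Q := fun k p => act Heuler p = (k%:R - N) *: p)) => [v|k p q hp hq ep eq].
  rewrite actB actD !actM.
  have [-> ->] : act Hzeta (tens 1 v : M) = 0 /\ act Hzetab (tens 1 v : M) = 0.
    by split; [exact: (zeta_lower (hom_tens1 _ _ _)) | exact: (zetab_lower (hom_tens1 _ _ _))].
  by rewrite !linear0 add0r !sub0r sigma_tens1 scaleNr.
rewrite linearD /= -!actM (rel_h_z zC dz dk' zk') (rel_h_z' zC dz' dk zk) !actD !actM.
rewrite -/Heuler ep eq !linearZ /=.
have -> : k.+1%:R - N = (k%:R - N) + 1 by rewrite -natr1 addrAC.
by rewrite addrACA -scalerDr [RHS]scalerDl scale1r.
Qed.

Lemma Hdeg_hom k (p : M) : hom k p -> act Hdeg p = (k%:R + 1 - N) *: p.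
Proof.
move=> hp; have -> : Hdeg = Heuler + 1.
  by rewrite /Hdeg /Heuler [Hz * Hzeta + _]addrC -[RHS]addrA [- Hsigma + _]addrC.
by rewrite actD act1 (Heuler_hom hp) (addrAC _ 1) [RHS]scalerDl scale1r.
Qed.

Lemma Z0_Eplus (p : M) : act Z0 (act Eplus p) = act Eplus (act Z0 p).
Proof.
by rewrite -!actM Hscale_mulr Hscale_mull (rel_Z_e zC dz dz' dk dk' zk zk').
Qed.

Lemma Z0_Eminus (p : M) : act Z0 (act Eminus p) = act Eminus (act Z0 p).
Proof.
by rewrite -!actM Hscale_mulr Hscale_mull (rel_f_Z dC dz dz' dk dk' ks ks').
Qed.

Lemma sigma_Eplus (p : M) : act Hsigma (act Eplus p) = act Eplus (act Hsigma p).
Proof. by rewrite -!actM Hscale_mulr Hscale_mull (rel_s_e zC zk' kz'). Qed.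

Lemma sigma_Eminus (p : M) : act Hsigma (act Eminus p) = act Eminus (act Hsigma p).
Proof. by rewrite -!actM Hscale_mulr Hscale_mull (rel_s_f dC ks' ksr). Qed.

Local Notation lowE := (low (fun d => hom d)).

Lemma lower_low k q x : lower k q -> lowE k.+1 (x *: q).
Proof. by case: k => [|k] /= => [->|]; [rewrite scaler0 | exact: homZ]. Qed.

Lemma Z0E : Z0 = Heuler + Hsigma - 2 *: (Hz * Hzeta) :> H.
Proof.
rewrite /Heuler subrK scaler_nat mulr2n opprD addrA [_ + Hzb * _]addrC addrK.
by rewrite /Z0.
Qed.

Lemma Z0E' : Z0 = - (Heuler + Hsigma) + 2 *: (Hzb * Hzetab) :> H.
Proof.
rewrite /Heuler subrK scaler_nat mulr2n opprD -addrA.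
by rewrite addKr [RHS]addrC.
Qed.

Lemma two_two : 2 * 2 = 4 :> C.
Proof. by rewrite -natrM. Qed.

Lemma two_Eplus (p : M) : 2 *: act Eplus p = act Hz (act Hzb p).
Proof. by rewrite actZ scalerA divff ?pnatr_eq0 // scale1r actM. Qed.

(** As [Z_0 = (k + 1 - N) + sigma - 2 z zeta] in degree [k + 1], and
    [z zeta zbar = z zbar zeta + sigma zbar], the operator [Z_0] acts on
    [zbar^(k + 1)] by [k + 1 - N - sigma] modulo the image of [E_+ = z zbar / 2]. *)
Lemma Z0_zb k (v : V) : exists2 q, lowE k.+1 q &
  act Z0 (tens (Hzb ^+ k.+1) v : M) = (k.+1%:R - N) *: tens (Hzb ^+ k.+1) v
     - act Hsigma (tens (Hzb ^+ k.+1) v) + act Eplus q.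
Proof.
set p : M := tens (Hzb ^+ k) v.
have hp : hom k p := hom_zbX m c k v.
have E : (tens (Hzb ^+ k.+1) v : M) = act Hzb p by rewrite act_tens -exprS.
exists ((- 4) *: act Hzeta p); first by apply: lower_low; exact: zeta_lower.
rewrite E Z0E actB actD (Heuler_hom (hom_zb hp)).
rewrite -addrA -[RHS]addrA; congr (_ + _).
have zdz' : Hz * Hzeta * Hzb = Hz * Hzb * Hzeta + Hsigma * Hzb :> H.
  by rewrite -mulrA dk mulrDr zk mulrA.
have -> : act (2 *: (Hz * Hzeta)) (act Hzb p) =
    4 *: act Eplus (act Hzeta p) + 2 *: act Hsigma (act Hzb p).
  rewrite actZ -actM zdz' actD scalerDr [act (Hsigma * _) p]actM; congr (_ + _).
  by rewrite (actM (Hz * Hzb)) (actM Hz) -two_Eplus scalerA two_two.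
rewrite linearZ /= scaleNr [2 *: _]scaler_nat mulr2n !opprD addrC -!addrA.
by rewrite addNr addr0 addrC.
Qed.

(** The mirror image of [Z0_zb], from [Z_0 = - (k + 1 - N) - sigma + 2 zbar zetab]
    in degree [k + 1]. *)
Lemma Z0_z k (v : V) : exists2 q, lowE k.+1 q &
  act Z0 (tens (Hz ^+ k.+1) v : M) = - (k.+1%:R - N) *: tens (Hz ^+ k.+1) v
     + act Hsigma (tens (Hz ^+ k.+1) v) + act Eplus q.
Proof.
set p : M := tens (Hz ^+ k) v.
have hp : hom k p := hom_zX m c k v.
have E : (tens (Hz ^+ k.+1) v : M) = act Hz p by rewrite act_tens -exprS.
exists (4 *: act Hzetab p); first by apply: lower_low; exact: zetab_lower.
rewrite E Z0E' actD actN actD (Heuler_hom (hom_z hp)).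
rewrite opprD -scaleNr -addrA -[RHS]addrA; congr (_ + _).
have zdz : Hzb * Hzetab * Hz = Hz * Hzb * Hzetab + Hsigma * Hz :> H.
  by rewrite -mulrA dk' mulrDr zk' mulrA -zC.
have -> : act (2 *: (Hzb * Hzetab)) (act Hz p) =
    4 *: act Eplus (act Hzetab p) + 2 *: act Hsigma (act Hz p).
  rewrite actZ -actM zdz actD scalerDr [act (Hsigma * _) p]actM; congr (_ + _).
  by rewrite (actM (Hz * Hzb)) (actM Hz) -two_Eplus scalerA two_two.
rewrite linearZ /= [2 *: _]scaler_nat mulr2n addrCA [RHS]addrC.
by congr (_ + _); rewrite addKr.
Qed.

Lemma reflX_z j k : Hrefl j * Hz ^+ k = (om ^+ j.+1) ^+ k *: (Hzb ^+ k * Hrefl j) :> H.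
Proof.
elim: k => [|k IHk]; first by rewrite !expr0 scale1r mulr1 mul1r.
rewrite [Hz ^+ _]exprS mulrA Hrefl_z Hscale_mull -mulrA IHk Hscale_mulr scalerA.
by rewrite mulrA -!exprS.
Qed.

Lemma reflX_zb j k : Hrefl j * Hzb ^+ k = (om ^- j.+1) ^+ k *: (Hz ^+ k * Hrefl j) :> H.
Proof.
elim: k => [|k IHk]; first by rewrite !expr0 scale1r mulr1 mul1r.
rewrite [Hzb ^+ _]exprS mulrA Hrefl_zb Hscale_mull -mulrA IHk Hscale_mulr scalerA.
by rewrite mulrA -!exprS.
Qed.

Lemma tensZl a (h : H) (v : V) : tens (a *: h) v = a *: tens h v :> M.
Proof. by rewrite -[h]mulr1 -act_tens -Hscale_mull mulr1 -actZ act_tens mulr1. Qed.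

Lemma sigma_z k (i : 'I_(dimV tau)) : act Hsigma (tens (Hz ^+ k) (zlab i) : M) =
  sigma_tau m c k%:Z i *: tens (Hzb ^+ k) (zblab i).
Proof.
rewrite act_suml -tensZr -sum_repr_zlab // tens_sumr; apply: eq_bigr => j _.
by rewrite actZ act_tens reflX_z tensZl tens_refl scalerA tensZr.
Qed.

Lemma sigma_zb k (i : 'I_(dimV tau)) : act Hsigma (tens (Hzb ^+ k) (zblab i) : M) =
  sigma_tau m c k%:Z i *: tens (Hz ^+ k) (zlab i).
Proof.
rewrite act_suml -tensZr -sum_repr_zblab // tens_sumr; apply: eq_bigr => j _.
by rewrite actZ act_tens reflX_zb tensZl tens_refl scalerA tensZr.
Qed.

End DunklGrading.

(** * The adjoints of E_+ and Z_0 *)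
Section Star.
Variables (R : realType) (m : nat) (c : 'M[R]_2 -> R).
Local Notation C := (R[i]).
Local Notation H := (Hc m c).
Variables (st : H -> H) (st_star : is_star st).

Let st_lin (a : C) (h h' : H) : st (a *: h + h') = Num.conj a *: st h + st h'.
Proof. by case: st_star. Qed.

Let st0 : st 0 = 0.
Proof.
have := st_lin 1 0 0; rewrite rmorph1 !scale1r addr0 => E.
by apply: (addrI (st 0)); rewrite -E addr0.
Qed.

Let stD (h h' : H) : st (h + h') = st h + st h'.
Proof. by have := st_lin 1 h h'; rewrite rmorph1 !scale1r. Qed.

Let stZ (a : C) (h : H) : st (a *: h) = Num.conj a *: st h.
Proof. by have := st_lin a h 0; rewrite st0 !addr0. Qed.

Let stM (h h' : H) : st (h * h') = st h' * st h.
Proof. by case: st_star. Qed.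

Let stK (h : H) : st (st h) = h.
Proof. by case: st_star. Qed.

Let two0 : (2 : C) != 0.
Proof. by rewrite pnatr_eq0. Qed.

(** [z = x + i y] has the adjoint [xi - i eta = 2 zeta]. *)
Let st_z : st Hz = 2 *: Hzeta.
Proof.
have [_ _ _ [_ stx _ sty] _] := st_star.
rewrite /Hz [vx R + _]addrC Hcovector_lin -/Hx -/Hy stD stZ stx sty conjCi.
rewrite /Hzeta HvectorZ scalerA divff // scale1r addrC.
by rewrite [vxi R - _]addrC -scaleNr Hvector_lin scaleNr addrC.
Qed.

Let st_zb : st Hzb = 2 *: Hzetab.
Proof.
have [_ _ _ [_ stx _ sty] _] := st_star.
rewrite /Hzb [vx R - _]addrC -scaleNr Hcovector_lin -/Hx -/Hy stD stZ stx sty.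
rewrite rmorphN /= conjCi opprK /Hzetab HvectorZ scalerA divff // scale1r.
by rewrite [vxi R + _]addrC Hvector_lin.
Qed.

Let conj_half : Num.conj (2^-1 : C) = 2^-1.
Proof. by rewrite fmorphV rmorph_nat. Qed.

Let conj_two : Num.conj (2 : C) = 2.
Proof. by rewrite rmorph_nat. Qed.

Let st_zeta : st Hzeta = 2^-1 *: Hz.
Proof.
have := stK Hz; rewrite st_z stZ conj_two => E.
by rewrite -E scalerA mulVf // scale1r.
Qed.

Let st_zetab : st Hzetab = 2^-1 *: Hzb.
Proof.
have := stK Hzb; rewrite st_zb stZ conj_two => E.
by rewrite -E scalerA mulVf // scale1r.
Qed.

Lemma st_Eplus : st Eplus = - Eminus.
Proof.
rewrite stZ stM st_z st_zb conj_half Hscale_mull Hscale_mulr !scalerA -HzetaC.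
by rewrite mulrA mulVf // mul1r /Eminus scaleNr opprK.
Qed.

Lemma st_Z0 : st Z0 = Z0.
Proof.
rewrite /Z0 stD -[- (_ * _) in LHS]scaleN1r stZ rmorphN1 scaleN1r !stM.
rewrite st_z st_zb st_zeta st_zetab !Hscale_mull !Hscale_mulr !scalerA.
by rewrite mulVf // !scale1r.
Qed.

End Star.

(** * The standard module is spanned by homogeneous vectors *)
Section Spanning.
Variables (R : realType) (m : nat) (m_gt0 : (0 < m)%N).
Variables (c : 'M[R]_2 -> R) (tau : irrep).
Local Notation C := (R[i]).
Local Notation V := ('cV[C]_(dimV tau)).
Local Notation H := (Hc m c).
Local Notation M := (Mc m c tau).
Local Notation hom := (@homogeneous R m c tau).

(** The sums of homogeneous vectors; the impredicative form needs no lists and is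
    directly an induction principle. *)
Definition finite_sum (p : M) : Prop := forall Q : M -> Prop,
  (forall p q, Q p -> Q q -> Q (p + q)) -> (forall k p, hom k p -> Q p) -> Q p.

Lemma finite_sumD p q : finite_sum p -> finite_sum q -> finite_sum (p + q).
Proof. by move=> fp fq Q QD Qh; exact: QD (fp Q QD Qh) (fq Q QD Qh). Qed.

Lemma finite_sum_hom k p : hom k p -> finite_sum p.
Proof. by move=> hp Q QD Qh; exact: Qh hp. Qed.

Definition stable (h : H) : Prop := forall p, finite_sum p -> finite_sum (act h p).

Lemma stable_hom (h : H) :
  (forall k p, hom k p -> finite_sum (act h p)) -> stable h.
Proof.
move=> hh p fp; apply: (fp (fun p => finite_sum (act h p))) => // {p fp} p q fp fq.
by rewrite linearD; exact: finite_sumD.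
Qed.

Lemma stableD (h h' : H) : stable h -> stable h' -> stable (h + h').
Proof. by move=> sh sh' p fp; rewrite actD; apply: finite_sumD; [exact: sh|exact: sh']. Qed.

Lemma stableM (h h' : H) : stable h -> stable h' -> stable (h * h').
Proof. by move=> sh sh' p fp; rewrite actM; apply: sh; apply: sh'. Qed.

Lemma stable1 : stable 1.
Proof. by move=> p; rewrite act1. Qed.

Lemma stableZ a (h : H) : stable h -> stable (a *: h).
Proof.
move=> sh p fp; rewrite actZ; apply: (sh p fp (fun p => finite_sum (a *: p))).
  by move=> q r fq fr; rewrite scalerDr; exact: finite_sumD.
by move=> k q hq; apply: (@finite_sum_hom k); exact: homZ.
Qed.

Let lower_sum k q : lower k q -> finite_sum (q : M).
Proof.
case: k => [->|k /= h]; last exact: finite_sum_hom h.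
by apply: (@finite_sum_hom 0); exact: hom0.
Qed.

Lemma stable_z : stable Hz.
Proof. by apply: stable_hom => k p /hom_z; exact: finite_sum_hom. Qed.

Lemma stable_zb : stable Hzb.
Proof. by apply: stable_hom => k p /hom_zb; exact: finite_sum_hom. Qed.

Lemma stable_zeta : stable Hzeta.
Proof. by apply: stable_hom => k p /zeta_lower; exact: lower_sum. Qed.

Lemma stable_zetab : stable Hzetab.
Proof. by apply: stable_hom => k p /zetab_lower; exact: lower_sum. Qed.

Lemma stable_refl j : stable (Hrefl j).
Proof. by apply: stable_hom => k p /(hom_refl j); exact: finite_sum_hom. Qed.

Lemma stable_cov f : stable (Hcovector f).
Proof.
rewrite [f]row_zE Hcovector_lin HcovectorZ.
by apply: stableD; apply: stableZ; [exact: stable_z | exact: stable_zb].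
Qed.

Lemma stable_vec u : stable (Hvector u).
Proof.
rewrite [u]col_zetaE Hvector_lin (HvectorZ _ _ (u 0 0 - _)).
by apply: stableD; apply: stableZ; [exact: stable_zeta | exact: stable_zetab].
Qed.

Lemma stable_grp g (hg : in_dihedral m g) : stable (Hpi c (Tgrp hg) : H).
Proof.
elim: (g) / hg (hg) => [|j h hh IH] hg'.
  have -> : Hpi c (Tgrp hg') = 1 :> H by apply/HpiP/Hgrp1.
  exact: stable1.
have -> : Hpi c (Tgrp hg') = Hrefl j * Hpi c (Tgrp hh) :> H.
  by rewrite [RHS]HmulE; apply/HpiP/Heq_sym/HgrpM.
by apply: stableM; [exact: stable_refl | exact: IH].
Qed.

(** [M_c(tau)] is generated by [V(tau)], and the generators of the algebra preserve
    the sums of homogeneous vectors. *)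
Lemma stable_all (h : H) : stable h.
Proof.
have [t ->] := Hpi_surj h; elim: t => [u|f|g hg|a|s IHs t IHt|s IHs t IHt].
- exact: stable_vec.
- exact: stable_cov.
- exact: stable_grp.
- by rewrite HscalE; apply: stableZ; exact: stable1.
- by rewrite -HaddE; exact: stableD.
by rewrite -HmulE; exact: stableM.
Qed.

Lemma finite_sum_all (p : M) : finite_sum p.
Proof.
have [t ->] := Mpi_surj p; elim: t => [h v||a t IH|s IHs t IHt].
- have -> : Mpi (Mtens h v) = act h (tens 1 v) by rewrite act_tens mulr1.
  by apply: stable_all; apply: (@finite_sum_hom 0); exact: hom_tens1.
- by apply: (@finite_sum_hom 0); exact: hom0.
- have -> : Mpi (Msca a t) = act (a *: (1 : H)) (Mpi t) by rewrite actZ act1 [RHS]Mc_scaleE.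
  exact: stable_all.
by rewrite -[Mpi _]Mc_addE; exact: finite_sumD.
Qed.

End Spanning.

(** * Harmonics of the standard module *)
Section InvariantForm.
Variables (R : realType) (m : nat) (c : 'M[R]_2 -> R) (tau : irrep).
Local Notation C := (R[i]).
Local Notation M := (Mc m c tau).

(** All that is used of the Hermitian form. *)
Lemma invariant_form : unitarisable m c tau -> exists form : M -> M -> C,
  [/\ forall x p r, form (x *: p) r = x * form p r,
      forall p q, form q p = Num.conj (form p q),
      forall p, p != 0 -> 0 < form p p &
      (forall p q, form (act Eplus p) q = - form p (act Eminus q)) /\
      (forall p q, form (act Z0 p) q = form p (act Z0 q))].
Proof.
move=> [st [beta [st_star adj _ _]]]; exists (fun p q => beta p q).
split=> [x p r|p q|p p0|].
- exact: linearZl_LR.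
- by rewrite hermC mul1r.
- exact: neq0_dnorm_gt0.
split=> p q; rewrite adj; last by rewrite st_Z0.
by rewrite st_Eplus // actN linearNr.
Qed.

End InvariantForm.

Section DegreeZero.
Variables (R : realType) (m : nat) (m_gt0 : (0 < m)%N).
Variables (c : 'M[R]_2 -> R) (c_inv : conj_invariant m c).
Variables (tau : irrep) (tau_irr : is_irrep m tau).
Local Notation C := (R[i]).
Local Notation V := ('cV[C]_(dimV tau)).
Local Notation M := (Mc m c tau).
Local Notation N := (Nc m c tau).

(** [N_c(tau)] is the member of [sigma(tau)_0] in dimension 1, and 0 for
    [rho^(u)], where [z(sigma)] and [zbar(sigma)] are different. *)
Lemma Nc_label (i : 'I_(dimV tau)) : N = (sigma_tau m c 0 i : C) * (i == rev_ord i)%:R.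
Proof.
have E : N *: (zlab i : V) = (sigma_tau m c 0 i : C) *: zblab i.
  rewrite -(sum_repr_zlab m c 0 i) -mul_scalar_mx -Nc_spec // mulmx_suml.
  by apply: eq_bigr => j _; rewrite expr0 mulr1 scalemxAl.
have := congr1 (fun A : V => A i 0) E; rewrite !mxE !eqxx !andbT => <-.
by rewrite mulr1.
Qed.

Lemma lam0E eps i : lam0 m c tau eps i = eps%:C * N.
Proof.
rewrite (Nc_label i) /lam0; case: (tau) i => [||u|u] i.
all: try by rewrite (ord1 (rev_ord i)) (ord1 i) eqxx mulr1.
have -> : (i == rev_ord i) = false by case: i => [[|[|//]] ?].
by rewrite !mulr0.
Qed.

Lemma Zeps_tens1 eps i v :
  act (Zeps eps) (tens 1 v : M) = lam0 m c tau eps i *: tens 1 v.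
Proof.
rewrite lam0E actD actZ sigma_tens1 // scalerA actB !actM.
have -> : act Hzeta (tens 1 v : M) = 0 := zeta_lower (hom_tens1 m c v).
have -> : act Hzetab (tens 1 v : M) = 0 := zetab_lower (hom_tens1 m c v).
by rewrite (linear0 (act Hzb)) (linear0 (act Hz)) subr0 add0r.
Qed.

End DegreeZero.

Section ProjectionOperator.
Variables (R : realType) (m : nat) (c : 'M[R]_2 -> R) (tau : irrep).
Local Notation C := (R[i]).
Local Notation M := (Mc m c tau).
Local Notation N := (Nc m c tau).

Lemma ProjE k (p : M) : Proj k p = hproj (act Eplus) (act Eminus) N k p.
Proof. by apply: eq_bigr => j _; rewrite actM !act_iter. Qed.

Lemma Proj_low k (p : M) : homogeneous k p ->
  exists2 q, low (fun d => @homogeneous R m c tau d) k q & Proj k p = p + act Eplus q.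
Proof.
move=> hp; rewrite ProjE.
exact: (projE N (fun d p => @hom_Eplus _ _ _ _ d p) (fun d p => @hom_Eminus _ _ _ _ d p)
  (hom0 m c tau) (fun d => @homD _ _ _ _ d) (fun d => @homZ _ _ _ _ d) hp).
Qed.

Lemma Proj_id k (p : M) : act Eminus p = 0 -> Proj k p = p.
Proof. by move=> p0; rewrite ProjE hproj_id. Qed.

Lemma Proj_linear k : linear (@Proj R m c tau k).
Proof. by move=> x p q; rewrite !ProjE hproj_is_linear. Qed.

HB.instance Definition _ k :=
  GRing.isLinear.Build C M M _ (@Proj R m c tau k) (Proj_linear k).

Lemma Proj_Z0 k (p : M) : act Z0 (Proj k p) = Proj k (act Z0 p).
Proof. by rewrite !ProjE hproj_comm // => q; [exact: Z0_Eplus | exact: Z0_Eminus]. Qed.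

Lemma Proj_sigma k (p : M) : act Hsigma (Proj k p) = Proj k (act Hsigma p).
Proof. by rewrite !ProjE hproj_comm // => q; [exact: sigma_Eplus | exact: sigma_Eminus]. Qed.

End ProjectionOperator.

Section Harmonics.
Variables (R : realType) (m : nat) (m_gt0 : (0 < m)%N).
Variables (c : 'M[R]_2 -> R) (c_inv : conj_invariant m c).
Variables (tau : irrep) (tau_irr : is_irrep m tau).
Local Notation C := (R[i]).
Local Notation V := ('cV[C]_(dimV tau)).
Local Notation M := (Mc m c tau).
Local Notation N := (Nc m c tau).
Local Notation hom := (fun d => @homogeneous R m c tau d).

Variable form : M -> M -> C.
Hypothesis formZl : forall x p r, form (x *: p) r = x * form p r.
Hypothesis form_conj : forall p q, form q p = Num.conj (form p q).
Hypothesis form_gt0 : forall p, p != 0 -> 0 < form p p.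
Hypothesis form_Eplus : forall p q, form (act Eplus p) q = - form p (act Eminus q).

Let Em_Ep (p : M) := Eminus_Eplus p.
Let wt_Hd d (p : M) (h : hom d p) := Hdeg_hom m_gt0 c_inv tau_irr h.
Let wt_Ep d (p : M) (h : hom d p) : hom d.+2 (act Eplus p) := hom_Eplus h.
Let wt_Em d (p : M) (h : hom d.+2 p) : hom d (act Eminus p) := hom_Eminus h.
Let wt_Em0 d (p : M) (d2 : (d < 2)%N) (h : hom d p) : act Eminus p = 0 := hom_Eminus0 d2 h.
Let wt0 d : hom d (0 : M) := hom0 m c tau d.
Let wtD d (p q : M) (h : hom d p) (h' : hom d q) : hom d (p + q) := homD h h'.
Let wtZ d x (p : M) (h : hom d p) : hom d (x *: p) := homZ x h.

(* Any nonzero vector of degree 0 serves as the lowest weight vector. *)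
Let i0 : 'I_(dimV tau) := Ordinal (ltac:(by case: tau) : (0 < dimV tau)%N).

Let v0 : M := tens 1 (zlab i0).

Let z0 : (zlab i0 : V) != 0.
Proof.
apply/eqP => /(congr1 (fun A : V => A i0 0)) /eqP.
by rewrite !mxE !eqxx oner_eq0.
Qed.

Let Ep_v0 : act Eplus v0 != 0.
Proof. by apply: contra_neq z0; exact: Eplus_tens_neq0. Qed.

Let v0_neq0 : v0 != 0.
Proof. by apply: contraNneq Ep_v0 => ->; rewrite linear0. Qed.

Let wt_v0 : hom 0 v0 := hom_tens1 m c _.

Lemma weight_gt0 k : 0 < k.+1%:R - N.
Proof.
exact: (sl2_weightS_gt0 Em_Ep wt_Hd wt_Em0 formZl form_conj form_gt0 form_Eplus
  wt_v0 v0_neq0 Ep_v0).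
Qed.

Lemma Proj_harmonic k (p : M) : hom k p -> harmonic k (Proj k p).
Proof.
move=> hp; rewrite ProjE; split; first exact: (wt_proj N wt_Ep wt_Em wt0 wtD wtZ hp).
exact: (proj_harmonic Em_Ep wt_Hd wt_Ep wt_Em wt_Em0 formZl form_conj form_gt0
  form_Eplus wt_v0 v0_neq0 Ep_v0 hp).
Qed.

(** The harmonics of degree [k] are thus a complement of [E_+ M_(k - 2)]. *)
Lemma Proj_Eplus k (q : M) : low hom k q -> Proj k (act Eplus q) = 0.
Proof.
move=> lq; rewrite ProjE.
exact: (proj_Ep Em_Ep wt_Hd wt_Ep wt_Em wt_Em0 wt0 wtD wtZ formZl form_conj form_gt0
  form_Eplus wt_v0 v0_neq0 Ep_v0 lq).
Qed.

End Harmonics.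

Section TopMonomials.
Variables (R : realType) (m : nat) (c : 'M[R]_2 -> R) (tau : irrep).
Local Notation C := (R[i]).
Local Notation V := ('cV[C]_(dimV tau)).
Local Notation H := (Hc m c).
Local Notation M := (Mc m c tau).
Local Notation hom := (fun d => @homogeneous R m c tau d).

(** All the monomials other than [z^k] and [zbar^k] are divisible by [z zbar]. *)
Lemma hom_top k (p : M) : (0 < k)%N -> hom k p -> exists v v' q,
  low hom k q /\ p = tens (Hz ^+ k) v + tens (Hzb ^+ k) v' + act Eplus q.
Proof.
case: k => [//|[|k]] _ [v ->].
  exists (v ord_max), (v ord0), 0; split=> //.
  rewrite big_ord_recl big_ord1 linear0 addr0 addrC subnn mulr1.
  by rewrite expr0 mul1r; congr (tens _ (v _) + _); apply: val_inj.
exists (v ord_max), (v ord0), (\sum_(a < k.+1)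
  2 *: tens (Hz ^+ a * Hzb ^+ (k - a)) (v (lift ord0 (widen_ord (leqnSn _) a)))); split.
  by exists (fun a => 2 *: v (lift ord0 (widen_ord (leqnSn _) a)));
    apply: eq_bigr => a _; rewrite tensZr.
rewrite big_ord_recl big_ord_recr linear_sum /= addrCA [LHS]addrC.
rewrite [X in X + _]addrC; congr (_ + _ + _).
- by rewrite /bump /= add1n subnn mulr1; congr (tens _ (v _)); apply: val_inj.
- by rewrite expr0 mul1r subn0.
apply: eq_bigr => a _; rewrite linearZ /= two_Eplus !act_tens HzbXz mulrA -exprS.
by rewrite /bump /= add1n subSS subSn // -ltnS ltn_ord.
Qed.

End TopMonomials.

(** * The eigenbasis of the harmonics *)
Section HarmonicEigenbasis.
Variables (R : realType) (m : nat) (m_gt0 : (0 < m)%N).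
Variables (c : 'M[R]_2 -> R) (c_inv : conj_invariant m c).
Variables (tau : irrep) (tau_irr : is_irrep m tau).
Local Notation C := (R[i]).
Local Notation V := ('cV[C]_(dimV tau)).
Local Notation M := (Mc m c tau).
Local Notation N := (Nc m c tau).
Local Notation hom := (fun d => @homogeneous R m c tau d).

Variable form : M -> M -> C.
Hypothesis formZl : forall x p r, form (x *: p) r = x * form p r.
Hypothesis form_conj : forall p q, form q p = Num.conj (form p q).
Hypothesis form_gt0 : forall p, p != 0 -> 0 < form p p.
Hypothesis form_Eplus : forall p q, form (act Eplus p) q = - form p (act Eminus q).
Hypothesis form_Z0 : forall p q, form (act Z0 p) q = form p (act Z0 q).

Variable k : nat.
Hypothesis k_gt0 : (0 < k)%N.
Variable eps : R.

Local Notation P := (k%:R - N).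
Local Notation s := (@sigma_tau R m c tau k%:Z).

(** The harmonic projections of the two extreme monomials. They are a basis of the
    harmonics of degree [k] because all else is in the image of [E_+]. *)
Definition topz (i : 'I_(dimV tau)) : M := Proj k (tens (Hz ^+ k) (zlab i)).
Definition topzb (i : 'I_(dimV tau)) : M := Proj k (tens (Hzb ^+ k) (zblab i)).

Let ProjE0 (q : M) (lq : low hom k q) : Proj k (act Eplus q) = 0 :=
  Proj_Eplus m_gt0 c_inv tau_irr formZl form_conj form_gt0 form_Eplus lq.

Lemma Z0_topzb i : act Z0 (topzb i) = P *: topzb i - s i *: topz i.
Proof.
rewrite /topzb /topz Proj_Z0; case: k k_gt0 ProjE0 => // k' _ PE.
have [q lq ->] := Z0_zb m_gt0 c_inv tau_irr k' (zblab i).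
rewrite linearD /= [Proj _ (act Eplus q)]PE // addr0 linearB sigma_zb //=.
by rewrite [Proj _ (_ *: _)]linearZ [X in _ - X]linearZ.
Qed.

Lemma Z0_topz i : act Z0 (topz i) = - P *: topz i + s i *: topzb i.
Proof.
rewrite /topzb /topz Proj_Z0; case: k k_gt0 ProjE0 => // k' _ PE.
have [q lq ->] := Z0_z m_gt0 c_inv tau_irr k' (zlab i).
rewrite linearD /= [Proj _ (act Eplus q)]PE // addr0 linearD sigma_z /=.
by rewrite [Proj _ (_ *: _)]linearZ [X in _ + X = _]linearZ.
Qed.

Lemma sigma_topzb i : act Hsigma (topzb i) = s i *: topz i.
Proof. by rewrite /topzb Proj_sigma sigma_zb // linearZ. Qed.

Lemma sigma_topz i : act Hsigma (topz i) = s i *: topzb i.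
Proof. by rewrite /topz Proj_sigma sigma_z linearZ. Qed.

Let zcomb (x : 'I_(dimV tau) -> C) : V := \sum_i x i *: zlab i.
Let zbcomb (x : 'I_(dimV tau) -> C) : V := \sum_i x i *: zblab i.

Let zcombE x i : zcomb x i 0 = x i.
Proof.
rewrite /zcomb summxE (bigD1 i) //= big1 => [|j ji]; rewrite !mxE.
  by rewrite !eqxx mulr1 addr0.
by rewrite [i == j]eq_sym (negPf ji) mulr0.
Qed.

Let zbcombE x i : zbcomb x (rev_ord i) 0 = x i.
Proof.
rewrite /zbcomb summxE (bigD1 i) //= big1 => [|j ji]; rewrite !mxE.
  by rewrite !eqxx mulr1 addr0.
by rewrite (inj_eq rev_ord_inj) [i == j]eq_sym (negPf ji) mulr0.
Qed.

Let top_sum x y : \sum_i (x i *: topz i + y i *: topzb i) =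
  Proj k (tens (Hz ^+ k) (zcomb x) + tens (Hzb ^+ k) (zbcomb y)).
Proof.
rewrite !tens_sumr -big_split linear_sum; apply: eq_bigr => i _.
rewrite /= !tensZr linearD /=.
by rewrite [Proj _ (x i *: _)]linearZ [Proj _ (y i *: _)]linearZ.
Qed.

(** If the projection of a combination of top monomials vanishes, then the
    combination is in the image of [E_+]. *)
Lemma top_free x y : \sum_i (x i *: topz i + y i *: topzb i) = 0 ->
  forall i, x i = 0 /\ y i = 0.
Proof.
rewrite top_sum => E i.
have hp : hom k (tens (Hz ^+ k) (zcomb x) + tens (Hzb ^+ k) (zbcomb y)).
  by apply: homD; [exact: hom_zX | exact: hom_zbX].
have [q lq Eq] := Proj_low hp.
have /(tens_top_free m_gt0 c_inv tau_irr k_gt0)[x0 y0] :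
    tens (Hz ^+ k) (zcomb x) + tens (Hzb ^+ k) (zbcomb y) = act Eplus (- q) :> M.
  by rewrite linearN; apply/eqP; rewrite -addr_eq0 -Eq E.
by rewrite -(zcombE x) x0 -(zbcombE y) y0 !mxE.
Qed.

Lemma top_span p : harmonic k p -> exists x y : 'I_(dimV tau) -> C,
  p = \sum_i (x i *: topz i + y i *: topzb i).
Proof.
move=> [hp p0]; have [v [v' [q [lq E]]]] := hom_top k_gt0 hp.
exists (fun i => v i 0), (fun i => v' (rev_ord i) 0); rewrite top_sum.
have -> : zcomb (fun i => v i 0) = v.
  by apply/matrixP => i j; rewrite ord1 zcombE.
have -> : zbcomb (fun i => v' (rev_ord i) 0) = v'.
  by apply/matrixP => i j; rewrite ord1 -[i in LHS]rev_ordK zbcombE rev_ordK.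
by rewrite -[LHS](Proj_id k p0) E linearD /= [X in _ + X]ProjE0 // addr0.
Qed.

Local Notation e := (eps%:C).
Local Notation lam := (lam m c tau eps k).
Local Notation hvec := (hvec m c tau eps k).

Lemma lamE i b : lam i b = eigval P s e i b.
Proof. by []. Qed.

Lemma hvecE i b : hvec i b = eigvec topz topzb P s e i b.
Proof.
rewrite /hvec /eigvec /lam mul1r mulN1r opprK -/(root_disc P s e i) /topz /topzb.
by case: b; rewrite linearB [X in X - _]linearZ [X in _ - X]linearZ.
Qed.

Let P_gt0 : 0 < P.
Proof.
case: k k_gt0 => // k' _.
exact: (weight_gt0 m_gt0 c_inv tau_irr formZl form_conj form_gt0 form_Eplus k').
Qed.

Let s_real i : s i \is Num.real := sigma_tau_real m_gt0 c_inv tau_irr k%:Z i.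

Let e_real : e \is Num.real.
Proof. by apply/CrealP; rewrite conj_real. Qed.

Lemma hvec_harmonic i b : harmonic k (hvec i b).
Proof.
apply: (Proj_harmonic m_gt0 c_inv tau_irr formZl form_conj form_gt0 form_Eplus).
have homB x y (p q : M) : homogeneous k p -> homogeneous k q -> homogeneous k (x *: p - y *: q).
  by move=> hp hq; rewrite -scaleNr; apply: homD; exact: homZ.
by case: b; apply: homB; [exact: hom_zbX | exact: hom_zX | exact: hom_zX | exact: hom_zbX].
Qed.

Lemma Zeps_hvec i b : act (Zeps eps) (hvec i b) = lam i b *: hvec i b.
Proof.
rewrite hvecE lamE -(eigvecP Z0_topzb Z0_topz sigma_topzb sigma_topz e i b).
by rewrite actD actZ.
Qed.

(** The eigenvectors are related to [topz], [topzb] by invertible 2 x 2 matrices. *)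
Lemma hvec_free (x : {ffun 'I_(dimV tau) * bool -> C}) :
  \sum_ib x ib *: hvec ib.1 ib.2 = 0 -> x = [ffun => 0].
Proof.
rewrite (eq_bigr _ (fun ib _ => congr1 (fun q => x ib *: q) (hvecE ib.1 ib.2))).
exact: (eigvec_free Z0_topzb Z0_topz top_free P_gt0 s_real formZl form_gt0 form_Z0 e_real).
Qed.

Lemma hvec_span p : harmonic k p -> exists x : {ffun 'I_(dimV tau) * bool -> C},
  p = \sum_ib x ib *: hvec ib.1 ib.2.
Proof.
move=> /top_span[x [y ->]].
have [z ->] := eigvec_span Z0_topzb Z0_topz top_free P_gt0 s_real formZl form_gt0
  form_Z0 e_real x y.
by exists z; apply: eq_bigr => ib _; rewrite hvecE.
Qed.

Lemma hvec_neq0 i b : hvec i b != 0.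
Proof.
apply/eqP => h0; have := @hvec_free [ffun ib => (ib == (i, b))%:R].
have -> : \sum_ib [ffun ib => (ib == (i, b))%:R] ib *: hvec ib.1 ib.2 = 0.
  apply: big1 => ib _; rewrite ffunE; case: eqP => [-> |_]; last by rewrite scale0r.
  by rewrite h0 scaler0.
by move=> /(_ erefl)/ffunP/(_ (i, b))/eqP; rewrite !ffunE eqxx oner_eq0.
Qed.

Lemma hvec_eigenvector i b : eigenvector (Zeps eps) (lam i b) (hvec i b).
Proof. by split; [exact: hvec_neq0 | exact: Zeps_hvec]. Qed.

(** Compare coefficients in the basis of eigenvectors. *)
Lemma harmonic_eigenvalue (p : M) l : harmonic k p -> eigenvector (Zeps eps) l p ->
  exists i b, l = lam i b.
Proof.
move=> hp [p0 Ep]; have [x px] := hvec_span hp.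
have /hvec_free x0 : \sum_ib [ffun ib => x ib * (lam ib.1 ib.2 - l)] ib *:
    hvec ib.1 ib.2 = 0.
  rewrite (eq_bigr (fun ib => act (Zeps eps) (x ib *: hvec ib.1 ib.2) -
    l *: (x ib *: hvec ib.1 ib.2))) => [|ib _].
    by rewrite sumrB -scaler_sumr -(linear_sum (act (Zeps eps))) /= -px Ep subrr.
  by rewrite ffunE linearZ /= Zeps_hvec !scalerA mulrBr scalerBl (mulrC l).
have [ib xib] : exists ib, x ib != 0.
  apply/existsP; apply: contraNT p0 => /existsPn xx; rewrite px big1 // => ib _.
  by have /negPn/eqP-> := xx ib; rewrite scale0r.
exists ib.1, ib.2; apply/eqP; rewrite eq_sym -subr_eq0.
have /eqP := congr1 (fun f : {ffun _ -> C} => f ib) x0.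
by rewrite !ffunE mulf_eq0 (negPf xib).
Qed.

End HarmonicEigenbasis.

(** * All the eigenvectors *)
Section Generation.
Variables (R : realType) (m : nat) (m_gt0 : (0 < m)%N).
Variables (c : 'M[R]_2 -> R) (c_inv : conj_invariant m c).
Variables (tau : irrep) (tau_irr : is_irrep m tau).
Local Notation C := (R[i]).
Local Notation V := ('cV[C]_(dimV tau)).
Local Notation M := (Mc m c tau).
Local Notation N := (Nc m c tau).
Local Notation hom := (fun d => @homogeneous R m c tau d).

Variable form : M -> M -> C.
Hypothesis formZl : forall x p r, form (x *: p) r = x * form p r.
Hypothesis form_conj : forall p q, form q p = Num.conj (form p q).
Hypothesis form_gt0 : forall p, p != 0 -> 0 < form p p.
Hypothesis form_Eplus : forall p q, form (act Eplus p) q = - form p (act Eminus q).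
Hypothesis form_Z0 : forall p q, form (act Z0 p) q = form p (act Z0 q).
Variable eps : R.

Let Em_Ep (p : M) := Eminus_Eplus p.
Let wt_Hd d (p : M) (h : hom d p) := Hdeg_hom m_gt0 c_inv tau_irr h.
Let wt_Ep d (p : M) (h : hom d p) : hom d.+2 (act Eplus p) := hom_Eplus h.
Let N_gt0 := weight_gt0 m_gt0 c_inv tau_irr formZl form_conj form_gt0 form_Eplus.

Lemma tens1_neq0 (v : V) : v != 0 -> tens 1 v != 0 :> M.
Proof.
apply: contra_neq => v0; apply: (Eplus_tens_neq0 m_gt0 c_inv tau_irr).
by rewrite v0 linear0.
Qed.

Lemma harmonic0P (p : M) : harmonic 0 p <-> exists v, p = tens 1 v.
Proof.
split=> [[/hom0P//]|[v ->]]; split; first exact: hom_tens1.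
exact: (hom_Eminus0 (k := 0)) (hom_tens1 m c v).
Qed.

Lemma tens1_eigenvector i (v : V) : v != 0 ->
  eigenvector (Zeps eps) (lam0 m c tau eps i) (tens 1 v : M).
Proof. by move=> v0; split; [exact: tens1_neq0 | exact: Zeps_tens1]. Qed.

Lemma listed_harmonic l (p : M) : listed eps l p ->
  eigenvector (Zeps eps) l p /\ exists k, harmonic k p.
Proof.
case=> [i v v0|k i b k0].
  by split; [exact: tens1_eigenvector | exists 0; apply/harmonic0P; exists v].
split; first exact: (hvec_eigenvector m_gt0 c_inv tau_irr formZl form_conj form_gt0
  form_Eplus form_Z0 k0).
exists k; exact: (hvec_harmonic m_gt0 c_inv tau_irr formZl form_conj form_gt0 form_Eplus).
Qed.

Lemma Zeps_Eplus (p : M) : act (Zeps eps) (act Eplus p) = act Eplus (act (Zeps eps) p).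
Proof.
have E (q : M) : act (Zeps eps) q = act Z0 q + eps%:C *: act Hsigma q.
  by rewrite actD actZ.
rewrite !E [act Z0 _]Z0_Eplus [act Hsigma _]sigma_Eplus linearD /=.
by rewrite [act Eplus (_ *: _)]linearZ.
Qed.

Lemma Zeps_EplusX n l (p : M) : act (Zeps eps) p = l *: p ->
  act (Zeps eps) (act (Eplus ^+ n) p) = l *: act (Eplus ^+ n) p.
Proof.
move=> Ep; rewrite act_iter; elim: n => //= n IHn.
by rewrite Zeps_Eplus IHn linearZ.
Qed.

Lemma raised_eigenvector n l (p : M) : listed eps l p ->
  eigenvector (Zeps eps) l (act (Eplus ^+ n) p).
Proof.
move=> /listed_harmonic[[p0 Ep] [k [hp fp]]]; split; last exact: Zeps_EplusX.
rewrite act_iter; exact: (iter_Ep_neq0 Em_Ep wt_Hd wt_Ep N_gt0 n hp fp p0).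
Qed.

(** The index type and the eigenvalues are arbitrary, which makes this predicate
    additive; the terms with other eigenvalues are removed at the end. *)
Definition generated (p : M) : Prop :=
  exists (J : finType) (a l : J -> C) (n : J -> nat) (q : J -> M),
    (forall t, listed eps (l t) (q t)) /\ p = \sum_t a t *: act (Eplus ^+ n t) (q t).

Lemma generatedD p p' : generated p -> generated p' -> generated (p + p').
Proof.
move=> [J [a [l [n [q [lq ->]]]]]] [J' [a' [l' [n' [q' [lq' ->]]]]]].
pose mix T (f : J -> T) (f' : J' -> T) (t : J + J') : T :=
  match t with inl x => f x | inr x => f' x end.
exists (J + J')%type, (mix _ a a'), (mix _ l l'), (mix _ n n'), (mix _ q q').
by split; [case | rewrite big_sumType].
Qed.

Lemma generated_harmonic d n (h : M) :
  hom d h -> act Eminus h = 0 -> generated (iter n (act Eplus) h).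
Proof.
move=> hh h0; rewrite -act_iter; case: d hh => [|d] hh.
  have /harmonic0P[v ->] : harmonic 0 h by [].
  have i0 : 'I_(dimV tau) by case: (tau) => [||u|u]; exact: ord0.
  have [->|v0] := eqVneq v 0.
    exists 'I_0, (fun=> 0), (fun=> 0), (fun=> 0%N), (fun=> 0); split; first by case.
    by rewrite big_ord0 tens0r linear0.
  exists 'I_1, (fun=> 1), (fun=> lam0 m c tau eps i0), (fun=> n), (fun=> tens 1 v); split.
    by move=> t; exact: listed0.
  by rewrite big_ord1 scale1r.
have [x ->] := hvec_span m_gt0 c_inv tau_irr formZl form_conj form_gt0 form_Eplus
  form_Z0 (ltn0Sn d) eps (conj hh h0).
exists ('I_(dimV tau) * bool)%type, x, (fun ib => lam m c tau eps d.+1 ib.1 ib.2),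
  (fun=> n), (fun ib => hvec m c tau eps d.+1 ib.1 ib.2); split.
  by move=> ib; exact: listedS.
by rewrite linear_sum; apply: eq_bigr => ib _; rewrite linearZ.
Qed.

(** [wt_strings] reduces this to raised harmonics, which the eigenbasis of each
    degree handles. *)
Lemma generated_all (p : M) : generated p.
Proof.
apply: (finite_sum_all p); first exact: generatedD.
apply: (wt_strings (Em := act Eminus) (Ep := act Eplus) (wt := hom)); last 2 first.
- exact: generatedD.
- exact: generated_harmonic.
move=> d q hq; have [q' lq' E] := Proj_low hq.
exists (Proj d q), (- q'); split.
- by have [] := Proj_harmonic m_gt0 c_inv tau_irr formZl form_conj form_gt0 form_Eplus hq.
- by have [] := Proj_harmonic m_gt0 c_inv tau_irr formZl form_conj form_gt0 form_Eplus hq.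
- by case: d {hq E} lq' => [|[|d]] /= => [->|->|/(homZ (-1))]; rewrite ?oppr0 ?scaleN1r.
by rewrite E linearN addrK.
Qed.

(** In an eigenvector, only the terms with its own eigenvalue contribute. *)
Lemma eigenvector_generated l (p : M) : eigenvector (Zeps eps) l p ->
  exists (r : nat) (a : 'I_r -> C) (n : 'I_r -> nat) (q : 'I_r -> M),
    (forall t, listed eps l (q t)) /\
    p = \sum_t a t *: act (Eplus ^+ n t) (q t).
Proof.
move=> [_]; have [J [a [k [n [q [lq ->]]]]]] := generated_all p => E.
have Eq t : act (Zeps eps) (a t *: act (Eplus ^+ n t) (q t)) =
    k t *: (a t *: act (Eplus ^+ n t) (q t)).
  have [[_ Et] _] := listed_harmonic (lq t).
  by rewrite linearZ /= (Zeps_EplusX _ Et) !scalerA mulrC.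
have -> := eigen_filter Eq E; pose A := [pred t | k t == l].
exists #|A|, (a \o enum_val), (n \o enum_val), (q \o enum_val); split.
  by move=> t; have /eqP <- := enum_valP t.
exact: (big_enum_val (A := A) (fun t => a t *: act (Eplus ^+ n t) (q t))).
Qed.

End Generation.

Theorem theorem4p3 (R : realType) (m : nat) (m_gt0 : (0 < m)%N)
    (c : 'M[R]_2 -> R) (c_inv : conj_invariant m c)
    (eps : R) (tau : irrep) (tau_irr : is_irrep m tau)
    (Mc_irr : irreducible_module m c tau) (Mc_unit : unitarisable m c tau) :
  (* degree k > 0 *)
  (forall k : nat, (0 < k)%N ->
    [/\ (* the eigenvalues on the harmonics of degree k *)
        forall l : R[i],
          (exists2 p : Mc m c tau, harmonic k p & eigenvector (Zeps eps) l p) <->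
          (exists i b, l = lam m c tau eps k i b),
        (* the corresponding eigenvectors *)
        forall i b,
          harmonic k (hvec m c tau eps k i b) /\
          eigenvector (Zeps eps) (lam m c tau eps k i b)
            (hvec m c tau eps k i b : Mc m c tau),
        (* form a basis of the harmonics of degree k *)
        forall p : Mc m c tau, harmonic k p ->
          exists! a : {ffun 'I_(dimV tau) * bool -> R[i]},
            p = \sum_ib a ib *: hvec m c tau eps k ib.1 ib.2 &
        (* Proj k is a projection onto the harmonics of degree k *)
        (forall p : Mc m c tau, homogeneous k p -> harmonic k (Proj k p)) /\
        (forall p : Mc m c tau, harmonic k p -> Proj k p = p)]) /\
  (* degree 0 *)
  ((forall p : Mc m c tau, harmonic 0 p <-> exists v, p = tens 1 v) /\
   (forall i (v : 'cV[R[i]]_(dimV tau)), v != 0 ->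
      eigenvector (Zeps eps) (lam0 m c tau eps i) (tens 1 v : Mc m c tau))) /\
  (* all other eigenvectors *)
  ((forall (n : nat) l (p : Mc m c tau), listed eps l p ->
      eigenvector (Zeps eps) l (act (Eplus ^+ n) p)) /\
   (forall l (p : Mc m c tau), eigenvector (Zeps eps) l p ->
      exists (r : nat) (a : 'I_r -> R[i]) (n : 'I_r -> nat)
             (q : 'I_r -> Mc m c tau),
        (forall t, listed eps l (q t)) /\
        p = \sum_t a t *: act (Eplus ^+ n t) (q t))).
Proof.
have [form [fZ fC f0 [fE fT]]] := invariant_form Mc_unit.
split; [move=> k k0; split|split; split].
- move=> l; split=> [[p hp Ep]|[i [b ->]]].
    exact: (harmonic_eigenvalue m_gt0 c_inv tau_irr fZ fC f0 fE fT k0 hp Ep).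
  exists (hvec m c tau eps k i b); last exact: (hvec_eigenvector m_gt0 c_inv tau_irr fZ fC f0 fE fT k0).
  exact: (hvec_harmonic m_gt0 c_inv tau_irr fZ fC f0 fE).
- move=> i b; split; first exact: (hvec_harmonic m_gt0 c_inv tau_irr fZ fC f0 fE).
  exact: (hvec_eigenvector m_gt0 c_inv tau_irr fZ fC f0 fE fT k0).
- move=> p hp; have [x px] := hvec_span m_gt0 c_inv tau_irr fZ fC f0 fE fT k0 eps hp.
  exists x; split=> // y py.
  apply/ffunP => ib; apply/eqP; rewrite -subr_eq0; apply/eqP.
  have /ffunP/(_ ib) : [ffun ib => x ib - y ib] = [ffun => 0] :> {ffun _ -> R[i]}.
    apply: (hvec_free m_gt0 c_inv tau_irr fZ fC f0 fE fT k0 (eps := eps)).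
    under eq_bigr do rewrite ffunE scalerBl.
    by rewrite sumrB -px -py subrr.
  by rewrite !ffunE.
- split=> p; first exact: (Proj_harmonic m_gt0 c_inv tau_irr fZ fC f0 fE).
  by move=> [_ p0]; exact: Proj_id.
- exact: harmonic0P.
- by move=> i v; exact: (tens1_eigenvector m_gt0 c_inv tau_irr).
- move=> n l p; exact: (raised_eigenvector m_gt0 c_inv tau_irr fZ fC f0 fE fT).
- move=> l p; exact: (eigenvector_generated m_gt0 c_inv tau_irr fZ fC f0 fE fT).
Qed.
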